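(* Let $\mu$ be a doubling measure on $\mathbb{R}^n$ with support $\Sigma$. Let $1<\lambda_1<\lambda_2<\infty$ be given, let $\alpha_{\mathcal G}(x,r)$ be defined as in the context, set $$\alpha_{\mathcal G}^\ast(x,r)=\frac{1}{\mu(B(x,r))}\int_{B(x,r)}\frac1r\int_r^{2r}\alpha_{\mathcal G}(y,t)\,dt\,d\mu(y)\qquad(x\in\Sigma,\ r>0),$$ and let $$\Sigma_0=\Big\{x\in\Sigma:\ \lim_{r\to0}\alpha_{\mathcal G}^\ast(x,r)=0\Big\}.$$ Then $\mathrm{Tan}(\mu,x)\subset\mathcal F$ for every $x\in\Sigma_0$; that is, every tangent measure to $\mu$ at every point of $\Sigma_0$ is flat.
   Context: $B(x,r)$ is the open ball in $\mathbb{R}^n$ and $\mathbb{B}=B(0,1)$. A Radon measure $\mu$ on $\mathbb{R}^n$ is a locally finite positive Borel measure; its support is $\Sigma=\{x\in\mathbb{R}^n:\mu(B(x,r))>0\text{ for all }r>0\}$. $\mu$ is doubling if it is Radon and there is a constant $C_\delta>0$ with $\mu(B(x,2r))\le C_\delta\,\mu(B(x,r))$ for all $x\in\Sigma$, $r>0$. $\mathrm{Lip}_1(\mathbb{B})$ is the set of $1$-Lipschitz functions $\psi:\mathbb{R}^n\to\mathbb{R}$ with $\psi=0$ on $\mathbb{R}^n\setminus\mathbb{B}$. For measures $\mu,\nu$ whose restrictions to $\mathbb{B}$ are probability measures, $\mathbb{W}_1(\mu,\nu)=\sup_{\psi\in\mathrm{Lip}_1(\mathbb{B})}\left|\int\psi\,d\mu-\int\psi\,d\nu\right|$.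 $\mathcal R$ is the group of affine isometries of $\mathbb{R}^n$; $\mathcal G=\{\lambda R:\lambda>0,\ R\in\mathcal R\}$, and for $G\in\mathcal G$, $\lambda(G)>0$ is the unique number with $G=\lambda(G)R$, $R\in\mathcal R$. For $x\in\mathbb{R}^n$, $r>0$, $\mathcal G(x)=\{G\in\mathcal G:G(x)=0\}$ and $\mathcal G(x,r)=\{G\in\mathcal G(x):\lambda_1r\le\lambda(G)^{-1}\le\lambda_2r\}$. For $G\in\mathcal G$, $\mu^G(A)=\mu(G^{-1}(A))$ for Borel $A$; for $x\in\Sigma$ and $G\in\mathcal G(x)$, $\mu_0^G=\mu^G/\mu^G(\mathbb{B})$. Also $\mu^{x,r}(A)=\mu(x+rA)$ and $\mu_0^{x,r}=\mu^{x,r}/\mu(B(x,r))$. For $x\in\Sigma$, $r>0$, $\alpha_{\mathcal G}(x,r)=\inf_{G\in\mathcal G(x,r)}\mathbb{W}_1(\mu_0^G,\mu_0^{x,r})$. $\mathrm{Tan}(\mu,x)$ is the set of non-zero Radon measures $\sigma$ for which there exist $r_k>0$ with $r_k\to0$ and $a_k\ge0$ such that $a_k\mu^{x,r_k}\to\sigma$ weakly, i.e. $\int f\,d\sigma=\lim_k a_k\int f\,d\mu^{x,r_k}$ for every continuous compactly supported $f$. For $0\le d\le n$, $\mathcal F_d$ is the set of measures $c\,\mathcal H^d|_V$ with $c\ge0$ and $V$ a $d$-dimensional vector subspace of $\mathbb{R}^n$ ($\mathcal H^d$ is $d$-dimensional Hausdorff measure); $\mathcal F=\bigcup_{0\le d\le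 n}\mathcal F_d$ is the set of flat measures. *)

(* Defs.v *)
From HB Require Import structures.
From mathcomp Require Import all_boot all_order all_algebra.
From mathcomp Require Import all_classical all_reals all_analysis.

Set Implicit Arguments.
Unset Strict Implicit.
Unset Printing Implicit Defensive.
Import Order.TTheory GRing.Theory Num.Theory.
Import numFieldNormedType.Exports.

Local Open Scope classical_set_scope.
Local Open Scope ring_scope.

(* R^n is 'rV[R]_n. Its library norm is the max norm, hence [enorm] below; both
   norms induce the same topology, so [open], [compact], [continuous] and the
   Borel sets are the usual ones. *)
Notation borel R n := (g_sigma_algebraType (open : set (set 'rV[R]_n))).

Section euclidean.
Context {R : realType} {n : nat}.
Implicit Types (x y : 'rV[R]_n) (r : R).

Definition enorm x : R := Num.sqrt (\sum_(i < n) x 0 i ^+ 2).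

Definition eball x r : set 'rV[R]_n := [set y | enorm (y - x) < r].

Definition unit_eball : set 'rV[R]_n := eball 0 1.

Definition affine_isometry (f : 'rV[R]_n -> 'rV[R]_n) : Prop :=
  (exists (A : 'M[R]_n) (b : 'rV[R]_n), forall x, f x = x *m A + b) /\
  (forall x y, enorm (f x - f y) = enorm (x - y)).

(* G = lam R for an affine isometry R; for n > 0, G determines lam. *)
Definition similarity (lam : R) (G : 'rV[R]_n -> 'rV[R]_n) : Prop :=
  0 < lam /\
  exists2 f, affine_isometry f & forall x, G x = lam *: f x.

Definition similarities_at (l1 l2 : R) x r : set ('rV[R]_n -> 'rV[R]_n) :=
  [set G | exists lam : R,
     [/\ similarity lam G, G x = 0 & l1 * r <= lam^-1 <= l2 * r]].

Definition Lip1 : set ('rV[R]_n -> R) :=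
  [set psi | (forall x y, `|psi x - psi y| <= enorm (x - y)) /\
             (forall x, ~ unit_eball x -> psi x = 0)].

End euclidean.

Local Open Scope ereal_scope.

Section hausdorff.
Context {R : realType} {n : nat}.
Implicit Types (A E : set 'rV[R]_n) (d : nat).

(* Only meaningful for E nonempty: the supremum of the empty set is -oo. *)
Definition ediam E : \bar R :=
  ereal_sup [set (enorm (x - y))%:E | x in E & y in E].

(* diam(E)^d, with 0 for the empty set and diam(E)^0 = 1 otherwise *)
Definition diam_pow d E : \bar R :=
  if `[< E = set0 >] then 0 else ediam E ^+ d.

Definition hausdorff_delta d (delta : R) A : \bar R :=
  ereal_inf [set \sum_(i <oo) diam_pow d (E i) | E in
    [set E : nat -> set 'rV[R]_n |
      A `<=` \bigcup_i E i /\ forall i, ediam (E i) <= delta%:E]].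

(* Without the factor 2^-d omega_d that some authors include: flat measures
   carry an arbitrary constant. *)
Definition hausdorff d A : \bar R :=
  ereal_sup [set hausdorff_delta d delta A | delta in [set e : R | (0 < e)%R]].

End hausdorff.

Section measures.
Context {R : realType} {n : nat}.
Notation measureRn := {measure set (borel R n) -> \bar R}.
Implicit Types (mu sigma : measureRn) (x : 'rV[R]_n) (r : R).

Definition radon mu : Prop :=
  forall x, exists2 r, (0 < r)%R & mu (eball x r) < +oo.

Definition msupport mu : set 'rV[R]_n :=
  [set x | forall r, (0 < r)%R -> 0 < mu (eball x r)].

Definition doubling mu : Prop :=
  radon mu /\
  exists2 C : R, (0 < C)%R & forall x r, msupport mu x -> (0 < r)%R ->
    mu (eball x (2 * r)) <= C%:E * mu (eball x r).

(* mu and nu are plain set functions so that the integrals can be written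
   for rescaled measures without a measure structure on them. *)
Definition W1 (mu nu : set (borel R n) -> \bar R) : \bar R :=
  ereal_sup [set `| \int[mu]_x (psi x)%:E - \int[nu]_x (psi x)%:E |
            | psi in Lip1].

(* mu^G / mu^G(B); here and in [blowup0] the quotient is meaningful for centres
   in the support, whose complement is mu-null in [alphaG_star]. *)
Definition image0 mu (G : 'rV[R]_n -> 'rV[R]_n) (A : set (borel R n)) : \bar R :=
  let muG := pushforward mu (G : borel R n -> borel R n) in
  ((fine (muG unit_eball))^-1)%:E * muG A.

(* A |-> mu (x + r A) *)
Definition blowup mu x r (A : set (borel R n)) : \bar R :=
  mu [set (x + r *: y)%R | y in A].

Definition blowup0 mu x r (A : set (borel R n)) : \bar R :=
  ((fine (mu (eball x r)))^-1)%:E * blowup mu x r A.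

Definition alphaG mu (l1 l2 : R) x r : \bar R :=
  ereal_inf [set W1 (image0 mu G) (blowup0 mu x r)
            | G in similarities_at l1 l2 x r].

Definition alphaG_star mu (l1 l2 : R) x r : \bar R :=
  ((fine (mu (eball x r)))^-1)%:E *
  \int[mu]_(y in eball x r)
    ((r^-1)%:E *
     \int[@lebesgue_measure R]_(t in `[r, (2 * r)%R]) alphaG mu l1 l2 y t).

Definition Sigma0 mu (l1 l2 : R) : set 'rV[R]_n :=
  [set x | msupport mu x /\ alphaG_star mu l1 l2 x r @[r --> 0^'+] --> 0].

Definition Tan mu x : set measureRn :=
  [set sigma | [/\ radon sigma,
    exists2 A : set (borel R n), measurable A & sigma A != 0 &
    exists rk ak : nat -> R,
      [/\ forall k, (0 < rk k)%R, rk k @[k --> \oo] --> (0 : R)%R,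
          forall k, (0 <= ak k)%R &
          forall f : 'rV[R]_n -> R, continuous f ->
            compact (closure [set y | f y != 0%R]) ->
            (ak k)%:E * \int[blowup mu x (rk k)]_y (f y)%:E @[k --> \oo]
              --> \int[sigma]_y (f y)%:E]]].

Definition flat_dim (d : nat) : set measureRn :=
  [set sigma | exists (c : R) (V : {vspace 'rV[R]_n}),
    [/\ (0 <= c)%R, \dim V = d &
        forall A : set (borel R n), measurable A ->
          sigma A = c%:E * hausdorff d (A `&` [set y | y \in V])]].

Definition flat : set measureRn :=
  \bigcup_(d in [set d : nat | (d <= n)%N]) flat_dim d.

End measures.

(* Main.v *)
(** A contradiction argument at the scale of the blow-ups shows that, for a
    tangent measure [sigma] and a point [y] of its support, some similarity of
    ratio in [[1/l2, 1/l1]] fixing [y] maps [sigma] to a multiple of itself. Let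
    [G] be the closed group of all similarities with this last property. The
    origin is in the support; let [B] be the linear part of its contraction.
    Conjugating by powers of the contraction [h] at [y], along powers whose
    rotation part is almost the identity, gives in the limit the element
    [v |-> (v - y) B + y] of [G], and so the translation by [y - y B]. The
    translations by [y B^k - y B^(k+1)] add up to the translation by [y], and
    integer multiples of the small vectors [y B^k] approximate every [t y].
    Since conjugation by [B] preserves the factor of a translation and shrinks
    its vector, the translations in [G] preserve [sigma]. Hence [sigma] is
    carried by the span [V] of its support and is invariant under [V]; comparing
    it with the Hausdorff measure on small boxes of [V] identifies the two up to
    a constant. *)
Require Import Defs.
From HB Require Import structures.
From mathcomp Require Import all_boot all_order all_algebra.
From mathcomp Require Import all_classical all_reals all_analysis.
From mathcomp Require Import finmap measurable_realfun.
From mathcomp Require Import ring lra.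
Import Order.TTheory GRing.Theory Num.Theory.
Import numFieldNormedType.Exports.
Local Open Scope classical_set_scope.
Local Open Scope ring_scope.
Set Implicit Arguments.
Unset Strict Implicit.
Unset Printing Implicit Defensive.


(** * The Euclidean norm and the topology of the row space *)

Section enorm_theory.
Context {R : realType} {n : nat}.
Implicit Types (x y z : 'rV[R]_n) (r : R).

(** The contractions at two points of the support have unrelated rotation parts, so their quotient
    need not be a translation; this is why the linear part [B] found at the origin is carried over
    to every other point of the support. The bound [1 < l1] makes the ratios at most [l1^-1 < 1],
    and [l2] keeps them away from 0. Doubling keeps the normalising factors away from 0 in the
    limit, and also puts the origin in the support of [sigma]. Everything is tested on Lipschitz
    functions of bounded support: these are what [W1] controls, and they determine a Radon measure.
    Limits of maps and factors are taken along an ultrafilter on the integers, in place of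
    extracting subsequences. Averages of [alphaG] are only bounded below, through monotonicity of
    the lower integral. Likewise [hausdorff] enters only through subadditivity and its behaviour
    under Lipschitz maps: this yields one inequality for open sets, regularity of [sigma] extends it
    to Borel sets, and complements in large boxes, where equality holds, yield the reverse one. *)

Lemma enorm_ge0 x : 0 <= enorm x.
Proof. exact: sqrtr_ge0. Qed.

Lemma sqr_enorm x : enorm x ^+ 2 = \sum_(i < n) x 0 i ^+ 2.
Proof. by rewrite sqr_sqrtr// sumr_ge0// => i _; exact: sqr_ge0. Qed.

Lemma enorm0 : enorm (0 : 'rV[R]_n) = 0.
Proof. by rewrite /enorm big1 ?sqrtr0// => i _; rewrite mxE expr0n. Qed.

Lemma enormZ (a : R) x : enorm (a *: x) = `|a| * enorm x.
Proof.
rewrite /enorm -sqrtr_sqr -sqrtrM ?sqr_ge0// mulr_sumr.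
by congr Num.sqrt; apply: eq_bigr => i _; rewrite mxE exprMn.
Qed.

Lemma enormN x : enorm (- x) = enorm x.
Proof. by rewrite -scaleN1r enormZ normrN1 mul1r. Qed.

Lemma enormB x y : enorm (x - y) = enorm (y - x).
Proof. by rewrite -enormN opprB. Qed.

Lemma normr_coord_le x i : `|x 0 i| <= enorm x.
Proof.
rewrite -(ler_pXn2r (ltn0Sn 1)) ?nnegrE ?enorm_ge0//.
by rewrite sqr_enorm real_normK ?num_real// (bigD1 i)//= lerDl sumr_ge0// => j _; exact: sqr_ge0.
Qed.

Lemma enorm_eq0 x : enorm x = 0 -> x = 0.
Proof.
move=> x0; apply/rowP => i; rewrite mxE; apply/eqP; rewrite -normr_le0 -x0.
exact: normr_coord_le.
Qed.

Lemma enorm_gt0 x : x != 0 -> 0 < enorm x.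
Proof.
by move=> x0; rewrite lt_neqAle enorm_ge0 andbT; apply: contra x0 => /eqP/esym/enorm_eq0 ->.
Qed.

(** For nonzero vectors, the squared norm of [enorm y *: x - enorm x *: y] is
    [2 * enorm x * enorm y] times the difference of the two sides. *)
Lemma cauchy_schwarz x y : \sum_(i < n) x 0 i * y 0 i <= enorm x * enorm y.
Proof.
have [->|x0] := eqVneq x 0.
  by rewrite enorm0 mul0r big1// => i _; rewrite mxE mul0r.
have [->|y0] := eqVneq y 0.
  by rewrite enorm0 mulr0 big1// => i _; rewrite mxE mulr0.
have a0 := enorm_gt0 x0; have b0 := enorm_gt0 y0.
have : 0 <= \sum_(i < n) (enorm y * x 0 i - enorm x * y 0 i) ^+ 2.
  by apply: sumr_ge0 => i _; exact: sqr_ge0.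
have -> : \sum_(i < n) (enorm y * x 0 i - enorm x * y 0 i) ^+ 2 =
  2 * (enorm x * enorm y) * (enorm x * enorm y - \sum_(i < n) x 0 i * y 0 i).
  transitivity (enorm y ^+ 2 * (\sum_(i < n) x 0 i ^+ 2) +
    enorm x ^+ 2 * (\sum_(i < n) y 0 i ^+ 2)
    - 2 * (enorm x * enorm y) * \sum_(i < n) x 0 i * y 0 i); last first.
    by rewrite -!sqr_enorm; ring.
  rewrite !mulr_sumr -!big_split /= -sumrB; apply: eq_bigr => i _; ring.
by rewrite pmulr_rge0 ?subr_ge0// ?mulr_gt0.
Qed.

Lemma enormD x y : enorm (x + y) <= enorm x + enorm y.
Proof.
rewrite -(ler_pXn2r (ltn0Sn 1)) ?nnegrE ?addr_ge0 ?enorm_ge0// sqrrD !sqr_enorm.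
have := cauchy_schwarz x y.
suff -> : \sum_(i < n) (x + y) 0 i ^+ 2 = \sum_(i < n) x 0 i ^+ 2 +
   2 * \sum_(i < n) x 0 i * y 0 i + \sum_(i < n) y 0 i ^+ 2 by lra.
rewrite mulr_sumr -!big_split /=; apply: eq_bigr => i _; rewrite mxE; ring.
Qed.

Lemma enorm_distD z x y : enorm (x - y) <= enorm (x - z) + enorm (z - y).
Proof. by rewrite (le_trans _ (enormD _ _))// addrA subrK. Qed.

Lemma enorm_dist_dist x y : `|enorm x - enorm y| <= enorm (x - y).
Proof.
rewrite ler_norml; apply/andP; split.
  by have := enormD (y - x) x; rewrite subrK (enormB y); lra.
by have := enormD (x - y) y; rewrite subrK; lra.
Qed.

Lemma enorm_le_sum x : enorm x <= \sum_(i < n) `|x 0 i|.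
Proof.
rewrite -(ler_pXn2r (ltn0Sn 1)) ?nnegrE ?enorm_ge0 ?sumr_ge0//.
rewrite sqr_enorm expr2 mulr_suml ler_sum// => i _.
rewrite -real_normK ?num_real// expr2 ler_wpM2l//.
by rewrite (bigD1 i)//= lerDl sumr_ge0.
Qed.

Lemma ball_rVP x r y : ball x r y <-> 0 < r /\ forall i, `|x 0 i - y 0 i| < r.
Proof.
split=> [[r0 H]|[r0 H]]; split=> //.
- by move=> i; exact: H.
- by move=> i j; rewrite (ord1 i); exact: H.
Qed.

Lemma nbhs_eball x r : 0 < r -> nbhs x (eball x r).
Proof.
(* The Euclidean norm is at most the sum of [n] coordinates, each below [r / (n + 1)]. The [+ 1]
   makes the final inequality strict and covers [n = 0]. *)
move=> r0; apply/nbhs_ballP; exists (r / (n%:R + 1)) => /=; first by rewrite divr_gt0.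
move=> y /ball_rVP[_ H]; rewrite /eball/= enormB.
apply: le_lt_trans (enorm_le_sum _) _.
apply: (@le_lt_trans _ _ (\sum_(i < n) r / (n%:R + 1))).
  by apply: ler_sum => i _; rewrite !mxE; apply: ltW.
rewrite sumr_const card_ord -[_ *+ n]mulr_natr mulrAC ltr_pdivrMr ?ltr_wpDl//.
by rewrite ltr_pM2l// ltrDl.
Qed.

Lemma nbhs_eballP x (A : set 'rV[R]_n) :
  nbhs x A <-> exists2 r, 0 < r & eball x r `<=` A.
Proof.
split=> [/nbhs_ballP[r /= r0 rA]|[r r0 rA]]; last exact: (@filterS _ _ (nbhs_filter x) _ _ rA (nbhs_eball x r0)).
exists r => // y xyr; apply: rA; apply/ball_rVP; split=> // i.
have := normr_coord_le (x - y) i; rewrite !mxE => /le_lt_trans; apply.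
by rewrite enormB.
Qed.

Lemma open_eball x r : open (eball x r).
Proof.
rewrite openE => y /= xyr; apply/nbhs_eballP; exists (r - enorm (y - x)).
  by rewrite subr_gt0.
by move=> z /=; rewrite /eball/= ltrBrDr; apply: le_lt_trans; exact: enorm_distD.
Qed.

Lemma eball_sub x y r s : enorm (y - x) + s <= r -> eball y s `<=` eball x r.
Proof.
move=> yx z; rewrite /eball/= => zy.
have := enorm_distD y z x; lra.
Qed.

Lemma bounded_eball_sub (A : set 'rV[R]_n) r : (forall x, A x -> enorm x <= r) -> bounded_set A.
Proof.
move=> Ar; exists r; split; first exact: num_real.
move=> M rM x /Ar xr; apply: (le_trans _ (ltW rM)); apply: le_trans xr.
rewrite {1}/Num.norm/= mx_normrE; apply/bigmax_leP; split; first exact: enorm_ge0.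
by move=> [i j] _ /=; rewrite (ord1 i); exact: normr_coord_le.
Qed.

Lemma compact_ebounded (A : set 'rV[R]_n) r :
  closed A -> (forall x, A x -> enorm x <= r) -> compact A.
Proof. by move=> cA Ar; apply: bounded_closed_compact => //; exact: (bounded_eball_sub Ar). Qed.

Lemma continuous_elipschitz (f : 'rV[R]_n -> R) (L : R) :
  (forall x y, `|f x - f y| <= L * enorm (x - y)) -> continuous f.
Proof.
move=> fL x A /nbhs_ballP[e /= e0 eA].
have L1 : 0 < `|L| + 1 by rewrite ltr_wpDl.
apply/nbhs_eballP; exists (e / (`|L| + 1)); first by rewrite divr_gt0.
move=> y /=; rewrite /eball/= ltr_pdivlMr// => xy; apply: eA; rewrite /ball/=; apply: le_lt_trans (fL _ _) _; rewrite enormB.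
apply: le_lt_trans xy; rewrite mulrC ler_wpM2l ?enorm_ge0//.
by rewrite (le_trans (ler_norm _))// lerDl.
Qed.

Lemma continuous_enorm : continuous (@enorm R n).
Proof.
by apply: (@continuous_elipschitz _ 1) => x y; rewrite mul1r; exact: enorm_dist_dist.
Qed.

Lemma closed_enorm_le r : closed [set x : 'rV[R]_n | enorm x <= r].
Proof.
apply: (@closed_comp _ _ (@enorm R n) [set t | t <= r]); last exact: closed_le.
by move=> x _; exact: continuous_enorm.
Qed.

Lemma compact_eball r : compact [set x : 'rV[R]_n | enorm x <= r].
Proof. by apply: (@compact_ebounded _ r) => //; exact: closed_enorm_le. Qed.

Lemma measurable_open (U : set (borel R n)) : open (U : set 'rV[R]_n) -> measurable U.
Proof. by move=> oU; apply: sub_sigma_algebra. Qed.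

Lemma measurable_closed (U : set (borel R n)) : closed (U : set 'rV[R]_n) -> measurable U.
Proof.
by move=> cU; rewrite -[U]setCK; apply: measurableC; apply: measurable_open; exact: closed_openC.
Qed.

Lemma measurable_eball x r : measurable (eball x r : set (borel R n)).
Proof. by apply: measurable_open; exact: open_eball. Qed.

Lemma measurable_borel_real (f : 'rV[R]_n -> R) :
  continuous f -> measurable_fun setT (f : borel R n -> R).
Proof.
move=> cf; apply: (measurability _ (RGenOInfty.measurableE R)) => //.
move=> _ [_ [a ->] <-]; rewrite setTI; apply: measurable_open.
by move/continuousP: cf; apply; exact: interval_open.
Qed.

Lemma measurable_borel_rV (f : 'rV[R]_n -> 'rV[R]_n) :
  continuous f -> measurable_fun setT (f : borel R n -> borel R n).
Proof.
move=> cf; apply: (@measurability _ _ (borel R n) (borel R n) _ _ (open : set (set 'rV[R]_n))) => //.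
move=> _ [U oU <-]; rewrite setTI; apply: measurable_open.
by move/continuousP: cf; apply.
Qed.

End enorm_theory.
#[global] Hint Resolve enorm_ge0 measurable_eball : core.

(** * Lipschitz test functions of bounded support *)

Section test_functions.
Context {R : realType} {n : nat}.
Implicit Types (x y z : 'rV[R]_n) (r : R) (phi psi chi : 'rV[R]_n -> R).

Definition lipschitz_with L phi := forall x y, `|phi x - phi y| <= L * enorm (x - y).

(** Lipschitz functions are those seen by [W1]; bounded support makes them integrable for a Radon
    measure, and non-negativity lets their integrals be handled without integrability conditions. *)
Definition test_fun phi := [/\ forall x, 0 <= phi x,
  exists2 L, 0 <= L & lipschitz_with L phi &
  exists M, forall x, M <= enorm x -> phi x = 0].

Definition cutoff M x : R := Num.max 0 (Num.min 1 (M + 1 - enorm x)).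

(** A cone over the ball of radius [r] about [y], used in place of the indicator of the ball: for a
    Radon measure its integral is positive for every [r > 0] exactly when [y] is in the support, and
    a dilation pulls it back to a multiple of another tent. *)
Definition tent y r x : R := Num.max 0 (r - enorm (x - y)).

Lemma maxr0_lip (a b : R) : `|Num.max 0 a - Num.max 0 b| <= `|a - b|.
Proof.
by have [?|?] := leP 0 a; have [?|?] := leP 0 b; rewrite ler_norml; apply/andP; split;
  have := ler_norm (a - b); have := ler_norm (b - a); rewrite (distrC b); lra.
Qed.

Lemma minr1_lip (c a b : R) : `|Num.min c a - Num.min c b| <= `|a - b|.
Proof.
by have [?|?] := leP c a; have [?|?] := leP c b; rewrite ler_norml; apply/andP; split;
  have := ler_norm (a - b); have := ler_norm (b - a); rewrite (distrC b); lra.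
Qed.

Lemma minr_lip (a b c d K : R) : `|a - c| <= K -> `|b - d| <= K ->
  `|Num.min a b - Num.min c d| <= K.
Proof.
rewrite !ler_norml => /andP[? ?] /andP[? ?].
by have [?|?] := leP a b; have [?|?] := leP c d; apply/andP; split; lra.
Qed.

Lemma test_cutoff M : test_fun (cutoff M).
Proof.
split; first by move=> x; rewrite /cutoff le_max lexx.
- exists 1 => // x y; rewrite mul1r (le_trans (maxr0_lip _ _))//.
  rewrite (le_trans (minr1_lip _ _ _))// opprB addrC addrA addrNK.
  by rewrite enormB; exact: enorm_dist_dist.
- exists (M + 1) => x Mx; rewrite /cutoff; apply/max_idPl.
  by rewrite ge_min subr_le0 Mx orbT.
Qed.

Lemma cutoff_eq1 M x : enorm x <= M -> cutoff M x = 1.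
Proof.
move=> xM; rewrite /cutoff min_l ?max_r//; lra.
Qed.

Lemma cutoff_ge0 M x : 0 <= cutoff M x.
Proof. by rewrite /cutoff le_max lexx. Qed.

Lemma cutoff_le1 M x : cutoff M x <= 1.
Proof. by rewrite /cutoff ge_max ler01 ge_min lexx. Qed.

Lemma cutoff_eq0 M x : M + 1 <= enorm x -> cutoff M x = 0.
Proof.
by move=> Mx; rewrite /cutoff; apply/max_idPl; rewrite ge_min subr_le0 Mx orbT.
Qed.

Lemma test_tent y r : test_fun (tent y r).
Proof.
split; first by move=> x; rewrite /tent le_max lexx.
- exists 1 => // x z; rewrite mul1r (le_trans (maxr0_lip _ _))//.
  rewrite opprB addrC addrA addrNK; apply: le_trans (enorm_dist_dist _ _) _.
  by rewrite opprB addrA addrNK enormB.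
- exists (r + enorm y) => x Mx; rewrite /tent; apply/max_idPl.
  have := enorm_distD y x 0; rewrite !subr0; lra.
Qed.

Lemma lip_continuous L phi : lipschitz_with L phi -> continuous phi.
Proof. exact: continuous_elipschitz. Qed.

Lemma test_continuous phi : test_fun phi -> continuous phi.
Proof. by move=> [_ [L _ H] _]; exact: lip_continuous H. Qed.

Lemma test_measurable phi : test_fun phi -> measurable_fun setT (phi : borel R n -> R).
Proof. by move=> /test_continuous /measurable_borel_real. Qed.

Lemma test_emeasurable phi : test_fun phi ->
  measurable_fun setT (fun x : borel R n => (phi x)%:E).
Proof. by move=> /test_measurable mphi; apply/measurable_EFinP. Qed.

Lemma test_support phi : test_fun phi -> exists2 M, 0 < M & forall x, M <= enorm x -> phi x = 0.
Proof.
move=> [_ _ [M HM]]; exists (Num.max 1 M); first by rewrite lt_max ltr01.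
by move=> x; rewrite ge_max => /andP[_]; exact: HM.
Qed.

Lemma test_bounded phi : test_fun phi ->
  exists2 K, 0 <= K & exists2 M, 0 < M & forall x, phi x <= K * \1_(eball 0 M) x.
Proof.
move=> tphi; have [M M0 HM] := test_support tphi; case: tphi => p0 [L L0 HL] _.
exists (phi 0 + L * M); first by rewrite addr_ge0 ?mulr_ge0// ltW.
exists M => // x; have [xM|Mx] := ltP (enorm x) M.
  rewrite indicE mem_set ?mulr1; last by rewrite /eball/= subr0.
  have := HL x 0; rewrite subr0 => /(le_trans (ler_norm _)).
  rewrite lerBlDl => /le_trans; apply; rewrite lerD2l ler_wpM2l//; exact: ltW.
by rewrite HM// mulr_ge0 ?addr_ge0 ?mulr_ge0// ltW.
Qed.

Lemma testD phi psi : test_fun phi -> test_fun psi -> test_fun (fun x => phi x + psi x).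
Proof.
move=> [p0 [L L0 HL] [M HM]] [q0 [K K0 HK] [N HN]]; split.
- by move=> x; rewrite addr_ge0.
- exists (L + K); first by rewrite addr_ge0.
  move=> x y; rewrite opprD addrACA mulrDl (le_trans (ler_normD _ _))//.
  by rewrite lerD ?HL ?HK.
- exists (Num.max M N) => x; rewrite ge_max => /andP[? ?].
  by rewrite HM// HN// addr0.
Qed.

Lemma testZ a phi : 0 <= a -> test_fun phi -> test_fun (fun x => a * phi x).
Proof.
move=> a0 [p0 [L L0 HL] [M HM]]; split.
- by move=> x; rewrite mulr_ge0.
- exists (a * L); first by rewrite mulr_ge0.
  by move=> x y; rewrite -mulrBr normrM ger0_norm// -mulrA ler_wpM2l// HL.
- by exists M => x /HM ->; rewrite mulr0.
Qed.

Lemma compact_test_support phi : test_fun phi -> compact (closure [set x | phi x != 0]).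
Proof.
move=> /test_support[M M0 HM]; apply: (@compact_ebounded _ _ _ M).
  exact: closed_closure.
suff : closure [set x | phi x != 0] `<=` [set x | enorm x <= M] by [].
rewrite [X in _ `<=` X](_ : _ = closure [set x : 'rV[R]_n | enorm x <= M]); last first.
  by apply/closure_id; exact: closed_enorm_le.
apply: closureS => x /= px; rewrite leNgt; apply/negP => /ltW /HM px0.
by rewrite px0 eqxx in px.
Qed.

End test_functions.

(** * Integrals of test functions and supports of Radon measures *)

Section radon_measures.
Context {R : realType} {n : nat}.
Implicit Types (x y z : 'rV[R]_n) (r : R) (phi psi chi : 'rV[R]_n -> R).
Implicit Types m : {measure set (borel R n) -> \bar R}.

Lemma measurable_rindic (A : set (borel R n)) : measurable A ->
  measurable_fun setT (\1_A : borel R n -> R).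
Proof. by move=> mA; exact: measurable_indic. Qed.

Lemma measurable_eindic (A : set (borel R n)) : measurable A ->
  measurable_fun setT (fun x : borel R n => (\1_A x : R)%:E).
Proof. by move=> mA; apply/measurable_EFinP; exact: measurable_rindic. Qed.

Lemma measure_sub m (A B : set (borel R n)) : measurable A -> measurable B ->
  A `<=` B -> (m A <= m B)%E.
Proof. by move=> mA mB; apply: le_measure; rewrite ?mem_set. Qed.

(** Finitely many of the balls of finite mass given by local finiteness cover a compact ball about
    the origin that contains this one. *)
Lemma radon_ball m x r : radon m -> (m (eball x r) < +oo)%E.
Proof.
move=> rm; pose M := enorm x + r.
pose rr z := projT1 (cid2 (rm z)).
have rr0 z : 0 < rr z by rewrite /rr; case: cid2.
have mrr z : (m (eball z (rr z)) < +oo)%E by rewrite /rr; case: cid2.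
have := @compact_eball R n M; rewrite compact_cover.
move=> /(_ _ setT (fun z => eball z (rr z)))[].
- by move=> i _; exact: open_eball.
- by move=> z _; exists z => //; rewrite /eball/= subrr enorm0.
move=> D _ DM.
have /= := @content_sub_fsum _ _ (borel R n) m _ [set` D] (eball x r)
  (fun z => eball z (rr z)) (finite_fset D) (fun z _ => measurable_eball z (rr z))
  (measurable_eball x r).
move=> mD; apply: (@le_lt_trans _ _ _ _ _ (mD _)).
  move=> z; rewrite /eball/= => xz; apply: DM => /=.
    have := enorm_distD x z 0; rewrite !subr0 /M; lra.
rewrite fsbig_finite//=.
by apply: lte_sum_pinfty => i _.
Qed.

Definition tint m phi : R := fine (\int[m]_x (phi x)%:E).

Lemma tint_lty m phi : radon m -> test_fun phi -> (\int[m]_x (phi x)%:E < +oo)%E.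
Proof.
move=> rm tp; have [K K0 [M M0 HM]] := test_bounded tp.
apply: (@le_lt_trans _ _ (\int[m]_x (K%:E * (\1_(eball 0 M) x)%:E))%E).
  apply: ge0_le_integral => //.
  - by move=> x _; rewrite lee_fin; case: tp.
  - exact: test_emeasurable.
  - by apply/measurable_EFinP; apply: measurable_funM.
  - by move=> x _; rewrite lee_fin.
rewrite ge0_integralZl_EFin//.
- rewrite integral_indic// setIT; apply: lte_mul_pinfty => //.
  exact: radon_ball.
- exact: (measurable_eindic (measurable_eball _ _)).
Qed.

Lemma tintE m phi : radon m -> test_fun phi ->
  (\int[m]_x (phi x)%:E = (tint m phi)%:E)%E.
Proof.
move=> rm tp; rewrite /tint fineK// ge0_fin_numE ?tint_lty//.
by apply: integral_ge0 => x _; rewrite lee_fin; case: tp.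
Qed.

Lemma tint_ge0 m phi : test_fun phi -> 0 <= tint m phi.
Proof.
by move=> [p0 _ _]; apply: fine_ge0; apply: integral_ge0 => x _; rewrite lee_fin.
Qed.

Lemma tint_le m phi psi chi e : radon m -> test_fun phi -> test_fun psi -> test_fun chi ->
  0 <= e -> (forall x, phi x <= psi x + e * chi x) ->
  tint m phi <= tint m psi + e * tint m chi.
Proof.
move=> rm tp tq tc e0 H; rewrite -lee_fin EFinD EFinM -!tintE//.
rewrite -ge0_integralZl_EFin//; [|by case: tc => + _ _ x _; rewrite lee_fin|exact: test_emeasurable].
rewrite -ge0_integralD//; last 4 first.
- by case: tq => + _ _ x _; rewrite lee_fin.
- exact: test_emeasurable.
- by case: tc => + _ _ x _; rewrite -EFinM lee_fin => c0; rewrite mulr_ge0.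
- by apply: (test_emeasurable (phi := fun x => e * chi x)); exact: testZ.
apply: ge0_le_integral => //.
- by case: tp => + _ _ x _; rewrite lee_fin.
- exact: test_emeasurable.
- apply: (test_emeasurable (phi := fun x => psi x + e * chi x)); apply: testD => //; exact: testZ.
- by move=> x _; rewrite -EFinM -EFinD lee_fin.
Qed.

Lemma tint_mono m phi psi : radon m -> test_fun phi -> test_fun psi ->
  (forall x, phi x <= psi x) -> tint m phi <= tint m psi.
Proof.
move=> rm tp tq H; have := @tint_le m phi psi psi 0 rm tp tq tq (lexx _).
by rewrite mul0r addr0; apply => x; rewrite mul0r addr0.
Qed.

Lemma tintZ m a phi : radon m -> test_fun phi -> 0 <= a ->
  tint m (fun x => a * phi x) = a * tint m phi.
Proof.
move=> rm tp a0; apply: EFin_inj; rewrite -tintE//; last exact: testZ.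
rewrite EFinM -tintE// -ge0_integralZl_EFin//; last exact: test_emeasurable.
by case: tp => + _ _ x _; rewrite lee_fin.
Qed.

(** The pointwise error has to be dominated by a multiple of a test function, since constants need
    not be integrable. *)
Lemma tint_dist m phi psi chi e : radon m -> test_fun phi -> test_fun psi -> test_fun chi ->
  0 <= e -> (forall x, `|phi x - psi x| <= e * chi x) ->
  `|tint m phi - tint m psi| <= e * tint m chi.
Proof.
move=> rm tp tq tc e0 H.
have H1 : tint m phi <= tint m psi + e * tint m chi.
  by apply: tint_le => // x; have := H x; rewrite ler_norml => /andP[_]; lra.
have H2 : tint m psi <= tint m phi + e * tint m chi.
  by apply: tint_le => // x; have := H x; rewrite ler_norml => /andP[+ _]; lra.
by rewrite ler_norml; apply/andP; split; lra.
Qed.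

Lemma le_tint_ball m x r a phi : radon m -> test_fun phi -> 0 <= a ->
  (forall y, eball x r y -> a <= phi y) -> (a%:E * m (eball x r) <= (tint m phi)%:E)%E.
Proof.
move=> rm tp a0 H; rewrite -tintE//.
have -> : (a%:E * m (eball x r) = \int[m]_y (a%:E * (\1_(eball x r) y)%:E))%E.
  rewrite ge0_integralZl_EFin// ?integral_indic ?setIT//.
  exact: (measurable_eindic (measurable_eball _ _)).
apply: ge0_le_integral => //.
- by move=> y _; rewrite -EFinM lee_fin mulr_ge0.
- by apply/measurable_EFinP; apply: measurable_funM.
- exact: test_emeasurable.
move=> y _; rewrite -EFinM lee_fin indicE; case: (boolP (y \in _)) => [/set_mem /H|_].
  by rewrite mulr1.
by rewrite mulr0; case: tp.
Qed.

Lemma tint_le_ball m x r a phi : radon m -> test_fun phi -> 0 <= a ->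
  (forall y, phi y <= a) -> (forall y, ~ eball x r y -> phi y = 0) ->
  ((tint m phi)%:E <= a%:E * m (eball x r))%E.
Proof.
move=> rm tp a0 H H0; rewrite -tintE//.
have -> : (a%:E * m (eball x r) = \int[m]_y (a%:E * (\1_(eball x r) y)%:E))%E.
  rewrite ge0_integralZl_EFin// ?integral_indic ?setIT//.
  exact: (measurable_eindic (measurable_eball _ _)).
apply: ge0_le_integral => //.
- by case: tp => + _ _ y _; rewrite lee_fin.
- exact: test_emeasurable.
- by apply/measurable_EFinP; apply: measurable_funM.
move=> y _; rewrite -EFinM lee_fin indicE; case: (boolP (y \in _)) => [_|].
  by rewrite mulr1.
by rewrite notin_setE => /H0 ->; rewrite mulr0.
Qed.

Lemma msupport_tint m y r : radon m -> msupport m y -> 0 < r -> 0 < tint m (tent y r).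
Proof.
move=> rm sy r0; have r2 : 0 < r / 2 by rewrite divr_gt0.
rewrite -lte_fin; apply: (@lt_le_trans _ _ ((r / 2)%:E * m (eball y (r / 2)))%E).
  by apply: mule_gt0; rewrite ?lte_fin//; exact: sy.
apply: le_tint_ball => //; [exact: test_tent|exact: ltW|].
move=> z; rewrite /eball/tent/= => yz; rewrite le_max; apply/orP; right; lra.
Qed.

Lemma tint_msupport m y : radon m ->
  (forall r, 0 < r -> 0 < tint m (tent y r)) -> msupport m y.
Proof.
move=> rm H r r0; rewrite lt0e measure_ge0 andbT; apply/eqP => m0.
have := H r r0; rewrite -lte_fin ltNge => /negP; apply.
apply: (@le_trans _ _ (r%:E * m (eball y r))%E); last by rewrite m0 mule0.
apply: tint_le_ball => //; first exact: test_tent.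
- exact: ltW.
- by move=> z; rewrite /tent ge_max (ltW r0) lerBlDr lerDl enorm_ge0.
- by move=> z; rewrite /eball/tent/= => /negP; rewrite -leNgt => H1; apply/max_idPl; rewrite subr_le0.
Qed.

Lemma rational_approx x e : 0 < e -> exists q : 'rV[rat]_n, enorm (x - map_mx ratr q) < e.
Proof.
move=> e0; have d0 : 0 < e / (n%:R + 1) by rewrite divr_gt0.
have H (i : 'I_n) : exists q : rat, `|x 0 i - ratr q| < e / (n%:R + 1).
  have xe : x 0 i < x 0 i + e / (n%:R + 1) by rewrite ltrDl.
  have [q] := rat_in_itvoo xe; by rewrite in_itv/= => /andP[? ?]; exists q; rewrite ltr_norml; apply/andP; split; lra.
exists (\row_i projT1 (cid (H i))).
apply: le_lt_trans (enorm_le_sum _) _.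
apply: (@le_lt_trans _ _ (\sum_(i < n) e / (n%:R + 1))).
  by apply: ler_sum => i _; rewrite !mxE; case: cid => q /= /ltW.
rewrite sumr_const card_ord -[_ *+ n]mulr_natr mulrAC ltr_pdivrMr ?ltr_wpDl//.
by rewrite ltr_pM2l// ltrDl.
Qed.

Lemma closed_msupport m : closed (msupport m).
Proof.
rewrite -[X in closed X]setCK; apply: open_closedC; rewrite openE => x.
move=> /existsNP[r /not_implyP[r0 /negP]]; rewrite -leNgt => mr.
apply/nbhs_eballP; exists (r / 2); rewrite ?divr_gt0// => y xy.
move=> /(_ (r / 2)); rewrite divr_gt0// => /(_ isT); apply/negP; rewrite -leNgt.
apply: (le_trans _ mr); apply: measure_sub => //.
move=> z; move: xy; rewrite /eball/= => xy zy.
have := enorm_distD y z x; lra.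
Qed.

(** The balls with rational centre and radius [1 / (k + 1)] are countably many, and the null ones
    among them cover the complement of the support. *)
Lemma msupportC_null m : m (~` msupport m) = 0%E.
Proof.
pose B (qk : 'rV[rat]_n * nat) : set (borel R n) := eball (map_mx ratr qk.1) (qk.2.+1%:R^-1).
pose F (i : nat) : set (borel R n) := if choice.unpickle i is Some qk then
   if m (B qk) == 0%E then B qk else set0 else set0.
apply/eqP; rewrite eq_le measure_ge0 andbT.
have mF i : measurable (F i).
  by rewrite /F; case: choice.unpickle => // qk; case: ifP => // _; exact: measurable_eball.
have F0 i : m (F i) = 0%E.
  by rewrite /F; case: choice.unpickle => [qk|]; [case: ifP => [/eqP->|]|]; rewrite ?measure0.
have mS : measurable (~` msupport m : set (borel R n)).
  by apply: measurable_open; apply: closed_openC; exact: closed_msupport.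
apply: (@le_trans _ _ (\sum_(i <oo) m (F i))%E); last by rewrite eseries0.
apply: measure_sigma_subadditive => // x.
move=> /existsNP[r /not_implyP[r0 /negP]]; rewrite -leNgt => mr.
have [k] := @ltr_add_invr R 0 (r / 2) (divr_gt0 r0 (ltr0Sn _ 1)).
rewrite add0r => kr.
have [q Hq] := @rational_approx x (k.+1%:R^-1) (ltac:(by rewrite invr_gt0)).
exists (choice.pickle (q, k)) => //; rewrite /F choice.pickleK.
rewrite ifT//; rewrite eq_le measure_ge0 andbT; apply: (le_trans _ mr).
apply: measure_sub => //; first exact: measurable_eball.
apply: eball_sub; rewrite enormB (splitr r) lerD ?(ltW kr)//.
exact: (le_trans (ltW Hq) (ltW kr)).
Qed.

Lemma msupport_ex m (A : set (borel R n)) : measurable A -> m A != 0%E ->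
  exists x, msupport m x.
Proof.
move=> mA mA0; apply: contrapT => /forallNP H; move/eqP: mA0; apply.
apply/eqP; rewrite eq_le measure_ge0 andbT -(msupportC_null m).
apply: measure_sub => //.
  by apply: measurable_open; apply: closed_openC; exact: closed_msupport.
by move=> x _; exact: H.
Qed.

End radon_measures.

(** * Test functions increasing to the indicator of an open set *)

Section open_approximation.
Context {R : realType} {n : nat}.
Implicit Types (x y z : 'rV[R]_n) (r : R) (U : set 'rV[R]_n).

(* The value 1 in the infimum keeps it meaningful when U is the whole space. *)
Definition codist U x : R :=
  inf [set t : R | t = 1 \/ exists2 z, ~ U z & t = enorm (x - z)].

Lemma codist_has_inf U x :
  has_inf [set t : R | t = 1 \/ exists2 z, ~ U z & t = enorm (x - z)].
Proof.
split; first by exists 1; left.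
by exists 0 => _ [->|[z _ ->]] /=; rewrite ?ler01 ?enorm_ge0.
Qed.

Lemma codist_ge0 U x : 0 <= codist U x.
Proof.
by apply: lb_le_inf; [exists 1; left|move=> _ [->|[z _ ->]] /=; rewrite ?ler01 ?enorm_ge0].
Qed.

Lemma codist_le1 U x : codist U x <= 1.
Proof. by apply: ge_inf; [exact: (codist_has_inf U x).2|left]. Qed.

Lemma codist_le U x z : ~ U z -> codist U x <= enorm (x - z).
Proof. by move=> Uz; apply: ge_inf; [exact: (codist_has_inf U x).2|right; exists z]. Qed.

Lemma codist_lip U : lipschitz_with 1 (codist U).
Proof.
suff H x y : codist U x - codist U y <= enorm (x - y).
  move=> x y; rewrite mul1r ler_norml; apply/andP; split; last exact: H.
  by have := H y x; rewrite enormB; lra.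
suff : codist U x - enorm (x - y) <= codist U y by lra.
apply: lb_le_inf; first by exists 1; left.
move=> _ [->|[z Uz ->]].
  by have := codist_le1 U x; have := enorm_ge0 (x - y); lra.
by have := codist_le x Uz; have := enorm_distD y x z; lra.
Qed.

Lemma codist_gt0 U x : open U -> U x -> 0 < codist U x.
Proof.
move=> oU Ux; have /nbhs_eballP[r r0 rU] : nbhs x U by exact: open_nbhs_nbhs.
apply: (@lt_le_trans _ _ (Num.min 1 r)); first by rewrite lt_min ltr01.
apply: lb_le_inf; first by exists 1; left.
move=> _ [->|[z Uz ->]]; first by rewrite ge_min lexx.
rewrite ge_min; apply/orP; right; rewrite leNgt; apply/negP => xz.
by apply: Uz; apply: rU; rewrite /eball/= enormB.
Qed.

Lemma codist_eq0 U x : ~ U x -> codist U x = 0.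
Proof.
move=> Ux; apply/eqP; rewrite eq_le codist_ge0 andbT.
by rewrite (le_trans (codist_le x Ux))// subrr enorm0.
Qed.

(** The cutoff bounds the support, and the factor [k] steepens the distance to the complement; both
    increase with [k]. *)
Definition open_approx U (k : nat) x : R := Num.min (cutoff k%:R x) (k%:R * codist U x).

Lemma test_open_approx U k : test_fun (open_approx U k).
Proof.
have [c0 [L L0 HL] [M HM]] := @test_cutoff R n k%:R; split.
- by move=> x; rewrite /open_approx le_min cutoff_ge0 mulr_ge0 ?codist_ge0.
- exists (L + k%:R); first by rewrite addr_ge0.
  move=> x y; apply: minr_lip.
    by apply: (le_trans (HL x y)); apply: ler_wpM2r; rewrite ?enorm_ge0 ?lerDl.
  rewrite -mulrBr normrM ger0_norm// ler_pM//.
    by rewrite lerDr.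
  by have := codist_lip U x y; rewrite mul1r.
- exists M => x /HM; rewrite /open_approx => ->; apply/min_idPl.
  by rewrite mulr_ge0 ?codist_ge0.
Qed.

Lemma nd_open_approx U x : nondecreasing_seq (fun k => open_approx U k x).
Proof.
move=> j k jk; rewrite /open_approx.
have jkR : j%:R <= k%:R :> R by rewrite ler_nat.
have : cutoff j%:R x <= cutoff k%:R x.
  by rewrite /cutoff ge_max !le_max lexx/= le_min !ge_min lexx/= lerD2r lerD2r jkR !orbT.
have : j%:R * codist U x <= k%:R * codist U x by rewrite ler_wpM2r// codist_ge0.
by move=> ? ?; rewrite le_min !ge_min; apply/andP; split; apply/orP; [left|right].
Qed.

Lemma cvg_open_approx U x : open U -> open_approx U k x @[k --> \oo] --> (\1_U x : R).
Proof.
move=> oU; rewrite indicE; case: (boolP (x \in U)) => [|]; last first.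
  rewrite notin_setE => Ux; apply: cvg_near_cst; apply: nearW => k.
  by rewrite /open_approx codist_eq0// mulr0; apply/min_idPr; exact: cutoff_ge0.
move=> /set_mem Ux; apply: cvg_near_cst.
have d0 := codist_gt0 oU Ux.
near=> k; rewrite /open_approx cutoff_eq1; last by near: k; exact: nbhs_infty_ger.
apply/min_idPl; rewrite -ler_pdivrMr//; near: k; exact: nbhs_infty_ger.
Unshelve. all: by end_near. Qed.

Lemma cvg_tint_open_approx (m : {measure set (borel R n) -> \bar R}) U :
  radon m -> open U -> (tint m (open_approx U k))%:E @[k --> \oo] --> m U.
Proof.
move=> rm oU.
have -> : (fun k => (tint m (open_approx U k))%:E) =
  (fun k => \int[m]_x (open_approx U k x)%:E)%E.
  by apply/funext => k; rewrite tintE//; exact: test_open_approx.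
have <- : (\int[m]_x (\1_U x)%:E = m U)%E.
  by rewrite integral_indic ?setIT//; exact: measurable_open.
have -> : (\int[m]_x (\1_U x)%:E = \int[m]_x limn (fun k => (open_approx U k x)%:E))%E.
  apply: eq_integral => x _; apply/esym/cvg_lim => //.
  apply: cvg_EFin; last exact: cvg_open_approx.
  exact: nearW.
apply: cvg_monotone_convergence => //.
- by move=> k; apply: test_emeasurable; exact: test_open_approx.
- by move=> k x _; rewrite lee_fin; case: (test_open_approx U k).
- by move=> x _ j k jk; rewrite lee_fin; exact: nd_open_approx.
Qed.

(** By monotone convergence the measures agree on open sets, which form a generating family stable
    under intersection and contain an exhausting sequence of balls of finite mass. *)
Lemma radon_measure_eq (m1 m2 : {measure set (borel R n) -> \bar R}) :
  radon m1 -> radon m2 -> (forall phi, test_fun phi -> tint m1 phi = tint m2 phi) ->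
  forall A, measurable A -> m1 A = m2 A.
Proof.
move=> r1 r2 H A mA.
apply: (@measure_unique _ R (borel R n) (open : set (set 'rV[R]_n)) (fun k => eball 0 k%:R)) => //.
- exact: openI.
- by move=> k; exact: open_eball.
- apply/seteqP; split=> // x _.
  exists (Num.bound (enorm (x : 'rV[R]_n))) => //; rewrite /eball/= subr0.
  exact: (archi_boundP (enorm_ge0 (x : 'rV[R]_n))).
- move=> U oU; have c1 := cvg_tint_open_approx r1 oU.
  have c2 := cvg_tint_open_approx r2 oU.
  have E : (fun k => (tint m1 (open_approx U k))%:E) = (fun k => (tint m2 (open_approx U k))%:E).
    by apply/funext => k; rewrite H//; exact: test_open_approx.
  by rewrite E in c1; exact: (cvg_unique _ c1 c2).
- by move=> k; exact: radon_ball.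
Qed.

End open_approximation.

(** * Limits of bounded sequences along an ultrafilter *)

Section ultrafilter_limits.
Context {R : realType}.

(** Compactness gives a cluster point. It is a limit: a neighbourhood outside the ultrafilter would
    have its complement in it, and would then have to meet that complement. *)
Lemma ultra_cvg (T : Type) (U : set_system T) (u : T -> R) (a b : R) :
  UltraFilter U -> (forall t, a <= u t <= b) ->
  exists2 l, a <= l <= b & u t @[t --> U] --> l.
Proof.
move=> UU uab; have PU := @ultra_proper _ _ UU.
have [|l [lab ul]] := @segment_compact R a b (u @ U) _.
  by apply: (@filterE _ U) => t; rewrite /= in_itv/=; exact: uab.
exists l; first by move: lab; rewrite /= in_itv.
move=> V lV; have [//|UV] := @in_ultra_setVsetC _ U (u @^-1` V) UU.
by have [t []] := ul (~` V) V UV lV.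
Qed.

(** Being finer than [\oo], this ultrafilter preserves ordinary limits. *)
Lemma ultra_nat : exists U : set_system nat, UltraFilter U /\ \oo `<=` U.
Proof. exact: ultraFilterLemma. Qed.

End ultrafilter_limits.

(** * Similarities that map a measure to a multiple of itself *)

Section similarity_maps.
Context {R : realType} {n : nat}.
Implicit Types (x y z v w : 'rV[R]_n) (phi psi chi : 'rV[R]_n -> R).
Implicit Types (A B : 'M[R]_n) (g h : 'rV[R]_n -> 'rV[R]_n).
Implicit Types m : {measure set (borel R n) -> \bar R}.

Definition dilates (lam : R) g := forall x y, enorm (g x - g y) = lam * enorm (x - y).

Definition conformal (lam : R) A := forall x, enorm (x *m A) = lam * enorm x.

Lemma conformal_dilates lam A y z :
  conformal lam A -> dilates lam (fun x => (x - y) *m A + z).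
Proof.
move=> cA x x'; rewrite opprD addrACA subrr addr0 -mulmxBl opprB addrA.
by rewrite addrNK cA.
Qed.

Lemma dilates_continuous lam g : dilates lam g -> continuous g.
Proof.
move=> dg x A /nbhs_eballP[r r0 rA].
apply/nbhs_eballP; have l1 : 0 < `|lam| + 1 by rewrite ltr_wpDl.
exists (r / (`|lam| + 1)); first by rewrite divr_gt0.
move=> y; rewrite /eball/= ltr_pdivlMr// => xy; apply: rA; rewrite /eball/= dg.
apply: le_lt_trans xy; rewrite mulrC ler_wpM2l ?enorm_ge0//.
by rewrite (le_trans (ler_norm _))// lerDl.
Qed.

Lemma dilates_enorm_ge lam g x : dilates lam g -> lam * enorm x - enorm (g 0) <= enorm (g x).
Proof.
move=> dg; have := enorm_distD (g x) 0 (g 0); have := enorm_dist_dist (g x) (g 0).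
by rewrite ler_norml => /andP[_]; have := dg x 0; rewrite subr0 => <-;
  have := enormD (g x) (- g 0); rewrite enormN; lra.
Qed.

Lemma test_dilates lam g phi : 0 < lam -> dilates lam g -> test_fun phi ->
  test_fun (fun x => phi (g x)).
Proof.
move=> lam0 dg tp; have [M M0 HM] := test_support tp.
case: tp => p0 [L L0 HL] _; split => //.
- exists (L * lam); first by rewrite mulr_ge0// ltW.
  by move=> x y; rewrite -mulrA -dg; exact: HL.
- exists ((M + enorm (g 0)) / lam) => x; rewrite ler_pdivrMr// => xM.
  by apply: HM; have := dilates_enorm_ge x dg; lra.
Qed.

(** Because [e <= lam / 2], the perturbed map still grows at rate [lam / 2], so both compositions
    vanish outside one ball, inside which the Lipschitz bound applies. The dominating [chi] depends
    neither on [e] nor on [g']. *)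
Lemma test_perturb lam g phi : 0 < lam -> dilates lam g -> test_fun phi ->
  exists2 chi, test_fun chi & forall e g', 0 <= e -> e <= lam / 2 ->
    (forall x, enorm (g' x - g x) <= e * (1 + enorm x)) ->
    forall x, `|phi (g' x) - phi (g x)| <= e * chi x.
Proof.
move=> lam0 dg tp; have [M M0 HM] := test_support tp.
case: (tp) => p0 [L L0 HL] _.
(* From [enorm x >= M'] on, [lam / 2 * enorm x] is at least [M] plus the losses [enorm (g 0)] and
   [lam / 2]. *)
pose M' := (M + enorm (g 0) + lam / 2) / (lam / 2).
have lam2 : 0 < lam / 2 by rewrite divr_gt0.
have M'0 : 0 <= M' by rewrite divr_ge0 ?(ltW lam2)// !addr_ge0 ?enorm_ge0 ?(ltW M0) ?(ltW lam2).
exists (fun x => L * (1 + M') * cutoff M' x).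
  by apply: testZ (test_cutoff _); rewrite mulr_ge0// addr_ge0.
move=> e g' e0 elam H x; have [xM'|M'x] := ltP (enorm x) M'.
  rewrite cutoff_eq1 ?mulr1; last exact: ltW.
  apply: le_trans (HL _ _) _; rewrite mulrCA ler_wpM2l//.
  by apply: le_trans (H x) _; rewrite ler_wpM2l// lerD2l ltW.
have gx := dilates_enorm_ge x dg.
have Hx : M + enorm (g 0) + lam / 2 <= lam / 2 * enorm x.
  by move: M'x; rewrite /M' ler_pdivrMr // (mulrC (enorm x)).
have ex : e * (1 + enorm x) <= lam / 2 * (1 + enorm x) by rewrite ler_wpM2r ?addr_ge0 ?enorm_ge0.
have g'x := enorm_dist_dist (g' x) (g x).
have := H x; have x0 := enorm_ge0 x; move: g'x; rewrite ler_norml => /andP[g'x _] Hg.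
rewrite !HM; first by rewrite subrr normr0 mulr_ge0 ?cutoff_ge0// mulr_ge0 ?cutoff_ge0 ?mulr_ge0 ?addr_ge0.
  by have := enorm_ge0 (g 0); lra.
by have := enorm_ge0 (g 0); lra.
Qed.

(** The image of [m] under [g] is [c m], in a weak form that passes to limits of maps. *)
Definition scales m g (c : R) := forall phi, test_fun phi ->
  tint m (fun x => phi (g x)) = c * tint m phi.

Definition symmetry m g := exists2 c, 0 < c & scales m g c.

Lemma scales_comp m g h c d lam : 0 < lam -> dilates lam g ->
  scales m g c -> scales m h d -> scales m (fun x => g (h x)) (c * d).
Proof.
move=> lam0 dg sg sh phi tp; rewrite (sh (fun x => phi (g x))) ?sg//; first by rewrite mulrA (mulrC d).
exact: test_dilates lam0 dg tp.
Qed.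

Lemma symmetry_comp m g h lam : 0 < lam -> dilates lam g ->
  symmetry m g -> symmetry m h -> symmetry m (fun x => g (h x)).
Proof.
move=> lam0 dg [c c0 sg] [d d0 sh]; exists (c * d); first by rewrite mulr_gt0.
exact: scales_comp lam0 dg sg sh.
Qed.

Lemma symmetry_ext m g h : g =1 h -> symmetry m g -> symmetry m h.
Proof. by move=> /funext ->. Qed.

Lemma symmetry_inv m g h lam : 0 < lam -> dilates lam h -> cancel g h ->
  symmetry m g -> symmetry m h.
Proof.
move=> lam0 dh gK [c c0 sg]; exists c^-1; first by rewrite invr_gt0.
move=> phi tp; have := sg (fun x => phi (h x)) (test_dilates lam0 dh tp).
rewrite [X in tint _ X](_ : _ = phi) => [->|]; first by rewrite mulKf// gt_eqF.
by apply/funext => x; rewrite gK.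
Qed.

Lemma symmetry_support m g lam y : radon m -> 0 < lam -> dilates lam g -> symmetry m g ->
  msupport m y -> msupport m (g y).
Proof.
move=> rm lam0 dg [c c0 sg] sy; apply: tint_msupport => // r r0.
have := sg (tent (g y) r) (test_tent _ _).
have -> : (fun x => tent (g y) r (g x)) = (fun x => lam * tent y (r / lam) x).
  apply/funext => x; rewrite /tent dg maxr_pMr; last exact: ltW.
  by rewrite mulr0 mulrBr (mulrC lam (r / _)) divfK ?gt_eqF.
rewrite tintZ//; [|exact: test_tent|exact: ltW].
have H : 0 < lam * tint m (tent y (r / lam)).
  by rewrite mulr_gt0//; apply: msupport_tint => //; rewrite divr_gt0.
by move=> E; rewrite E pmulr_rgt0 in H.
Qed.

(** This is the convergence of affine maps: when linear parts and constants converge, the error is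
    small relative to [1 + enorm x] but not uniformly. *)
Definition approximates (T : Type) (F : set_system T) (g_ : T -> 'rV[R]_n -> 'rV[R]_n) g :=
  forall e, 0 < e -> \forall t \near F, forall x, enorm (g_ t x - g x) <= e * (1 + enorm x).

Lemma tint_approximates m (T : Type) (F : set_system T) (g_ : T -> _) lam g phi :
  ProperFilter F -> radon m -> 0 < lam -> dilates lam g ->
  (forall t, exists2 l, 0 < l & dilates l (g_ t)) -> approximates F g_ g -> test_fun phi ->
  tint m (fun x => phi (g_ t x)) @[t --> F] --> tint m (fun x => phi (g x)).
Proof.
move=> FF rm lam0 dg dg_ gg tp; have [chi tc Hchi] := test_perturb lam0 dg tp.
apply/cvgrPdist_lt => e e0; have K0 := tint_ge0 m tc.
pose d := Num.min (lam / 2) (e / (tint m chi + 1)).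
have d0 : 0 < d by rewrite lt_min !divr_gt0// ltr_wpDl.
apply: filterS (gg d d0) => t Ht.
have [l l0 dl] := dg_ t.
apply: (@le_lt_trans _ _ (d * tint m chi)).
  rewrite distrC; apply: tint_dist => //.
  - exact: test_dilates l0 dl tp.
  - exact: test_dilates lam0 dg tp.
  - exact: ltW.
  - by apply: Hchi => //; [exact: ltW|rewrite ge_min lexx].
apply: (@lt_le_trans _ _ (d * (tint m chi + 1))); first by rewrite ltr_pM2l// ltrDl.
by rewrite -ler_pdivlMr ?ltr_wpDl// ge_min lexx orbT.
Qed.

(** No bound on the factors is assumed: they are ratios of integrals, so one test function
    determines their limit. The tent at [g p] serves, because its pullback by [g] has positive
    integral when [p] is in the support. *)
Lemma symmetry_limit m (T : Type) (F : set_system T) (g_ : T -> _) lam g p :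
  ProperFilter F -> radon m -> msupport m p -> 0 < lam -> dilates lam g ->
  (forall t, exists2 l, 0 < l & dilates l (g_ t)) -> approximates F g_ g ->
  (forall t, symmetry m (g_ t)) -> symmetry m g.
Proof.
move=> FF rm sp lam0 dg dg_ gg sg.
have cv phi (tp : test_fun phi) := tint_approximates FF rm lam0 dg dg_ gg tp.
pose c_ t := projT1 (cid2 (sg t)).
have c_0 t : 0 < c_ t by rewrite /c_; case: cid2.
have sc t : scales m (g_ t) (c_ t) by rewrite /c_; case: cid2.
have cv' phi (tp : test_fun phi) : c_ t * tint m phi @[t --> F] --> tint m (fun x => phi (g x)).
  rewrite (_ : (fun t => c_ t * tint m phi) = (fun t => tint m (fun x => phi (g_ t x)))).
    exact: cv.
  by apply/funext => t; rewrite sc.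
pose phi0 := tent (g p) 1; have tp0 : test_fun phi0 := test_tent _ _.
have I0 : 0 < tint m (fun x => phi0 (g x)).
  have -> : (fun x => phi0 (g x)) = (fun x => lam * tent p (1 / lam) x).
    apply/funext => x; rewrite /phi0 /tent dg maxr_pMr; last exact: ltW.
    by rewrite mulr0 mulrBr (mulrC lam (1 / _)) divfK ?gt_eqF.
  rewrite tintZ//; [|exact: test_tent|exact: ltW].
  by rewrite mulr_gt0//; apply: msupport_tint => //; rewrite divr_gt0.
have I1 : 0 < tint m phi0.
  rewrite lt0r tint_ge0// andbT; apply/eqP => E.
  have cv0 : c_ t * tint m phi0 @[t --> F] --> 0.
    rewrite E (_ : (fun t => _) = cst 0); first exact: cvg_cst.
    by apply/funext => t; rewrite mulr0.
  have E0 : tint m (fun x => phi0 (g x)) = 0.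
    by exact: (cvg_unique _ (cv' _ tp0) cv0).
  by move: I0; rewrite E0 ltxx.
exists (tint m (fun x => phi0 (g x)) / tint m phi0); first by rewrite divr_gt0.
move=> phi tp.
have cc : c_ t @[t --> F] --> tint m (fun x => phi0 (g x)) / tint m phi0.
  rewrite [X in X @ _](_ : c_ = (fun t => c_ t * tint m phi0 * (tint m phi0)^-1)).
    exact: cvgM (cv' _ tp0) (cvg_cst (tint m phi0)^-1).
  by apply/funext => t; rewrite mulfK// gt_eqF.
exact: (cvg_unique _ (cv' _ tp) (cvgM cc (cvg_cst _))).
Qed.

End similarity_maps.

(** * Conformal matrices and recurrence of their rotation parts *)

Section conformal_matrices.
Context {R : realType} {n : nat}.
Implicit Types (x y z v w : 'rV[R]_n) (A B : 'M[R]_n) (lam : R).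

Lemma conformalM a b A B : conformal a A -> conformal b B -> conformal (a * b) (A *m B).
Proof. by move=> cA cB x; rewrite mulmxA cB cA mulrCA mulrA. Qed.

Lemma conformal1 : conformal 1 (1%:M : 'M[R]_n).
Proof. by move=> x; rewrite mulmx1 mul1r. Qed.

Lemma conformal_exp lam A k : conformal lam A -> conformal (lam ^+ k) (A ^+ k).
Proof.
move=> cA; elim: k => [|k IH]; first exact: conformal1.
by rewrite !exprS; exact: conformalM.
Qed.

Lemma conformal_unit lam A : 0 < lam -> conformal lam A -> A \in unitmx.
Proof.
move=> lam0 cA; rewrite -row_free_unit -kermx_eq0; apply/eqP/row_matrixP => i.
rewrite row0; apply: enorm_eq0; apply: (mulfI (lt0r_neq0 lam0)).
by rewrite -cA -row_mul mulmx_ker row0 enorm0 mulr0.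
Qed.

Lemma conformal_inv lam A : 0 < lam -> conformal lam A -> conformal lam^-1 (invmx A).
Proof.
move=> lam0 cA x; have uA := conformal_unit lam0 cA.
by rewrite -[in RHS](mulmxKV uA x) cA mulKf// gt_eqF.
Qed.

Lemma conformalZ a lam A : conformal lam A -> conformal (`|a| * lam) (a *: A).
Proof. by move=> cA x; rewrite -scalemxAr enormZ cA mulrA. Qed.

Lemma enorm_mulmx_le (d : R) A x : (forall a b, `|A a b| <= d) ->
  enorm (x *m A) <= (n%:R * n%:R) * d * enorm x.
Proof.
move=> Ad; apply: le_trans (enorm_le_sum _) _.
apply: (@le_trans _ _ (\sum_(b < n) \sum_(a < n) enorm x * d)).
  apply: ler_sum => b _; rewrite mxE (le_trans (ler_norm_sum _ _ _))//.
  apply: ler_sum => a _; rewrite normrM ler_pM//.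
  exact: normr_coord_le.
rewrite !sumr_const !card_ord -mulrnA -[X in X <= _]mulr_natr natrM.
by rewrite (mulrC (enorm x)) -mulrA (mulrC _ (n%:R * n%:R)) mulrA.
Qed.

(* Pigeonhole in the compact group of orthogonal matrices: two of the powers
   [O ^ (i (N + 1))] are close to each other. *)
Lemma orthogonal_recurrence A (N : nat) (e : R) : conformal 1 A -> 0 < e ->
  exists2 k, (N <= k)%N & forall x, enorm (x *m A ^+ k - x) <= e * enorm x.
Proof.
move=> cA e0; have [U [UU oU]] := ultra_nat; have PU := @ultra_proper _ _ UU.
pose u i := A ^+ (i * N.+1).
have cu i : conformal 1 (u i) by have := conformal_exp (i * N.+1) cA; rewrite expr1n.
have ub (ab : 'I_n * 'I_n) i : - enorm (delta_mx 0 ab.1 : 'rV[R]_n) <= u i ab.1 ab.2 <=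
    enorm (delta_mx 0 ab.1 : 'rV[R]_n).
  rewrite -ler_norml -[X in _ <= X]mul1r -(cu i) -rowE.
  by have := normr_coord_le (row ab.1 (u i)) ab.2; rewrite mxE.
pose l ab := projT1 (cid2 (ultra_cvg UU (ub ab))).
have ul ab : u i ab.1 ab.2 @[i --> U] --> l ab by rewrite /l; case: cid2.
(* The entries of [u j - u i] will be below [2 * d], so its operator norm is at most
   [n * n * (2 * d) <= e]; the [+ 1] covers [n = 0]. *)
pose d := e / (2 * (n%:R * n%:R + 1)).
have nn1 : 0 < n%:R * n%:R + 1 :> R by rewrite ltr_wpDl// mulr_ge0.
have d0 : 0 < d by rewrite divr_gt0// mulr_gt0.
have UUd : \forall i \near U, forall ab, `|l ab - u i ab.1 ab.2| < d.
  by apply: filter_forall => ab; move/cvgrPdist_lt: (ul ab); apply.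
have [i Hi] := filter_ex UUd.
have Ui : U [set j | (i < j)%N] by apply: oU; exists i.+1.
have [j [Hj /= ij]] := filter_ex (filterI UUd Ui).
exists ((j - i) * N.+1)%N.
  by rewrite (leq_trans (leqnSn N))// leq_pmull// subn_gt0.
move=> x; have -> : enorm (x *m A ^+ ((j - i) * N.+1) - x) = enorm (x *m (u j - u i)).
  rewrite -[LHS]mul1r -(cu i) mulmxBl mulmxBr; congr (enorm (_ - _)).
  by rewrite -mulmxA mulmxE -exprD -mulnDl subnK// ltnW.
apply: (le_trans (@enorm_mulmx_le (2 * d) _ _ _)) => [a b|].
  rewrite !mxE; have := Hi (a, b); have := Hj (a, b); rewrite /=.
  rewrite !ltr_norml !ler_norml => /andP[? ?] /andP[? ?]; apply/andP; split; lra.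
apply: ler_wpM2r; first exact: enorm_ge0.
have -> : n%:R * n%:R * (2 * d) = e * (n%:R * n%:R) / (n%:R * n%:R + 1).
  by rewrite /d; field; rewrite gt_eqF.
by rewrite ler_pdivrMr// ler_pM2l// lerDl.
Qed.

(** The matrix [lam^-1 *: A] is an isometry. Recurrence for it gives arbitrarily high powers of [A]
    that are nearly homotheties, with an error relative to [lam ^+ k]. *)
Lemma conformal_recurrence lam A (N : nat) (e : R) : 0 < lam -> conformal lam A -> 0 < e ->
  exists2 k, (N <= k)%N &
    forall x, enorm (x *m A ^+ k - lam ^+ k *: x) <= e * lam ^+ k * enorm x.
Proof.
move=> lam0 cA e0; pose O := lam^-1 *: A.
have cO : conformal 1 O.
  by have := conformalZ lam^-1 cA; rewrite ger0_norm ?invr_ge0 ?(ltW lam0)// mulVf// gt_eqF.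
have [k Nk Hk] := orthogonal_recurrence N cO e0; exists k => // x.
have -> : x *m A ^+ k = lam ^+ k *: (x *m O ^+ k).
  elim: {Nk Hk} k x => [|k IH] x; first by rewrite !expr0 scale1r.
  rewrite !exprS -!mulmxE !mulmxA IH -scalemxAr -scalemxAl scalerA.
  by rewrite mulrAC mulfV ?gt_eqF// mul1r.
rewrite -scalerBr enormZ ger0_norm ?exprn_ge0 ?(ltW lam0)// (mulrC e) -mulrA.
by rewrite ler_wpM2l ?exprn_ge0 ?(ltW lam0).
Qed.

End conformal_matrices.

(** * From contractions at the support points to translation invariance *)

Section invariance.
Context {R : realType} {n : nat} (m : {measure set (borel R n) -> \bar R}).
Context (radon_m : radon m) (q : R) (q_lt1 : q < 1).
Context (self_similar : forall y : 'rV[R]_n, msupport m y -> exists (A : 'M[R]_n) (lam : R),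
  [/\ 0 < lam, lam <= q, conformal lam A & symmetry m (fun x => (x - y) *m A + y)]).
Context (support0 : msupport m 0).
Implicit Types (x y z v w : 'rV[R]_n) (A B : 'M[R]_n) (lam : R).

Lemma q_gt0 : 0 < q.
Proof. by have [A [lam [l0 lq _ _]]] := self_similar support0; exact: lt_le_trans lq. Qed.

Lemma cvg_qX : q ^+ k @[k --> \oo] --> 0.
Proof. by apply: cvg_expr; rewrite ger0_norm ?(ltW q_gt0). Qed.

Lemma symmetry_pow y A lam k : 0 < lam -> conformal lam A ->
  symmetry m (fun x => (x - y) *m A + y) -> symmetry m (fun x => (x - y) *m A ^+ k + y).
Proof.
move=> lam0 cA sA; elim: k => [|k IH].
  exists 1 => // phi tp; rewrite mul1r; congr tint; apply/funext => x.
  by rewrite expr0 mulmx1 subrK.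
apply: symmetry_ext (symmetry_comp lam0 (conformal_dilates y y cA) sA IH) => x.
by rewrite addrK exprSr -mulmxE mulmxA.
Qed.

(** The map [g N] conjugates [x |-> x B] by a power of the contraction at [y]. Conjugating by a
    homothety about [y] would keep the linear part and move the fixed point towards [y]; the chosen
    powers are homotheties up to a small relative error. *)
Lemma transport_linear_part y B lam : msupport m y -> 0 < lam -> conformal lam B ->
  symmetry m (fun x => x *m B) -> symmetry m (fun x => (x - y) *m B + y).
Proof.
move=> sy lam0 cB sB; have [A [mu [mu0 muq cA sA]]] := self_similar sy.
have ex N := conformal_recurrence N mu0 cA (ltac:(by rewrite invr_gt0) : 0 < N.+1%:R^-1 :> R).
pose k N := projT1 (cid2 (ex N)).
have kN N : (N <= k N)%N by rewrite /k; case: cid2.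
have Hk N x : enorm (x *m A ^+ k N - mu ^+ k N *: x) <= N.+1%:R^-1 * mu ^+ k N * enorm x.
  by move: x; rewrite /k; case: cid2.
have cP N : conformal (mu ^+ k N) (A ^+ k N) := conformal_exp (k N) cA.
have l0 N : 0 < mu ^+ k N by rewrite exprn_gt0.
have lq N : mu ^+ k N <= q ^+ N.
  apply: (@le_trans _ _ (q ^+ k N)); first by rewrite lerXn2r ?nnegrE ?(ltW mu0) ?(ltW q_gt0).
  by apply: ler_wiXn2l; rewrite ?(ltW q_gt0) ?(ltW q_lt1).
have uP N := conformal_unit (l0 N) (cP N).
have iP N := conformal_inv (l0 N) (cP N).
have i0 N : 0 < (mu ^+ k N)^-1 by rewrite invr_gt0.
have d0 : dilates lam (fun x => x *m B) by move=> x x'; rewrite -mulmxBl cB.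
pose g N x := (((x - y) *m invmx (A ^+ k N) + y) *m B - y) *m A ^+ k N + y.
have dk N := conformal_dilates y y (cP N).
have dk' N := conformal_dilates y y (iP N).
have dg1 N : dilates (lam * (mu ^+ k N)^-1) (fun x => ((x - y) *m invmx (A ^+ k N) + y) *m B).
  by move=> x x'; rewrite d0 dk' mulrA.
have dg N : dilates (mu ^+ k N * (lam * (mu ^+ k N)^-1)) (g N).
  by move=> x x'; rewrite /g dk dg1 mulrA.
apply: (@symmetry_limit R n m _ \oo g lam _ 0) => //.
- exact: conformal_dilates.
- by move=> N; exists (mu ^+ k N * (lam * (mu ^+ k N)^-1)); rewrite ?mulr_gt0.
- pose C := enorm (y *m B - y).
  (* The first term pays for two recurrence errors, the second for the displacement [(y B - y) A^k],
     of norm at most [C q^N]. *)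
  pose u N := 2 * lam * (1 + enorm y) * N.+1%:R^-1 + C * q ^+ N.
  have u0 : u N @[N --> \oo] --> 0.
    rewrite [X in _ --> X](_ : 0 = 2 * lam * (1 + enorm y) * 0 + C * 0); last by rewrite !mulr0 addr0.
    apply: cvgD; apply: cvgM; [exact: cvg_cst|exact: cvg_harmonic|exact: cvg_cst|exact: cvg_qX].
  move=> e e0; move/cvgrPdist_le: u0 => /(_ e e0); apply: filterS => N.
  rewrite sub0r normrN => uNe x; apply: (@le_trans _ _ (u N * (1 + enorm x))); last first.
    by apply: ler_wpM2r; [rewrite addr_ge0 ?enorm_ge0|exact: le_trans (ler_norm _) uNe].
  set P := A ^+ k N; set l := mu ^+ k N; pose w := (x - y) *m invmx P.
  have xw : x - y = w *m P by rewrite /w mulmxKV// uP.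
  have nw : enorm (x - y) = l * enorm w by rewrite xw cP.
  (* The error splits into the failures of [P] to be the homothety of ratio [l], at [w B] and at
     [w], and the displacement of the centre. The recurrence errors carry a factor [l], absorbed by
     [enorm (x - y) = l * enorm w]. *)
  have -> : g N x - ((x - y) *m B + y) =
      ((w *m B) *m P - l *: (w *m B)) + (l *: w - w *m P) *m B + (y *m B - y) *m P.
    rewrite /g -/P -/w xw !(mulmxBl, mulmxDl) -!scalemxAl.
    move: (w *m B *m P) (y *m B *m P) (y *m P) (w *m P *m B) (l *: (w *m B)) => a b c d e'.
    by apply/rowP => i; rewrite !mxE; ring.
  apply: le_trans (enormD _ _) _; rewrite cP -/C -/l.
  apply: (@le_trans _ _ (2 * lam * N.+1%:R^-1 * enorm (x - y) + l * C)).
    rewrite lerD2r; apply: le_trans (enormD _ _) _; rewrite cB.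
    have h1 := Hk N (w *m B); have h2 := Hk N w; rewrite cB -/P -/l in h1.
    rewrite -/P -/l enormB in h2.
    have h3 : lam * enorm (l *: w - w *m P) <= lam * (N.+1%:R^-1 * l * enorm w).
      by rewrite ler_wpM2l// ltW.
    apply: (le_trans (lerD h1 h3)); rewrite nw le_eqVlt; apply/orP; left; apply/eqP; ring.
  have xy : enorm (x - y) <= (1 + enorm y) * (1 + enorm x).
    have := enormD x (- y); rewrite enormN; have := mulr_ge0 (enorm_ge0 y) (enorm_ge0 x).
    lra.
  rewrite /u [leRHS]mulrDl; apply: lerD.
    have -> : 2 * lam * (1 + enorm y) * N.+1%:R^-1 * (1 + enorm x) =
      2 * lam * N.+1%:R^-1 * ((1 + enorm y) * (1 + enorm x)) by ring.
    by rewrite ler_wpM2l// !mulr_ge0// ltW.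
  rewrite (mulrC l) -mulrA ler_wpM2l ?enorm_ge0//.
  apply: (le_trans (lq N)); rewrite ler_peMr ?exprn_ge0 ?(ltW q_gt0)//.
  by rewrite lerDl ?enorm_ge0.
- move=> N; have sP := symmetry_pow (k N) mu0 cA sA.
  apply: (symmetry_comp (l0 N) (dk N) sP).
  apply: (symmetry_comp lam0 d0 sB).
  apply: (symmetry_inv (i0 N) (dk' N) _ sP) => x.
  by rewrite addrK mulmxK ?subrK// uP.
Qed.

Let T v := symmetry m (fun x => x + v).

Lemma dilates_translation v : dilates 1 (fun x => x + v).
Proof. by move=> x y; rewrite mul1r opprD addrACA subrr addr0. Qed.

Lemma translation_add v w : T v -> T w -> T (v + w).
Proof.
move=> Tv Tw; apply: symmetry_ext (symmetry_comp ltr01 (dilates_translation v) Tv Tw) => x /=.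
by rewrite -addrA (addrC w).
Qed.

Lemma translation0 : T 0.
Proof. by exists 1 => // phi _; rewrite mul1r; congr tint; apply/funext => x; rewrite addr0. Qed.

Lemma translation_limit v :
  (forall e, 0 < e -> exists2 v', T v' & enorm (v' - v) <= e) -> T v.
Proof.
move=> H; have ex (N : nat) := H N.+1%:R^-1 (ltac:(by rewrite invr_gt0)).
pose v_ N := projT1 (cid2 (ex N)).
have Tv N : T (v_ N) by rewrite /v_; case: cid2.
have vv N : enorm (v_ N - v) <= N.+1%:R^-1 by rewrite /v_; case: cid2.
apply: (@symmetry_limit R n m _ \oo (fun N x => x + v_ N) 1 _ 0) => //.
- exact: dilates_translation.
- by move=> N; exists 1 => //; exact: dilates_translation.
- move=> e e0; have := @cvg_harmonic R => /cvgrPdist_le /(_ e e0); apply: filterS => N.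
  rewrite sub0r normrN ger0_norm ?invr_ge0// => Ne x.
  rewrite opprD addrACA subrr add0r (le_trans (vv N))// (le_trans Ne)//.
  by rewrite ler_peMr ?(ltW e0)// lerDl ?enorm_ge0.
Qed.

Lemma translation_mulrn v j : T v -> T (v *+ j).
Proof.
move=> Tv; elim: j => [|j IH]; first by rewrite mulr0n; exact: translation0.
by rewrite mulrS; exact: translation_add.
Qed.

Lemma base_linear_part : exists B lam,
  [/\ 0 < lam, lam <= q, conformal lam B & symmetry m (fun x => x *m B)].
Proof.
have [B [lam [l0 lq cB sB]]] := self_similar support0; exists B, lam; split => //.
by apply: symmetry_ext sB => x; rewrite subr0 addr0.
Qed.

Lemma translation_support y : msupport m y -> T y.
Proof.
move=> sy; have [B [lam [l0 lq cB sB]]] := base_linear_part.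
have dB : dilates lam (fun x => x *m B) by move=> x x'; rewrite -mulmxBl cB.
have sBk k z : msupport m z -> msupport m (z *m B ^+ k).
  move=> sz; elim: k => [|k IH]; first by rewrite expr0 mulmx1.
  by rewrite exprSr -mulmxE mulmxA; exact: (symmetry_support radon_m l0 dB sB IH).
(* Both [x B] and [(x - z) B + z] are symmetries. Testing the first one on a translate of [phi]
   isolates the translation, with factor [c / c']. *)
have T1 z : msupport m z -> T (z - z *m B).
  move=> sz; have [c c0 sc] := transport_linear_part sz l0 cB sB.
  have [c' c'0 sc'] := sB; exists (c / c'); first by rewrite divr_gt0.
  move=> phi tp; have := sc phi tp.
  have -> : (fun x => phi ((x - z) *m B + z)) = (fun x => phi (x *m B + (z - z *m B))).
    by apply/funext => x; congr phi; rewrite mulmxBl addrAC addrA.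
  rewrite (sc' (fun x => phi (x + (z - z *m B)))); last first.
    exact: (test_dilates ltr01 (dilates_translation _) tp).
  by move=> E; rewrite mulrAC -E mulrC mulKf// gt_eqF.
have T2 k : T (y - y *m B ^+ k).
  elim: k => [|k IH]; first by rewrite expr0 mulmx1 subrr; exact: translation0.
  have := translation_add IH (T1 _ (sBk k y sy)).
  by rewrite addrA subrK exprSr -mulmxE mulmxA.
apply: translation_limit => e e0.
have c0 : q ^+ k * enorm y @[k --> \oo] --> 0.
  by rewrite -(mul0r (enorm y)); apply: cvgM; [exact: cvg_qX|exact: cvg_cst].
move/cvgrPdist_le: c0 => /(_ e e0) /filter_ex[k]; rewrite sub0r normrN => Hk.
exists (y - y *m B ^+ k) => //; rewrite addrAC subrr add0r enormN (conformal_exp k cB).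
apply: le_trans (le_trans (ler_norm _) Hk); apply: ler_wpM2r; first exact: enorm_ge0.
by rewrite lerXn2r ?nnegrE ?(ltW l0) ?(ltW q_gt0).
Qed.

(** The rotation part of [B] may turn [y B^k] away from the ray of [y]; recurrence supplies
    exponents for which [y B^k] is nearly [lam^k y], with [lam^k] as small as desired. *)
Lemma translation_ray y (t : R) : msupport m y -> 0 <= t -> T (t *: y).
Proof.
move=> sy t0; have [B [lam [l0 lq cB sB]]] := base_linear_part.
have dB : dilates lam (fun x => x *m B) by move=> x x'; rewrite -mulmxBl cB.
have sBk k : msupport m (y *m B ^+ k).
  elim: k => [|k IH]; first by rewrite expr0 mulmx1.
  by rewrite exprSr -mulmxE mulmxA; exact: (symmetry_support radon_m l0 dB sB IH).
apply: translation_limit => e e0.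
have c0 : q ^+ k * enorm y @[k --> \oo] --> 0.
  by rewrite -(mul0r (enorm y)); apply: cvgM; [exact: cvg_qX|exact: cvg_cst].
have e20 : 0 < e / 2 by rewrite divr_gt0.
move/cvgrPdist_le: c0 => /(_ _ e20) /filter_ex[N]; rewrite sub0r normrN => HN.
have ty : 0 <= t * enorm y by rewrite mulr_ge0 ?enorm_ge0.
(* With this tolerance, [j] copies of the recurrence error add up to at most [e / 2], since
   [j l <= t]. Rounding [t / l] down costs at most [l * enorm y <= e / 2]. *)
have e' : 0 < e / 2 / (t * enorm y + 1) by rewrite divr_gt0// ltr_wpDl.
have [k Nk Hk] := conformal_recurrence N l0 cB e'.
set l := lam ^+ k in Hk; have lk0 : 0 < l by rewrite exprn_gt0.
have lqN : l <= q ^+ N.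
  apply: (@le_trans _ _ (q ^+ k)); first by rewrite lerXn2r ?nnegrE ?(ltW l0) ?(ltW q_gt0).
  by apply: ler_wiXn2l; rewrite ?(ltW q_gt0) ?(ltW q_lt1).
pose j := Num.truncn (t / l).
have /andP[j1 j2] : j%:R <= t / l < j.+1%:R by apply: truncn_itv; rewrite divr_ge0// ltW.
move: j1 j2; rewrite ler_pdivlMr// ltr_pdivrMr// -natr1 mulrDl mul1r => j1 j2.
exists ((y *m B ^+ k) *+ j).
  by apply: translation_mulrn; apply: translation_support.
have -> : (y *m B ^+ k) *+ j - t *: y = j%:R *: (y *m B ^+ k - l *: y) + (j%:R * l - t) *: y.
  by rewrite scalerBr scalerBl !scalerA scaler_nat addrA subrK.
apply: le_trans (enormD _ _) _; rewrite !enormZ ger0_norm// ler0_norm; last lra.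
have h1 : j%:R * enorm (y *m B ^+ k - l *: y) <= e / 2.
  apply: (@le_trans _ _ (j%:R * (e / 2 / (t * enorm y + 1) * l * enorm y))).
    by rewrite ler_wpM2l.
  have -> : j%:R * (e / 2 / (t * enorm y + 1) * l * enorm y) =
    (j%:R * l) * enorm y * (e / 2) / (t * enorm y + 1) by ring.
  rewrite ler_pdivrMr ?ltr_wpDl// (mulrC (e / 2)) ler_wpM2r ?(ltW e20)//.
  by apply: (@le_trans _ _ (t * enorm y)); rewrite ?lerDl// ler_wpM2r ?enorm_ge0.
have h2 : - (j%:R * l - t) * enorm y <= e / 2.
  apply: le_trans (le_trans (ler_norm _) HN); apply: ler_wpM2r; first exact: enorm_ge0.
  apply: le_trans lqN; lra.
lra.
Qed.

(* Conjugation by the contraction [B] preserves the factor of a translation and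
   shrinks the translation vector. *)
Lemma translation_scales1 v : T v -> scales m (fun x => x + v) 1.
Proof.
move=> [c c0 sc]; have [B [lam [l0 lq cB sB]]] := base_linear_part.
have dB : dilates lam (fun x => x *m B) by move=> x x'; rewrite -mulmxBl cB.
have [c' c'0 sc'] := sB.
have sk k : scales m (fun x => x + v *m B ^+ k) c.
  elim: k => [|k IH]; first by move=> phi tp; rewrite expr0 mulmx1; exact: sc.
  move=> phi tp; have tpB := test_dilates l0 dB tp.
  have := IH _ tpB.
  have -> : (fun x => phi ((x + v *m B ^+ k) *m B)) = (fun x => phi (x *m B + v *m B ^+ k.+1)).
    by apply/funext => x; congr phi; rewrite mulmxDl exprSr -mulmxE mulmxA.
  rewrite (sc' _ (test_dilates ltr01 (dilates_translation _) tp)) sc'// => E.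
  by apply: (mulfI (lt0r_neq0 c'0)); rewrite E mulrCA.
have vk : approximates \oo (fun k x => x + v *m B ^+ k) id.
  move=> e e0; have c1 : q ^+ k * enorm v @[k --> \oo] --> 0.
    by rewrite -(mul0r (enorm v)); apply: cvgM; [exact: cvg_qX|exact: cvg_cst].
  move/cvgrPdist_le: c1 => /(_ _ e0); apply: filterS => k; rewrite sub0r normrN => Hk x.
  rewrite addrAC subrr add0r (conformal_exp k cB).
  apply: (@le_trans _ _ e); last by rewrite ler_peMr ?(ltW e0)// lerDl ?enorm_ge0.
  apply: le_trans (le_trans (ler_norm _) Hk); apply: ler_wpM2r; first exact: enorm_ge0.
  by rewrite lerXn2r ?nnegrE ?(ltW l0) ?(ltW q_gt0).
have did : dilates 1 (id : 'rV[R]_n -> 'rV[R]_n) by move=> x y; rewrite mul1r.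
move=> phi tp.
have dv k : exists2 l : R, 0 < l & dilates l (fun x => x + v *m B ^+ k).
  by exists 1 => //; exact: dilates_translation.
have cv := tint_approximates _ radon_m ltr01 did dv vk tp.
(* These integrals do not depend on [k], while the translations tend to the identity; hence
   [c * tint m phi = tint m phi]. *)
have E : (fun k => tint m (fun x => phi (x + v *m B ^+ k))) = cst (c * tint m phi).
  by apply/funext => k; rewrite sk.
rewrite E in cv; rewrite sc// mul1r.
have cc : cst (c * tint m phi) k @[k --> \oo] --> c * tint m phi by exact: cvg_cst.
exact: (cvg_unique _ cc (cv _)).
Qed.

Lemma invariant_line y (t : R) : msupport m y -> scales m (fun x => x + t *: y) 1.
Proof.
move=> sy; have [t0|t0] := leP 0 t.
  exact: translation_scales1 (translation_ray sy t0).
have nt0 : 0 <= - t by rewrite oppr_ge0 ltW.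
have H := translation_scales1 (translation_ray sy nt0).
move=> phi tp; rewrite mul1r.
have := H _ (test_dilates ltr01 (dilates_translation (t *: y)) tp); rewrite mul1r => <-.
by congr tint; apply/funext => x; rewrite -addrA scaleNr addNr addr0.
Qed.

Lemma invariant_add v w : scales m (fun x => x + v) 1 -> scales m (fun x => x + w) 1 ->
  scales m (fun x => x + (v + w)) 1.
Proof.
move=> sv sw phi tp; have := scales_comp ltr01 (dilates_translation v) sv sw tp.
by rewrite mulr1 => <-; congr tint; apply/funext => x; rewrite -addrA (addrC w).
Qed.

End invariance.

(** * Integrals against rescaled measures, and what a small [alphaG] provides *)

Section blowup_integrals.
Context {R : realType} {n : nat}.
Implicit Types (x y z v w : 'rV[R]_n) (phi psi chi : 'rV[R]_n -> R) (r t lam : R).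
Implicit Types mu : {measure set (borel R n) -> \bar R}.

Lemma dilates_blowup x r : 0 < r -> dilates r^-1 (fun z => r^-1 *: (z - x)).
Proof.
move=> r0 z z'; rewrite -scalerBr enormZ ger0_norm ?invr_ge0 ?(ltW r0)//.
by rewrite opprB addrA subrK.
Qed.

Lemma blowupE mu x r : 0 < r ->
  blowup mu x r = pushforward mu ((fun z => r^-1 *: (z - x)) : borel R n -> borel R n).
Proof.
move=> r0; apply/funext => A; rewrite /blowup /pushforward; congr (mu _).
have rn : r != 0 by rewrite gt_eqF.
apply/seteqP; split => [_ [y Ay <-]|z Az] /=.
  by rewrite addrAC subrr add0r scalerA mulVf// scale1r.
by exists (r^-1 *: (z - x)) => //; rewrite scalerA mulfV// scale1r addrC subrK.
Qed.

Lemma measurable_dilates lam g : dilates lam g ->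
  measurable_fun setT (g : borel R n -> borel R n).
Proof. by move=> dg; apply: measurable_borel_rV; exact: dilates_continuous dg. Qed.

Lemma integral_pushforward_test mu g lam phi : 0 < lam -> dilates lam g -> radon mu ->
  test_fun phi ->
  (\int[pushforward mu (g : borel R n -> borel R n)]_y (phi y)%:E =
   (tint mu (fun z => phi (g z)))%:E)%E.
Proof.
move=> lam0 dg rmu tp; rewrite ge0_integral_pushforward//.
- rewrite preimage_setT -tintE//; exact: (test_dilates lam0 dg tp).
- exact: measurable_dilates dg.
- exact: test_emeasurable.
- by move=> y _; rewrite lee_fin; case: tp.
Qed.

Lemma integral_blowup mu x r phi : 0 < r -> radon mu -> test_fun phi ->
  (\int[blowup mu x r]_y (phi y)%:E = (tint mu (fun z => phi (r^-1 *: (z - x))))%:E)%E.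
Proof.
move=> r0 rmu tp; rewrite blowupE//.
apply: (integral_pushforward_test _ (dilates_blowup x r0)) => //; by rewrite invr_gt0.
Qed.

Definition pushforward_measure mu g (mg : measurable_fun setT (g : borel R n -> borel R n)) :
  {measure set (borel R n) -> \bar R} :=
  measure_function_pushforward__canonical__measure_function_Measure mu mg.

Lemma integral_scaled_pushforward mu g lam (a : R) phi : 0 <= a -> 0 < lam -> dilates lam g ->
  radon mu -> test_fun phi ->
  (\int[fun A : set (borel R n) => a%:E * pushforward mu (g : borel R n -> borel R n) A]_y
     (phi y)%:E = (a * tint mu (fun z => phi (g z)))%:E)%E.
Proof.
move=> a0 lam0 dg rmu tp; have mg := measurable_dilates dg.
pose pm := pushforward_measure mu mg.
(* The plain set function is, by conversion, a scaled measure, to which the integration lemmas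
   apply. *)
change (\int[mscale (NngNum a0) pm]_y (phi y)%:E = (a * tint mu (fun z => phi (g z)))%:E)%E.
rewrite ge0_integral_mscale; [|by []|exact: test_emeasurable|].
  by rewrite EFinM -(integral_pushforward_test lam0 dg rmu tp).
by move=> y _; rewrite lee_fin; case: tp.
Qed.

Lemma similarity_linear lam G w : similarity lam G -> G w = 0 ->
  exists2 A, conformal lam A & forall z, G z = (z - w) *m A.
Proof.
move=> [lam0 [f [[A [b fA]] fiso] Gf]] Gw.
have GA z : G z = (z - w) *m (lam *: A).
  rewrite -[LHS]subr0 -Gw !Gf -scalerBr !fA opprD addrACA subrr addr0 -mulmxBl.
  by rewrite -scalemxAr.
exists (lam *: A) => // v; have := fiso (v + w) w.
have -> : f (v + w) - f w = v *m A.
  by rewrite !fA opprD addrACA subrr addr0 -mulmxBl addrK.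
by rewrite addrK -scalemxAr enormZ ger0_norm ?(ltW lam0)// => ->.
Qed.

Definition mball mu x r : R := fine (mu (eball x r)).

Lemma mballE mu x r : radon mu -> mu (eball x r) = (mball mu x r)%:E.
Proof. by move=> rmu; rewrite /mball fineK// ge0_fin_numE ?radon_ball// measure_ge0. Qed.

Lemma mball_ge0 mu x r : 0 <= mball mu x r.
Proof. by rewrite /mball fine_ge0// measure_ge0. Qed.

Lemma mball_gt0 mu x r : radon mu -> msupport mu x -> 0 < r -> 0 < mball mu x r.
Proof. by move=> rmu sx r0; rewrite -lte_fin -mballE//; exact: sx. Qed.

Lemma le_mball mu x y r t : radon mu -> enorm (y - x) + t <= r -> mball mu y t <= mball mu x r.
Proof.
move=> rmu yx; rewrite -lee_fin -!mballE//; apply: measure_sub => //; exact: eball_sub.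
Qed.

Lemma integral_image0 mu lam G w psi : radon mu -> 0 < lam -> dilates lam G -> G w = 0 ->
  test_fun psi ->
  (\int[image0 mu G]_y (psi y)%:E =
    ((mball mu w lam^-1)^-1 * tint mu (fun z => psi (G z)))%:E)%E.
Proof.
move=> rmu lam0 dG Gw tp.
have GB : G @^-1` unit_eball = eball w lam^-1.
  by apply/seteqP; split => z; rewrite /unit_eball /eball/= -Gw dG mulrC -ltr_pdivlMr// div1r.
rewrite -(@integral_scaled_pushforward mu G lam)// ?invr_ge0 ?mball_ge0//.
by congr integral; apply/funext => A; rewrite /image0 /mball -GB.
Qed.

Lemma integral_blowup0 mu w t psi : radon mu -> 0 < t -> test_fun psi ->
  (\int[blowup0 mu w t]_y (psi y)%:E =
    ((mball mu w t)^-1 * tint mu (fun z => psi (t^-1 *: (z - w))))%:E)%E.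
Proof.
move=> rmu t0 tp.
rewrite -(@integral_scaled_pushforward mu _ t^-1 _ psi) ?invr_ge0 ?invr_gt0 ?mball_ge0//.
  by congr integral; apply/funext => A; rewrite /blowup0 blowupE.
exact: dilates_blowup.
Qed.

Lemma W1_ge0 (m1 m2 : set (borel R n) -> \bar R) : (0 <= W1 m1 m2)%E.
Proof.
apply: ereal_sup_ge; exists `|\int[m1]_x (0 : R)%:E - \int[m2]_x (0 : R)%:E|%E => //.
exists (fun=> 0) => //; split => // x y; rewrite subrr normr0; exact: enorm_ge0.
Qed.

Lemma alphaG_ge0 mu l1 l2 w t : (0 <= alphaG mu l1 l2 w t)%E.
Proof. by apply: le_ereal_inf_tmp => _ [G _ <-]; exact: W1_ge0. Qed.

(** A similarity nearly realising the infimum is affine and vanishes at [w], so it has the form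
    [z |-> (z - w) A]. The unit ball pulls back to the ball of radius [lam^-1] about [w], whence the
    first normalisation. *)
Lemma alphaG_lt mu l1 l2 w t e : radon mu -> 0 < t -> (alphaG mu l1 l2 w t < e%:E)%E ->
  exists lam A, [/\ 0 < lam, l1 * t <= lam^-1 <= l2 * t, conformal lam A &
    forall psi, test_fun psi -> Lip1 psi ->
      `|(mball mu w lam^-1)^-1 * tint mu (fun z => psi ((z - w) *m A)) -
        (mball mu w t)^-1 * tint mu (fun z => psi (t^-1 *: (z - w)))| <= e].
Proof.
move=> rmu t0 /ereal_inf_lt[_ [G [lam [simG Gw lamt]] <-] We].
have lam0 : 0 < lam by case: simG.
have [A cA GA] := similarity_linear simG Gw; exists lam, A; split => //.
move=> psi tp Lp; rewrite -lee_fin; apply: le_trans (ltW We).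
have dG : dilates lam G by move=> z z'; rewrite !GA -mulmxBl opprB addrA subrK cA.
apply: ereal_sup_ge; eexists; first by exists psi => //; reflexivity.
rewrite (integral_image0 rmu lam0 dG Gw tp) (integral_blowup0 w rmu t0 tp).
rewrite -EFinB abse_EFin lee_fin; under [X in _ <= `|_ * tint _ X - _|]eq_fun do rewrite GA.
exact: lexx.
Qed.

End blowup_integrals.

(** * Lower bounds for the averaged coefficient *)

Section lower_integral.
Local Open Scope ereal_scope.

(* Monotonicity without measurability of the functions. *)
Lemma ge0_le_lower_integral d (T : measurableType d) (R : realType)
  (m : {measure set T -> \bar R}) (D : set T) (f g : T -> \bar R) :
  (forall x, D x -> 0 <= f x) -> (forall x, D x -> f x <= g x) ->
  \int[m]_(x in D) f x <= \int[m]_(x in D) g x.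
Proof.
move=> f0 fg; rewrite !ge0_integralE//; last by move=> x Dx; rewrite (le_trans (f0 x Dx))// fg.
apply: ge_ereal_sup => _ [h /= hf <-]; apply: ereal_sup_ubound; exists h => //= x.
apply: (le_trans (hf x)).
by rewrite /patch; case: ifPn => // /set_mem Dx; exact: fg.
Qed.

Context {R : realType} {n : nat} (mu : {measure set (borel R n) -> \bar R}).

(** A lower bound for [alphaG] on [E] at all scales from [rho] to [2 * rho] survives both averages.
    Centres off the support may be ignored, because they form a null set. *)
Lemma alphaG_star_ge (l1 l2 : R) x (rho e : R) (E : set 'rV[R]_n) :
  radon mu -> (0 < rho)%R -> (0 <= e)%R -> measurable (E : set (borel R n)) ->
  E `<=` eball x rho ->
  (forall y t, E y -> msupport mu y -> (rho <= t <= 2 * rho)%R -> e%:E <= alphaG mu l1 l2 y t) ->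
  (((mball mu x rho)^-1 * e)%:E * mu E <= alphaG_star mu l1 l2 x rho).
Proof.
move=> rmu rho0 e0 mE Ex H; rewrite /alphaG_star EFinM -muleA.
apply: lee_wpmul2l; first by rewrite lee_fin invr_ge0 mball_ge0.
have mS : measurable (msupport mu : set (borel R n)).
  by apply: measurable_closed; exact: closed_msupport.
have mES : measurable (E `&` msupport mu : set (borel R n)) by exact: measurableI.
have -> : mu E = mu (E `&` msupport mu).
  apply/eqP; rewrite eq_le; apply/andP; split; last by apply: measure_sub => //; exact: subIsetl.
  have -> : mu E = mu (E `&` msupport mu) + mu (E `&` ~` msupport mu).
    rewrite -measureU//; first by rewrite -setIUr setUCr setIT.
    - by apply: measurableI => //; exact: measurableC.
    - by rewrite setIACA setICr !setI0.
  rewrite [X in _ + X](_ : _ = 0) ?adde0//.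
  apply/eqP; rewrite eq_le measure_ge0 andbT -(msupportC_null mu).
  by apply: measure_sub => //; [apply: measurableI => //|]; exact: measurableC.
have -> : e%:E * mu (E `&` msupport mu) =
    \int[mu]_(y in eball x rho) (e%:E * (\1_(E `&` msupport mu) y)%:E).
  rewrite ge0_integralZl_EFin//.
  - rewrite integral_indic//; congr (_ * mu _); apply/seteqP; split => [y [Ey sy]|y []//].
    by split => //; exact: Ex.
  - by apply: (measurable_funS measurableT) => //; exact: measurable_eindic.
apply: ge0_le_lower_integral => y xy.
  by rewrite mule_ge0// lee_fin.
rewrite indicE; case: (boolP (y \in _)) => [/set_mem[Ey sy]|_]; last first.
  rewrite mule0 mule_ge0// ?lee_fin ?invr_ge0 ?(ltW rho0)//.
  by apply: integral_ge0 => t _; exact: alphaG_ge0.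
(* The interval has length [rho], so the inner average of the constant [e] is [e]. *)
rewrite mule1; apply: (@le_trans _ _ ((rho^-1)%:E *
    \int[@lebesgue_measure R]_(t in `[rho, (2 * rho)%R]) (cst e%:E t))).
  rewrite integral_cst//= lebesgue_measure_itv/= lte_fin ifT; last lra.
  by rewrite -EFinB -!EFinM lee_fin le_eqVlt; apply/orP; left; apply/eqP; field; rewrite gt_eqF.
apply: lee_wpmul2l; first by rewrite lee_fin invr_ge0 ltW.
apply: ge0_le_lower_integral => t; first by rewrite lee_fin.
by rewrite /= in_itv/= => tr; exact: H.
Qed.

End lower_integral.

Lemma pow2_unbounded (R : realType) (a : R) : exists p, a <= 2 ^+ p.
Proof.
exists (Num.bound `|a|); apply: (le_trans (ler_norm _)).
apply: (le_trans (ltW (archi_boundP (normr_ge0 a)))).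
by rewrite -natrX ler_nat ltnW// ltn_expl.
Qed.

(** * Self-similarity of tangent measures *)

Section tangent_measures.
Context {R : realType} {n : nat} (mu sigma : {measure set (borel R n) -> \bar R}).
Context (l1 l2 C : R) (x : 'rV[R]_n) (rk ak : nat -> R).
Context (radon_mu : radon mu) (radon_sigma : radon sigma) (C_gt0 : 0 < C).
Context (doubling_mu : forall y r, msupport mu y -> 0 < r ->
  mball mu y (2 * r) <= C * mball mu y r).
Context (l1_gt1 : 1 < l1) (l1_lt_l2 : l1 < l2) (support_x : msupport mu x).
Context (alpha_cvg0 : alphaG_star mu l1 l2 x r @[r --> 0^'+] --> (0 : \bar R)%E).
Context (rk_gt0 : forall k, 0 < rk k) (rk_cvg0 : rk k @[k --> \oo] --> 0).
Context (ak_ge0 : forall k, 0 <= ak k).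

(** The integral of [phi] against [ak k] times [blowup mu x (rk k)], as a real number. The
    hypothesis [cvgJ] keeps of weak convergence only what concerns test functions. *)
Let J k phi := ak k * tint mu (fun z => phi ((rk k)^-1 *: (z - x))).

Context (cvgJ : forall phi, test_fun phi -> J k phi @[k --> \oo] --> tint sigma phi).
Implicit Types (y z v w : 'rV[R]_n) (phi psi chi : 'rV[R]_n -> R) (r t lam e : R).

Lemma doubling_iter y r p : msupport mu y -> 0 < r ->
  mball mu y (2 ^+ p * r) <= C ^+ p * mball mu y r.
Proof.
move=> sy r0; elim: p => [|p IH]; first by rewrite !expr0 !mul1r.
rewrite !exprS -!mulrA; apply: le_trans (doubling_mu sy _) _.
  by rewrite mulr_gt0// exprn_gt0.
by rewrite ler_wpM2l// ltW.
Qed.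

Lemma mball_le_tint z r a phi : test_fun phi -> 0 <= a ->
  (forall y, eball z r y -> a <= phi y) -> a * mball mu z r <= tint mu phi.
Proof. by move=> tp a0 H; rewrite -lee_fin EFinM -mballE//; exact: le_tint_ball. Qed.

Lemma tint_le_mball z r a phi : test_fun phi -> 0 <= a -> (forall y, phi y <= a) ->
  (forall y, ~ eball z r y -> phi y = 0) -> tint mu phi <= a * mball mu z r.
Proof. by move=> tp a0 H H0; rewrite -lee_fin EFinM -mballE//; exact: tint_le_ball. Qed.

Lemma test_blowup k phi : test_fun phi -> test_fun (fun z => phi ((rk k)^-1 *: (z - x))).
Proof.
move=> tp; have r0 : 0 < (rk k)^-1 by rewrite invr_gt0.
exact: (test_dilates r0 (dilates_blowup x (rk_gt0 k)) tp).
Qed.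

Lemma J_ge0 k phi : test_fun phi -> 0 <= J k phi.
Proof. by move=> tp; rewrite mulr_ge0// tint_ge0//; exact: test_blowup. Qed.

Lemma J_dist k phi psi chi e : test_fun phi -> test_fun psi -> test_fun chi -> 0 <= e ->
  (forall v, `|phi v - psi v| <= e * chi v) -> `|J k phi - J k psi| <= e * J k chi.
Proof.
move=> tp tq tc e0 H; rewrite /J -mulrBr normrM ger0_norm// mulrCA ler_wpM2l//.
by apply: tint_dist => //; exact: test_blowup.
Qed.

Lemma blowup_ball k y r z : enorm ((rk k)^-1 *: (z - x) - y) < r <->
  enorm (z - (x + rk k *: y)) < r * rk k.
Proof.
have r0 := rk_gt0 k.
have -> : z - (x + rk k *: y) = rk k *: ((rk k)^-1 *: (z - x) - y).
  by rewrite scalerBr scalerA mulfV ?gt_eqF// scale1r opprD addrA.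
by rewrite enormZ ger0_norm ?(ltW r0)// mulrC ltr_pM2r.
Qed.

Lemma J_tent_le k y r : 0 < r -> J k (tent y r) <= r * (ak k * mball mu (x + rk k *: y) (r * rk k)).
Proof.
move=> r0; rewrite /J mulrCA ler_wpM2l//; apply: tint_le_mball.
- by apply: test_blowup; exact: test_tent.
- exact: ltW.
- by move=> z; rewrite /tent ge_max (ltW r0) lerBlDr lerDl enorm_ge0.
- move=> z Hz; rewrite /tent; apply/max_idPl; rewrite subr_le0 leNgt; apply/negP => /blowup_ball.
  exact: Hz.
Qed.

Lemma J_cutoff_ge k M : ak k * mball mu x (M * rk k) <= J k (cutoff M).
Proof.
rewrite /J ler_wpM2l// -[X in X <= _]mul1r; apply: mball_le_tint => //.
  by apply: test_blowup; exact: test_cutoff.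
move=> z zx; rewrite cutoff_eq1// ltW// -[X in enorm X]subr0; apply/blowup_ball.
by rewrite scaler0 addr0.
Qed.

(** Before the limit, the mass near [y] lies in a ball about [x] that is [2 ^+ p] times larger than
    the ball of radius [r / 2 * rk k]. Doubling at [x] bounds it by the mass near the origin, with a
    constant independent of [k]. *)
Lemma support_tangent0 y : msupport sigma y -> msupport sigma 0.
Proof.
move=> sy; apply: tint_msupport => // r r0.
have [p Hp] : exists p, enorm y + 1 <= 2 ^+ p * (r / 2).
  have [p Hp] := pow2_unbounded ((enorm y + 1) / (r / 2)).
  by exists p; rewrite -ler_pdivrMr// divr_gt0.
pose K := C ^+ p / (r / 2).
have K0 : 0 < K by rewrite divr_gt0 ?exprn_gt0// divr_gt0.
have r20 : 0 < r / 2 by rewrite divr_gt0.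
have H k : J k (tent y 1) <= K * J k (tent 0 r).
  apply: le_trans (J_tent_le k y ltr01) _; rewrite !mul1r.
  have h1 : mball mu (x + rk k *: y) (rk k) <= mball mu x (2 ^+ p * (r / 2 * rk k)).
    apply: le_mball => //; rewrite addrAC subrr add0r enormZ ger0_norm ?(ltW (rk_gt0 k))//.
    by rewrite mulrA -{2}[rk k]mul1r mulrC -mulrDl ler_wpM2r// ltW.
  have h2 := le_trans h1 (doubling_iter p support_x (mulr_gt0 r20 (rk_gt0 k))).
  apply: (le_trans (ler_wpM2l (ak_ge0 k) h2)).
  have -> : ak k * (C ^+ p * mball mu x (r / 2 * rk k)) =
      K * (ak k * (r / 2 * mball mu x (r / 2 * rk k))).
    by rewrite /K; field; rewrite gt_eqF.
  rewrite ler_wpM2l ?(ltW K0)// /J ler_wpM2l//; apply: mball_le_tint; last 2 first.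
  - exact: ltW.
  - move=> z zx; rewrite /tent le_max; apply/orP; right.
    have : enorm ((rk k)^-1 *: (z - x) - 0) < r / 2.
      by apply/blowup_ball; rewrite scaler0 addr0.
    lra.
  - by apply: test_blowup; exact: test_tent.
have Hl : tint sigma (tent y 1) <= K * tint sigma (tent 0 r).
  apply: ler_cvg_to (cvgJ (test_tent y 1)) (cvgM (cvg_cst K) (cvgJ (test_tent 0 r))) _.
  exact: nearW.
have := lt_le_trans (msupport_tint radon_sigma sy ltr01) Hl.
by rewrite pmulr_rgt0.
Qed.

Lemma alpha_star_small M d : 0 < M -> 0 < d ->
  \forall k \near \oo, (alphaG_star mu l1 l2 x (M * rk k) < d%:E)%E.
Proof.
move=> M0 d0; have /fine_cvgP[fin /cvgrPdist_lt /(_ d d0) small] := alpha_cvg0.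
have : \forall r \near 0^'+, (alphaG_star mu l1 l2 x r < d%:E)%E.
  apply: filterS2 fin small => r fr; rewrite sub0r normrN => Hr.
  by rewrite -(fineK fr) lte_fin (le_lt_trans (ler_norm _)).
move=> /nbhs_ballP[e /= e0 He].
move/cvgrPdist_lt: rk_cvg0 => /(_ (e / M) (divr_gt0 e0 M0)); apply: filterS => k.
rewrite sub0r normrN ger0_norm ?(ltW (rk_gt0 k))// ltr_pdivlMr// => Hk.
apply: He; last by rewrite /= mulr_gt0.
by rewrite /ball/= sub0r normrN ger0_norm ?mulr_ge0 ?(ltW M0) ?(ltW (rk_gt0 k))// mulrC.
Qed.

(* If [alphaG] were at least [e] at all admissible centres and scales, then so
   would be its lower integral; no measurability of [alphaG] is involved. *)
Lemma good_scale y eta M e : msupport sigma y -> 0 < eta -> enorm y + eta <= M -> 0 < e ->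
  \forall k \near \oo, exists w tau, [/\ enorm (w - y) < eta, 1 <= tau <= 2,
    msupport mu (x + rk k *: w) &
    (alphaG mu l1 l2 (x + rk k *: w) (tau * M * rk k) < e%:E)%E].
Proof.
move=> sy eta0 yM e0; have M0 : 0 < M by have := enorm_ge0 y; lra.
have P0 := msupport_tint radon_sigma sy eta0; set P := tint _ _ in P0.
pose Q := tint sigma (cutoff M) + 1.
have Q0 : 0 < Q by rewrite ltr_wpDl// tint_ge0//; exact: test_cutoff.
(* The threshold for [alphaG_star]: up to the common factor [ak k], the small ball about [z] has
   mass above [P / (2 eta)] and the large ball about [x] has mass below [Q]. A bound [alphaG >= e]
   on the small ball would make the average exceed this number. *)
have d0 : 0 < e * (P / 2) / (eta * Q) by rewrite divr_gt0 ?mulr_gt0// divr_gt0.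
have nP : \forall k \near \oo, P / 2 < J k (tent y eta).
  have P20 : 0 < P / 2 by rewrite divr_gt0.
  move/cvgrPdist_lt: (cvgJ (test_tent y eta)) => /(_ _ P20); apply: filterS => k.
  by rewrite -/P ltr_norml => /andP[_]; lra.
have nQ : \forall k \near \oo, J k (cutoff M) < Q.
  move/cvgrPdist_lt: (cvgJ (test_cutoff M)) => /(_ _ ltr01); apply: filterS => k.
  by rewrite ltr_norml /Q => /andP[+ _]; lra.
apply: filterS3 nP nQ (alpha_star_small M0 d0) => k HP HQ Ha.
apply: contrapT => H; have r0 := rk_gt0 k.
set z := x + rk k *: y; have er0 : 0 < eta * rk k by rewrite mulr_gt0.
have Mr0 : 0 < M * rk k by rewrite mulr_gt0.
have zx : eball z (eta * rk k) `<=` eball x (M * rk k).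
  apply: eball_sub; rewrite /z addrAC subrr add0r enormZ ger0_norm ?(ltW r0)//.
  by rewrite mulrC -mulrDl ler_wpM2r// ltW.
have := @alphaG_star_ge R n mu l1 l2 x (M * rk k) e (eball z (eta * rk k)) radon_mu
  Mr0 (ltW e0) (measurable_eball _ _) zx.
have -> : ((((mball mu x (M * rk k))^-1 * e)%:E * mu (eball z (eta * rk k)))%E =
  ((mball mu x (M * rk k))^-1 * e * mball mu z (eta * rk k))%:E) by rewrite mballE.
move=> Hb; have {}Hb := le_lt_trans (Hb _) Ha.
have mx0 := mball_gt0 radon_mu support_x Mr0.
have h1 := lt_le_trans HP (J_tent_le k y eta0); rewrite -/z in h1.
have h2 := le_lt_trans (J_cutoff_ge k M) HQ.
have a0 : 0 < ak k.
  rewrite lt_neqAle ak_ge0 andbT; apply/eqP => a0; move: h1; rewrite -a0 mul0r mulr0.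
  by rewrite ltNge divr_ge0 ?(ltW P0).
have : (mball mu x (M * rk k))^-1 * e * mball mu z (eta * rk k) < e * (P / 2) / (eta * Q).
  rewrite -lte_fin; apply: Hb => v t zv sv /andP[t1 t2]; rewrite leNgt; apply/negP => Hv.
  (* The centre and the scale of a value below [e], rewritten in the coordinates of the blow-up. *)
  apply: H; exists ((rk k)^-1 *: (v - x)), (t / (M * rk k)).
  have vE : x + rk k *: ((rk k)^-1 *: (v - x)) = v.
    by rewrite scalerA mulfV ?gt_eqF// scale1r addrC subrK.
  have tM : t / (M * rk k) * M * rk k = t by rewrite -mulrA divfK// gt_eqF.
  rewrite vE tM; split; [|apply/andP; split|exact: sv|exact: Hv].
  - by apply/(blowup_ball k y eta v); exact: zv.
  - by rewrite ler_pdivlMr// mul1r.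
  - by rewrite ler_pdivrMr.
have eQ0 : 0 < eta * Q by rewrite mulr_gt0.
set my := mball mu z _ in h1 *; set mx := mball mu x _ in h2 mx0 *.
rewrite ltNge => /negP; apply.
have h3 : ak k * (mx * (P / 2)) <= ak k * (my * (eta * Q)).
  apply: (@le_trans _ _ (Q * (P / 2))).
    by rewrite mulrA ler_wpM2r ?divr_ge0 ?(ltW P0) ?(ltW h2).
  apply: (@le_trans _ _ (Q * (eta * (ak k * my)))).
    by rewrite ler_wpM2l ?(ltW Q0) ?(ltW h1).
  by rewrite le_eqVlt; apply/orP; left; apply/eqP; ring.
rewrite ler_pM2l// in h3; rewrite ler_pdivrMr//.
have -> : mx^-1 * e * my * (eta * Q) = e * (my * (eta * Q)) / mx by ring.
by rewrite ler_pdivlMr// -mulrA ler_pM2l// (mulrC (P / 2)).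
Qed.

(** Both measures compared by [alphaG] are images of [mu], so their closeness reads as approximate
    invariance of one rescaled measure under a contraction fixing [w]. The two normalising radii
    differ by a factor at most [l2 <= 2 ^+ p], so doubling bounds the factor [c] below,
    independently of [N]. *)
Lemma approximate_symmetry y p (N : nat) : msupport sigma y -> l2 <= 2 ^+ p ->
  exists k w A lam c, [/\ (N <= k)%N, enorm (w - y) <= N.+1%:R^-1,
    l2^-1 <= lam <= l1^-1, conformal lam A &
    (C ^+ p)^-1 <= c <= 1 /\
    forall phi, test_fun phi -> lipschitz_with N.+1%:R phi ->
      (forall v, N%:R <= enorm v -> phi v = 0) ->
      `|c * J k (fun v => phi ((v - w) *m A + w)) - J k phi| <= N.+1%:R^-1].
Proof.
(* Since [phi] vanishes off the ball of radius [N] and [w] will have norm at most [enorm y + 1],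
   [phi] vanishes off the ball of radius [M] about [w], hence off that of radius [tau * M]. *)
move=> sy l2p; pose M := N%:R + enorm y + 2.
have y0 := enorm_ge0 y; have N0 : 0 <= N%:R :> R by [].
have N1 : 0 < N.+1%:R :> R by [].
have iN0 : 0 < N.+1%:R^-1 :> R by rewrite invr_gt0.
have iN1 : N.+1%:R^-1 <= 1 :> R by rewrite invf_le1// ler1n.
have M2 : 2 <= M by rewrite /M; lra.
have M0 : 0 < M by lra.
(* [D] will bound [ak k] times the mass of the ball of radius [t] about [z], which lies in the ball
   of radius [3 * M * r] about [x]. [K] will bound the Lipschitz constant [K1]. With the [e] below,
   the final error is at most [D * K * e = N.+1%:R^-1]. *)
pose D := tint sigma (cutoff (3 * M)) + 1.
have D0 : 0 < D by rewrite ltr_wpDl// tint_ge0//; exact: test_cutoff.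
pose K := 2 * M * N.+1%:R; have K0 : 0 < K by rewrite !mulr_gt0.
pose e := (N.+1%:R * (D * K))^-1; have e0 : 0 < e by rewrite invr_gt0 !mulr_gt0.
have yM : enorm y + N.+1%:R^-1 <= M.
  by rewrite /M; move: (N.+1%:R^-1) iN1 => a a1; lra.
have nD : \forall k \near \oo, J k (cutoff (3 * M)) < D.
  move/cvgrPdist_lt: (cvgJ (test_cutoff (3 * M))) => /(_ _ ltr01); apply: filterS => k.
  by rewrite ltr_norml /D => /andP[+ _]; lra.
have nN : \forall k \near \oo, (N <= k)%N by exact: nbhs_infty_ge.
have [k [[HD Nk] [w [tau [wy /andP[tau1 tau2] sz Ha]]]]] :=
  filter_ex (filterI (filterI nD nN) (good_scale sy iN0 yM e0)).
have r0 := rk_gt0 k; set r := rk k in r0 sz Ha *; set z := x + r *: w in sz Ha *.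
have tau0 : 0 < tau by lra.
have tM0 : 0 < tau * M by rewrite mulr_gt0.
set t := tau * M * r in Ha; have t0 : 0 < t by rewrite mulr_gt0.
have wM : enorm w <= enorm y + 1.
  have := enorm_distD y w 0; rewrite !subr0 => h; apply: (le_trans h).
  by rewrite addrC lerD2l (le_trans (ltW wy) iN1).
have [lam [A [lam0 /andP[lt1 lt2] cA HA]]] := alphaG_lt radon_mu t0 Ha.
have l10 : 0 < l1 := lt_trans ltr01 l1_gt1.
have l20 : 0 < l2 := lt_trans l10 l1_lt_l2.
have il0 : 0 < lam^-1 by rewrite invr_gt0.
set m1 := mball mu z lam^-1 in HA; set m2 := mball mu z t in HA.
have m20 : 0 < m2 by exact: mball_gt0.
have m10 : 0 < m1 by exact: mball_gt0.
have tl : t <= lam^-1 by apply: le_trans lt1; rewrite ler_peMl ?ltW.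
have m21 : m2 <= m1 by apply: le_mball => //; rewrite subrr enorm0 add0r.
have m12 : m1 <= C ^+ p * m2.
  apply: le_trans (doubling_iter p sz t0); apply: le_mball => //.
  by rewrite subrr enorm0 add0r (le_trans lt2)// ler_wpM2r// ltW.
have Cp0 : 0 < C ^+ p by rewrite exprn_gt0.
(* Undoing the normalisation by [t^-1] turns [A] into [t *: A]; the factor is the quotient of the
   masses of the balls of radii [t] and [lam^-1]. *)
exists k, w, (t *: A), (t * lam), (m2 / m1); split => //.
- exact: ltW.
- apply/andP; split.
    rewrite -div1r ler_pdivrMr// mulrAC (mulrC t l2).
    by rewrite -[lam^-1]div1r ler_pdivrMr// in lt2.
  rewrite -[l1^-1]div1r ler_pdivlMr// mulrAC (mulrC t l1).
  by rewrite -[lam^-1]div1r ler_pdivlMr// in lt1.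
- by have := conformalZ t cA; rewrite ger0_norm// ltW.
split.
  rewrite ler_pdivlMr// mulrC ler_pdivrMr// (mulrC m2) m12/=.
  by rewrite ler_pdivrMr// mul1r.
move=> phi tp Lp zp; pose K1 := tau * M * N.+1%:R.
have K10 : 0 < K1 by rewrite mulr_gt0.
(* The ball of radius [tau * M] about [w] becomes the unit ball, and division by the Lipschitz
   constant [K1] puts the function in [Lip1]. *)
pose psi u := K1^-1 * phi (w + (tau * M) *: u).
have dil : dilates (tau * M) (fun u => w + (tau * M) *: u).
  move=> u v; rewrite opprD addrACA subrr add0r -scalerBr enormZ ger0_norm// ltW//.
have tpsi : test_fun psi.
  apply: testZ; first by rewrite invr_ge0 ltW.
  exact: (test_dilates tM0 dil tp).
have Lpsi : Lip1 psi.
  split=> [u v|u].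
    rewrite /psi -mulrBr normrM ger0_norm ?invr_ge0 ?(ltW K10)// ler_pdivrMl//.
    apply: le_trans (Lp _ _) _; rewrite dil /K1 le_eqVlt; apply/orP; left; apply/eqP; ring.
  rewrite /unit_eball /eball/= subr0 => /negP; rewrite -leNgt => u1.
  rewrite /psi zp ?mulr0//.
  have := enorm_distD (w + (tau * M) *: u) ((tau * M) *: u) 0; rewrite !subr0.
  rewrite opprD addrCA subrr addr0 enormN enormZ ger0_norm ?(ltW tM0)//.
  have : M <= tau * M * enorm u.
    apply: (@le_trans _ _ (tau * M)); first by rewrite ler_peMl// ltW.
    by rewrite ler_peMr// ltW.
  rewrite /M in wM *; lra.
have := HA psi tpsi Lpsi.
have E1 : tint mu (fun v => psi ((v - z) *m A)) = K1^-1 * tint mu (fun v => phi (w + (tau * M) *: ((v - z) *m A))).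
  rewrite -tintZ//; last by rewrite invr_ge0 ltW.
  have dA : dilates (tau * M * lam) (fun v => w + (tau * M) *: ((v - z) *m A)).
    by move=> v v'; rewrite dil -mulmxBl opprB addrA subrK cA mulrA.
  by apply: (test_dilates _ dA tp); rewrite mulr_gt0.
have E2 : tint mu (fun v => psi (t^-1 *: (v - z))) = K1^-1 * tint mu (fun v => phi (r^-1 *: (v - x))).
  rewrite -tintZ ?invr_ge0 ?(ltW K10)//; last exact: test_blowup.
  congr tint; apply/funext => v; rewrite /psi; congr (_ * phi _).
  rewrite scalerA /t invfM mulrA mulfV ?gt_eqF// mul1r /z opprD addrA scalerBr scalerA.
  by rewrite mulVf ?gt_eqF// scale1r [LHS]addrC subrK.
have E3 : tint mu (fun v => phi (w + (tau * M) *: ((v - z) *m A))) =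
    tint mu (fun v => phi ((r^-1 *: (v - x) - w) *m (t *: A) + w)).
  congr tint; apply/funext => v; congr phi; rewrite addrC; congr (_ + _).
  have -> : r^-1 *: (v - x) - w = r^-1 *: (v - z).
    by rewrite /z opprD addrA [RHS]scalerBr scalerA mulVf ?gt_eqF// scale1r.
  by rewrite -scalemxAr -scalemxAl scalerA /t mulfK// gt_eqF.
rewrite E1 E2 E3 /J -/r.
set I1 := tint mu _; set I2 := tint mu _ => HI.
have am : ak k * m2 <= D.
  apply: le_trans (ltW HD); apply: le_trans (J_cutoff_ge k (3 * M)); rewrite ler_wpM2l//.
  apply: le_mball => //; rewrite -/r /z addrAC subrr add0r enormZ ger0_norm ?(ltW r0)//.
  have h1 : r * enorm w <= r * M by rewrite ler_wpM2l ?(ltW r0)//; rewrite /M in wM *; lra.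
  have h2 : t <= 2 * M * r by rewrite /t -!mulrA ler_wpM2r// mulr_ge0 ?ltW.
  rewrite (le_trans (lerD h1 h2))// le_eqVlt; apply/orP; left; apply/eqP; ring.
have -> : m2 / m1 * (ak k * I1) - ak k * I2 =
    (ak k * m2) * K1 * (m1^-1 * (K1^-1 * I1) - m2^-1 * (K1^-1 * I2)).
  by field; rewrite !gt_eqF.
have am0 : 0 <= ak k * m2 by rewrite mulr_ge0// ltW.
rewrite normrM ger0_norm; last by rewrite mulr_ge0// ltW.
have K1K : K1 <= K by rewrite /K1 /K ler_wpM2r// ler_wpM2r// ltW.
apply: (@le_trans _ _ (D * K * e)).
  apply: ler_pM => //; first by rewrite mulr_ge0// ltW.
  by apply: ler_pM => //; exact: ltW.
by rewrite /e invfM mulrCA mulfV ?mulr1// gt_eqF// mulr_gt0.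
Qed.

(** The matrices, ratios and factors of [approximate_symmetry] are bounded, so they converge along
    the ultrafilter. Their lower bounds [l2^-1] and [(C ^+ p)^-1] do not depend on [N], which keeps
    the limit ratio and factor nonzero. *)
Lemma self_similar_tangent y : msupport sigma y -> exists (A : 'M[R]_n) lam,
  [/\ 0 < lam, lam <= l1^-1, conformal lam A & symmetry sigma (fun v => (v - y) *m A + y)].
Proof.
move=> sy; have [p l2p] := pow2_unbounded l2.
have [kk H1] := choice (fun N => approximate_symmetry N sy l2p).
have [ww H2] := choice H1; have [AA H3] := choice H2.
have [ll H4] := choice H3; have [cc H] := choice H4; clear H1 H2 H3 H4.
have l10 : 0 < l1 := lt_trans ltr01 l1_gt1.
have l20 : 0 < l2 := lt_trans l10 l1_lt_l2.
have il1 : l1^-1 <= 1 by rewrite invf_le1// ltW.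
have [U [UU oU]] := ultra_nat; have PU := @ultra_proper _ _ UU.
have llb N : l2^-1 <= ll N <= l1^-1 by case: (H N).
have ccb N : (C ^+ p)^-1 <= cc N <= 1 by case: (H N) => _ _ _ _ [].
have cAA N : conformal (ll N) (AA N) by case: (H N).
have ll0 N : 0 < ll N by have /andP[h _] := llb N; apply: lt_le_trans h; rewrite invr_gt0.
have ll1 N : ll N <= 1 by have /andP[_ h] := llb N; exact: le_trans il1.
have ub (ab : 'I_n * 'I_n) N : - enorm (delta_mx 0 ab.1 : 'rV[R]_n) <= AA N ab.1 ab.2 <=
    enorm (delta_mx 0 ab.1 : 'rV[R]_n).
  rewrite -ler_norml; apply: (@le_trans _ _ (ll N * enorm (delta_mx 0 ab.1 : 'rV[R]_n))).
    by rewrite -cAA -rowE; have := normr_coord_le (row ab.1 (AA N)) ab.2; rewrite mxE.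
  by rewrite ler_piMl ?enorm_ge0.
pose a_ ab := projT1 (cid2 (ultra_cvg UU (ub ab))).
have cva ab : AA N ab.1 ab.2 @[N --> U] --> a_ ab by rewrite /a_; case: cid2.
pose A : 'M[R]_n := \matrix_(a, b) a_ (a, b).
have [lam /andP[lam2 lam1] cvl] := ultra_cvg UU llb.
have [c /andP[c1 _] cvc] := ultra_cvg UU ccb.
have lam0 : 0 < lam by apply: lt_le_trans lam2; rewrite invr_gt0.
have c0 : 0 < c by apply: lt_le_trans c1; rewrite invr_gt0 exprn_gt0.
have nn1 : 0 < n%:R * n%:R + 1 :> R by rewrite ltr_wpDl// mulr_ge0.
(* Entrywise convergence gives convergence in operator norm, at the cost of a factor [n * n]. *)
have nA e : 0 < e -> \forall N \near U, forall v, enorm (v *m AA N - v *m A) <= e * enorm v.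
  move=> e0; have d0 : 0 < e / (n%:R * n%:R + 1) by rewrite divr_gt0.
  have : \forall N \near U, forall ab, `|a_ ab - AA N ab.1 ab.2| < e / (n%:R * n%:R + 1).
    by apply: filter_forall => ab; move/cvgrPdist_lt: (cva ab); apply.
  apply: filterS => N HN v; rewrite -mulmxBr.
  apply: (le_trans (@enorm_mulmx_le _ _ (e / (n%:R * n%:R + 1)) _ _ _)) => [a b|].
    by rewrite !mxE distrC; exact: ltW (HN (a, b)).
  apply: ler_wpM2r; first exact: enorm_ge0.
  by rewrite mulrA ler_pdivrMr// mulrC ler_pM2l// lerDl.
have cA : conformal lam A.
  move=> v; have h1 : ll N * enorm v @[N --> U] --> lam * enorm v.
    by apply: cvgM => //; exact: cvg_cst.
  have h2 : ll N * enorm v @[N --> U] --> enorm (v *m A).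
    apply/cvgrPdist_le => e e0; have v1 : 0 < enorm v + 1 by rewrite ltr_wpDl ?enorm_ge0.
    apply: filterS (nA _ (divr_gt0 e0 v1)) => N HN; rewrite -cAA distrC.
    apply: le_trans (enorm_dist_dist _ _) _; apply: (le_trans (HN v)).
    by rewrite mulrAC ler_pdivrMr// ler_pM2l// lerDl.
  exact: (cvg_unique _ h2 h1).
pose g N v := (v - ww N) *m AA N + ww N; pose g' v := (v - y) *m A + y.
have dg N : dilates (ll N) (g N) := conformal_dilates _ _ (cAA N).
have dg' : dilates lam g' := conformal_dilates _ _ cA.
have app : approximates U g g'.
  move=> e e0; have y1 : 0 < 1 + enorm y by rewrite ltr_pwDl ?enorm_ge0.
  have e20 : 0 < e / 2 by rewrite divr_gt0.
  have e40 : 0 < e / 2 / 2 by rewrite divr_gt0.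
  have hN : \forall N \near U, N.+1%:R^-1 <= e / 2 / 2.
    apply: oU; have := @cvg_harmonic R => /cvgrPdist_le /(_ _ e40); apply: filterS => N.
    by rewrite sub0r normrN ger0_norm ?invr_ge0.
  apply: filterS2 hN (nA _ (divr_gt0 e20 y1)) => N hN HN v.
  have -> : g N v - g' v = ((v - y) *m AA N - (v - y) *m A) + ((y - ww N) *m AA N + (ww N - y)).
    rewrite /g /g' !mulmxBl.
    move: (v *m AA N) (ww N *m AA N) (v *m A) (y *m A) (y *m AA N) (ww N) => v1 v2 v3 v4 v5 v6.
    by apply/rowP => i; rewrite !mxE; ring.
  have wy : enorm (ww N - y) <= e / 2 / 2 by case: (H N) => _ h _ _ _; exact: le_trans hN.
  have h1 : enorm ((y - ww N) *m AA N + (ww N - y)) <= e / 2.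
    apply: le_trans (enormD _ _) _; rewrite cAA [X in _ <= X](splitr (e / 2)) lerD//.
    by rewrite enormB (le_trans _ wy)// ler_piMl ?enorm_ge0.
  have vy : enorm (v - y) <= (1 + enorm y) * (1 + enorm v).
    have := enormD v (- y); rewrite enormN; have := mulr_ge0 (enorm_ge0 y) (enorm_ge0 v); lra.
  have h2 := HN (v - y).
  have h3 : e / 2 / (1 + enorm y) * enorm (v - y) <= e / 2 * (1 + enorm v).
    by rewrite mulrAC ler_pdivrMr// -[X in _ <= X]mulrA ler_pM2l// (mulrC (1 + enorm v)).
  apply: le_trans (enormD _ _) _; apply: (le_trans (lerD (le_trans h2 h3) h1)).
  have := mulr_ge0 (ltW e20) (enorm_ge0 v); lra.
have kU : kk @ U --> \oo.
  move=> P [n0 _ HP]; apply: oU; exists n0 => // N /= n0N.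
  by apply: HP => /=; apply: (leq_trans n0N); case: (H N).
have cvk psi : test_fun psi -> J (kk N) psi @[N --> U] --> tint sigma psi.
  by move=> tp; exact: (cvg_comp kk (fun k => J k psi) kU (cvgJ tp)).
exists A, lam; split => //; exists c^-1; first by rewrite invr_gt0.
move=> phi tp; have tg' := test_dilates lam0 dg' tp.
have tg N := test_dilates (ll0 N) (dg N) tp.
(* Measures and maps vary together. The [chi] of [test_perturb] does not depend on [N] and its
   integrals converge, so replacing [g N] by [g'] costs little. *)
have cvF : J (kk N) (fun v => phi (g N v)) @[N --> U] --> tint sigma (fun v => phi (g' v)).
  have [chi tc Hchi] := test_perturb lam0 dg' tp.
  have I0 := tint_ge0 sigma tc; have I1 : 0 < tint sigma chi + 1 by rewrite ltr_wpDl.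
  apply/cvgrPdist_le => e e0; have e20 : 0 < e / 2 by rewrite divr_gt0.
  pose d := Num.min (lam / 2) (e / 2 / (tint sigma chi + 1)).
  have d0 : 0 < d by rewrite lt_min !divr_gt0.
  move/cvgrPdist_le: (cvk _ tg') => /(_ _ e20) n2.
  move/cvgrPdist_le: (cvk _ tc) => /(_ _ ltr01) n1.
  apply: filterS3 (app d d0) n1 n2 => N Hg Hc Hp.
  have h : `|J (kk N) (fun v => phi (g N v)) - J (kk N) (fun v => phi (g' v))| <= d * J (kk N) chi.
    apply: J_dist => //; first exact: ltW.
    by apply: Hchi => //; [exact: ltW|rewrite ge_min lexx].
  have h' : d * J (kk N) chi <= e / 2.
    apply: (@le_trans _ _ (d * (tint sigma chi + 1))).
      rewrite ler_pM2l//; move: Hc; rewrite ler_norml => /andP[+ _]; lra.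
    by rewrite -ler_pdivlMr// ge_min lexx orbT.
  rewrite (splitr e); apply: le_trans (ler_distD (J (kk N) (fun v => phi (g' v))) _ _) _.
  by rewrite lerD// distrC (le_trans h).
have cv1 : cc N * J (kk N) (fun v => phi (g N v)) - J (kk N) phi @[N --> U] -->
    c * tint sigma (fun v => phi (g' v)) - tint sigma phi.
  by apply: cvgB; [exact: cvgM|exact: cvk].
(* Once [N] exceeds both a Lipschitz constant of [phi] and a bound of its support, the approximate
   symmetry applies to [phi]. *)
have cv0 : cc N * J (kk N) (fun v => phi (g N v)) - J (kk N) phi @[N --> U] --> 0.
  have [L L0 HL] : exists2 L, 0 <= L & lipschitz_with L phi by case: tp.
  have [M M0 HM] := test_support tp.
  apply/cvgrPdist_le => e e0; apply: oU.
  have n1 : \forall N \near \oo, N.+1%:R^-1 <= e.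
    have := @cvg_harmonic R => /cvgrPdist_le /(_ _ e0); apply: filterS => N.
    by rewrite sub0r normrN ger0_norm ?invr_ge0.
  have n2 : \forall N \near \oo, L <= N%:R by exact: nbhs_infty_ger.
  have n3 : \forall N \near \oo, M <= N%:R by exact: nbhs_infty_ger.
  apply: filterS3 n1 n2 n3 => N Ne LN MN; rewrite sub0r normrN.
  case: (H N) => _ _ _ _ [_ /(_ phi tp) h]; apply: le_trans Ne; apply: h.
    move=> u v; apply: (le_trans (HL u v)); rewrite ler_wpM2r ?enorm_ge0//.
    by rewrite (le_trans LN)// ler_nat.
  by move=> v Nv; apply: HM; exact: le_trans Nv.
have E : c * tint sigma (fun v => phi (g' v)) - tint sigma phi = 0.
  by exact: (cvg_unique _ cv1 cv0).
have E' : c * tint sigma (fun v => phi (g' v)) = tint sigma phi by apply/eqP; rewrite -subr_eq0 E.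
by rewrite -E' mulKf// gt_eqF.
Qed.

End tangent_measures.

(** * Outer measure properties of [hausdorff] and mass distribution *)

Section hausdorff_theory.
Local Open Scope ereal_scope.
Context {R : realType} {n : nat}.
Implicit Types (A E F : set 'rV[R]_n) (d : nat) (x y z : 'rV[R]_n).

Lemma lee_expe (x y : \bar R) k : 0 <= x -> x <= y -> x ^+ k <= y ^+ k.
Proof.
by move=> x0 xy; elim: k => [|k IH]; rewrite ?expe0// !expeS lee_pmul// expe_ge0.
Qed.

Lemma expeMl_fin (t : R) (x : \bar R) k : (t%:E * x) ^+ k = (t ^+ k)%:E * x ^+ k.
Proof.
elim: k => [|k IH]; first by rewrite !expe0 expr0 mule1.
by rewrite !expeS IH exprS EFinM muleACA.
Qed.

Lemma ediam_ge E x y : E x -> E y -> (enorm (x - y))%:E <= ediam E.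
Proof. by move=> Ex Ey; apply: ereal_sup_ubound; exists x => //; exists y. Qed.

Lemma ediam_le E (r : \bar R) : (forall x y, E x -> E y -> (enorm (x - y))%:E <= r) -> ediam E <= r.
Proof. by move=> H; apply: ge_ereal_sup => _ [x Ex [y Ey <-]]; exact: H. Qed.

Lemma ediam_ge0 E : E !=set0 -> 0 <= ediam E.
Proof. by case=> x Ex; have := ediam_ge Ex Ex; rewrite subrr enorm0. Qed.

Lemma diam_pow_set0 d : diam_pow d (set0 : set 'rV[R]_n) = 0.
Proof. by rewrite /diam_pow asboolT. Qed.

Lemma diam_powE d E : E !=set0 -> diam_pow d E = ediam E ^+ d.
Proof. by move=> /set0P/eqP E0; rewrite /diam_pow asboolF. Qed.

Lemma diam_pow_ge0 d E : 0 <= diam_pow d E.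
Proof.
have [->|/set0P E0] := eqVneq E set0; first by rewrite diam_pow_set0.
by rewrite diam_powE// expe_ge0// ediam_ge0.
Qed.

Lemma hausdorff_delta_ge0 d (delta : R) A : 0 <= hausdorff_delta d delta A.
Proof.
by apply: le_ereal_inf_tmp => _ [E _ <-]; apply: nneseries_ge0 => *; exact: diam_pow_ge0.
Qed.

Lemma hausdorff_delta_le d (delta : R) A : (0 < delta)%R ->
  hausdorff_delta d delta A <= hausdorff d A.
Proof. by move=> d0; apply: ereal_sup_ubound; exists delta. Qed.

Lemma hausdorff_ge0 d A : 0 <= hausdorff d A.
Proof. exact: le_trans (hausdorff_delta_ge0 d 1 A) (hausdorff_delta_le _ _ ltr01). Qed.

Lemma hausdorff_mono d A E : A `<=` E -> hausdorff d A <= hausdorff d E.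
Proof.
move=> AE; apply: ge_ereal_sup => _ [delta d0 <-].
apply: le_trans (hausdorff_delta_le d E d0).
apply: le_ereal_inf_tmp => _ [F [EF Fd] <-]; apply: ereal_inf_lbound; exists F => //.
by split => //; exact: subset_trans EF.
Qed.

(** Covers of the [A k] that are optimal up to [e / 2 ^ (k + 1)] are merged into one sequence along
    a bijection between [nat] and [nat * nat]. *)
Lemma hausdorff_delta_sigma_subadditive d (delta : R) (A : nat -> set 'rV[R]_n) :
  hausdorff_delta d delta (\bigcup_i A i) <= \sum_(i <oo) hausdorff_delta d delta (A i).
Proof.
have [[i ioo]|] := pselect (exists i, hausdorff_delta d delta (A i) = +oo).
  rewrite (eseries_pinfty _ _ ioo) ?leey// => k _.
  by rewrite -ltNye (lt_le_trans _ (hausdorff_delta_ge0 _ _ _)).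
rewrite -forallNE => Aoo.
suff H (e : {posnum R}) : hausdorff_delta d delta (\bigcup_i A i) <=
    \sum_(i <oo) hausdorff_delta d delta (A i) + e%:num%:E.
  by apply/lee_addgt0Pr => _/posnumP[].
rewrite (le_trans _ (epsilon_trick _ _ _))//; last by move=> k; exact: hausdorff_delta_ge0.
pose P k (B : nat -> set 'rV[R]_n) := (A k `<=` \bigcup_i B i /\ forall i, ediam (B i) <= delta%:E) /\
  \sum_(i <oo) diam_pow d (B i) <= hausdorff_delta d delta (A k) + (e%:num / (2 ^ k.+1)%:R)%:E.
have [G PG] : {G : nat -> nat -> set 'rV[R]_n & forall k, P k (G k)}.
  apply: (@choice _ _ P) => k; rewrite /P.
  have fk : hausdorff_delta d delta (A k) \is a fin_num.
    rewrite ge0_fin_numE ?hausdorff_delta_ge0// ltey; exact/eqP/Aoo.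
  have en1 : (0 < e%:num / (2 ^ k.+1)%:R)%R by rewrite divr_gt0// ltr0n expn_gt0.
  have [_ [B BP <-] Blt] := lb_ereal_inf_adherent en1 fk.
  by exists B; split => //; exact: ltW.
have g0 (ij : nat * nat) : 0 <= diam_pow d (G ij.1 ij.2) by exact: diam_pow_ge0.
apply: (@le_trans _ _ (\esum_(ij in setT) diam_pow d (G ij.1 ij.2))).
  have /card_esym/ppcard_eqP[f] := card_nat2.
  apply: ereal_inf_lbound; exists (fun i => G (f i).1 (f i).2).
    split=> [x [k _ Akx]|i]; last exact: (PG _).1.2.
    have [j _ Gx] := (PG k).1.1 x Akx.
    exists (f^-1%FUN (k, j)) => //.
    have -> : f (f^-1%FUN (k, j)) = (k, j) by rewrite invK ?in_setE.
    exact: Gx.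
  rewrite -(esum_pred_image (fun ij => diam_pow d (G ij.1 ij.2)) _ xpredT) ?[fun=> _]set_true//.
  by rewrite image_eq.
rewrite (_ : esum _ _ = \sum_(i <oo) \sum_(j <oo) diam_pow d (G i j)).
  apply: lee_nneseries => [k _ _|k _]; last exact: (PG k).2.
  by apply: nneseries_ge0 => *; exact: diam_pow_ge0.
rewrite nneseries_esumT; last by move=> k; apply: nneseries_ge0 => *; exact: diam_pow_ge0.
rewrite (eq_esum (fun k _ => nneseries_esumT (fun j => diam_pow_ge0 d (G k j)))).
rewrite esum_esum; last by move=> *; exact: diam_pow_ge0.
by congr esum; apply/seteqP; split.
Qed.

Lemma hausdorff_sigma_subadditive d (A : nat -> set 'rV[R]_n) :
  hausdorff d (\bigcup_i A i) <= \sum_(i <oo) hausdorff d (A i).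
Proof.
apply: ge_ereal_sup => _ [delta d0 <-].
apply: le_trans (hausdorff_delta_sigma_subadditive d delta A) _.
apply: lee_nneseries => [k _ _|k _]; first exact: hausdorff_delta_ge0.
exact: hausdorff_delta_le.
Qed.

Lemma hausdorff_set0 d : hausdorff d (set0 : set 'rV[R]_n) = 0.
Proof.
apply/eqP; rewrite eq_le hausdorff_ge0 andbT; apply: ge_ereal_sup => _ [delta d0 <-].
apply: ereal_inf_lbound; exists (fun=> set0).
  split => // i; apply: (@le_trans _ _ -oo); last exact: leNye.
  by apply: ediam_le.
by rewrite eseries0// => i _ _; exact: diam_pow_set0.
Qed.

Lemma hausdorffU d A E : hausdorff d (A `|` E) <= hausdorff d A + hausdorff d E.
Proof.
rewrite -bigcup2E; apply: le_trans (hausdorff_sigma_subadditive d _) _.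
rewrite (nneseries_split 0 2); last by move=> k _; exact: hausdorff_ge0.
rewrite add0n [X in _ + X]eseries0 ?adde0.
  by rewrite big_mkord !big_ord_recl big_ord0 adde0.
by move=> [|[|k]]//= _ _; exact: hausdorff_set0.
Qed.

Lemma hausdorff_lipschitz d (t : R) (f : 'rV[R]_n -> 'rV[R]_n) A : (0 < t)%R ->
  (forall x y, (enorm (f x - f y) <= t * enorm (x - y))%R) ->
  hausdorff d (f @` A) <= (t ^+ d)%:E * hausdorff d A.
Proof.
move=> t0 ft; have td0 : (0 < t ^+ d)%R by rewrite exprn_gt0.
apply: ge_ereal_sup => _ [delta d0 <-].
apply: (@le_trans _ _ ((t ^+ d)%:E * hausdorff_delta d (delta / t) A)); last first.
  by rewrite lee_pmul2l//; apply: hausdorff_delta_le; rewrite divr_gt0.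
rewrite -lee_pdivrMl//; apply: le_ereal_inf_tmp => _ [E [AE Ed] <-].
rewrite lee_pdivrMl// -nneseriesZl//; last by move=> i _; exact: diam_pow_ge0.
have fE (F : set 'rV[R]_n) : F !=set0 -> ediam (f @` F) <= t%:E * ediam F.
  move=> F0; apply: ediam_le => _ _ [x Fx <-] [y Fy <-].
  apply: (@le_trans _ _ (t%:E * (enorm (x - y))%:E)); first by rewrite -EFinM lee_fin.
  by rewrite lee_pmul2l//; exact: ediam_ge.
apply: (@le_trans _ _ (\sum_(i <oo) diam_pow d (f @` E i))).
  apply: ereal_inf_lbound; exists (fun i => f @` E i) => //; split.
    by move=> _ [x /AE[i _ Eix] <-]; exists i => //; exists x.
  move=> i; have [E0|/set0P E0] := eqVneq (E i) set0.
    by rewrite E0 image_set0; apply: ediam_le.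
  apply: le_trans (fE _ E0) _; apply: (@le_trans _ _ (t%:E * (delta / t)%:E)).
    by rewrite lee_pmul2l.
  by rewrite -EFinM lee_fin mulrC divfK// gt_eqF.
apply: lee_nneseries => [i _ _|i _]; first exact: diam_pow_ge0.
have [E0|/set0P E0] := eqVneq (E i) set0.
  by rewrite E0 image_set0 !diam_pow_set0 mule0.
rewrite !diam_powE//; last by case: E0 => x Ex; exists (f x); exists x.
have f0 : 0 <= ediam (f @` E i).
  by apply: ediam_ge0; case: E0 => x Ex; exists (f x); exists x.
rewrite -expeMl_fin; apply: lee_expe => //; exact: fE.
Qed.

Lemma hausdorff_delta_le_count d (delta rho : R) (I : finType) (F : I -> set 'rV[R]_n) A :
  (rho <= delta)%R -> (0 <= rho)%R -> A `<=` \bigcup_i F i ->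
  (forall i x y, F i x -> F i y -> (enorm (x - y) <= rho)%R) ->
  hausdorff_delta d delta A <= (#|I|%:R * rho ^+ d)%:E.
Proof.
move=> rd r0 AF Fr.
(* Indices beyond the finite family get the empty set, which [diam_pow] counts as 0 even when
   [d = 0]. *)
pose E k := if insub k is Some j then F (enum_val (j : 'I_#|I|)) else set0.
have Er k x y : E k x -> E k y -> (enorm (x - y) <= rho)%R.
  by rewrite /E; case: insubP => // j _ _; exact: Fr.
have Ep k : diam_pow d (E k) <= (rho ^+ d)%:E.
  have [->|/set0P E0] := eqVneq (E k) set0.
    by rewrite diam_pow_set0 lee_fin exprn_ge0.
  rewrite diam_powE// EFin_expe; apply: lee_expe; first exact: ediam_ge0.
  by apply: ediam_le => x y Ex Ey; rewrite lee_fin; exact: Er Ey.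
apply: (@le_trans _ _ (\sum_(k <oo) diam_pow d (E k))).
  apply: ereal_inf_lbound; exists E => //; split.
    move=> x /AF[i _ Fix]; exists (enum_rank i) => //.
    by rewrite /E insubT// => lt; rewrite (_ : Sub _ _ = enum_rank i) ?enum_rankK//; exact: val_inj.
  move=> k; apply: ediam_le => x y Ex Ey; rewrite lee_fin; apply: le_trans rd; exact: Er Ey.
rewrite (nneseries_split 0 #|I|); last by move=> k _; exact: diam_pow_ge0.
rewrite add0n [X in _ + X]eseries0 ?adde0; last first.
  move=> k Ik _; rewrite /E insubF ?diam_pow_set0//.
  by rewrite ltnNge; apply/negbF; rewrite -(add0n #|I|).
rewrite big_mkord; apply: (@le_trans _ _ (\sum_(k < #|I|) (rho ^+ d)%:E)).
  by apply: lee_sum => k _; exact: Ep.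
by rewrite sumEFin sumr_const card_ord mulr_natl.
Qed.

(* The mass distribution principle. *)
Lemma le_hausdorff_mass d (m : {measure set (borel R n) -> \bar R}) (K delta : R)
  (A : set (borel R n)) : (0 < delta)%R -> (0 < K)%R -> measurable A ->
  (forall E (rho : R), (0 <= rho <= delta)%R ->
     (forall x y, E x -> E y -> (enorm (x - y) <= rho)%R) ->
     exists2 F : set (borel R n), measurable F & E `&` A `<=` F /\ m F <= (K * rho ^+ d)%:E) ->
  m A <= K%:E * hausdorff d A.
Proof.
move=> d0 K0 mA H; apply: (@le_trans _ _ (K%:E * hausdorff_delta d delta A)); last first.
  by rewrite lee_pmul2l//; exact: hausdorff_delta_le.
rewrite -lee_pdivrMl//; apply: le_ereal_inf_tmp => _ [E [AE Ed] <-].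
rewrite lee_pdivrMl// -nneseriesZl//; last by move=> i _; exact: diam_pow_ge0.
have ex i : exists2 F : set (borel R n), measurable F &
    E i `&` A `<=` F /\ m F <= K%:E * diam_pow d (E i).
  (* For an empty [E i] the diameter is [-oo] and cannot serve as [rho]. *)
  have [E0|/set0P E0] := eqVneq (E i) set0.
    by exists set0 => //; rewrite E0 set0I measure0 diam_pow_set0 mule0; split.
  have fE : ediam (E i) \is a fin_num.
    by rewrite ge0_fin_numE ?ediam_ge0// (le_lt_trans (Ed i))// ltry.
  have [||F mF [EF mFle]] := H (E i) (fine (ediam (E i))).
  - by rewrite fine_ge0 ?ediam_ge0//= -lee_fin fineK.
  - by move=> x y Ex Ey; rewrite -lee_fin fineK//; exact: ediam_ge.
  - exists F => //; split => //; apply: (le_trans mFle).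
    by rewrite diam_powE// EFinM EFin_expe fineK.
pose F i := projT1 (cid2 (ex i)).
have mF i : measurable (F i) by rewrite /F; case: cid2.
have EF i : E i `&` A `<=` F i by rewrite /F; case: cid2 => ? ? [].
have Fle i : m (F i) <= K%:E * diam_pow d (E i) by rewrite /F; case: cid2 => ? ? [].
apply: (@le_trans _ _ (\sum_(i <oo) m (F i))).
  apply: measure_sigma_subadditive => // x Ax.
  by have [i _ Eix] := AE x Ax; exists i => //; exact: EF.
by apply: lee_nneseries.
Qed.

End hausdorff_theory.

(** * Regularity of a measure inside a window of finite mass *)

Section outer_regularity.
Local Open Scope ereal_scope.
Context {R : realType} {n : nat} (m : {measure set (borel R n) -> \bar R}).
Context (W : set (borel R n)) (mW : measurable W) (W_fin : m W < +oo).
Implicit Types (A F U : set 'rV[R]_n).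

(** Approximating from inside and outside at once is symmetric under complement, so the sets with
    this property form a sigma-algebra. The window [W] of finite mass allows continuity from
    above. *)
Definition tight A := forall e : R, (0 < e)%R -> exists F U,
  [/\ closed F, open U, F `<=` A, A `<=` U & m (W `&` (U `\` F)) <= e%:E].

Lemma ereal_cvg0_lt (u : nat -> \bar R) (e : R) : u k @[k --> \oo] --> 0 -> (0 < e)%R ->
  \forall k \near \oo, u k < e%:E.
Proof.
move=> /fine_cvgP[fin /cvgrPdist_lt /[swap] e0 /(_ e e0)]; apply: filterS2 fin => k fk.
rewrite sub0r normrN => Hk.
by rewrite -(fineK fk) lte_fin (le_lt_trans (ler_norm _)).
Qed.

Lemma cvg_decreasing0 (D : nat -> set (borel R n)) : (forall k, measurable (D k)) ->
  (forall k, D k `<=` W) -> nonincreasing_seq D -> \bigcap_k D k = set0 ->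
  m (D k) @[k --> \oo] --> 0.
Proof.
move=> mD DW niD D0; rewrite -(measure0 m) -D0; apply: nonincreasing_cvg_mu => //.
- by apply: le_lt_trans W_fin; apply: measure_sub.
- by rewrite D0.
Qed.

(** The points at distance at least [1 / (k + 1)] from the complement form closed sets exhausting
    [U]. *)
Lemma tight_open U : open U -> tight U.
Proof.
move=> oU e e0; pose F (k : nat) := [set x | (k.+1%:R^-1 <= codist U x)%R].
have cF k : closed (F k).
  apply: (@closed_comp _ _ (codist U) [set t | (k.+1%:R^-1 <= t)%R]); last exact: closed_ge.
  by move=> x _; exact: (lip_continuous (codist_lip U)).
have FU k : F k `<=` U.
  move=> x Fx; apply: contrapT => Ux; move: Fx; rewrite /F /= codist_eq0//.
  by rewrite leNgt invr_gt0 ltr0n.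
have cv : m (W `&` (U `\` F k)) @[k --> \oo] --> 0.
  apply: (cvg_decreasing0 (D := fun k => W `&` (U `\` F k))).
  - move=> k; apply: measurableI => //; apply: measurableD; first exact: measurable_open.
    exact: measurable_closed.
  - by move=> k x [].
  - move=> j k jk; apply/subsetPset => x [Wx [Ux Fx]]; split => //; split => // Fjx; apply: Fx.
    by apply: le_trans Fjx; rewrite lef_pV2 ?posrE ?ltr0n// ler_nat.
  - apply/seteqP; split => // x H; have [_ [Ux _]] := H 0%N I.
    have d0 := codist_gt0 oU Ux.
    have [k] := @ltr_add_invr R 0 _ d0; rewrite add0r => kd.
    by have [_ [_]] := H k I; apply; exact: ltW.
have [k Hk] := filter_ex (ereal_cvg0_lt cv e0).
by exists (F k), U; split => //; exact: ltW.
Qed.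

Lemma tightC A : tight A -> tight (~` A).
Proof.
move=> tA e e0; have [F [U [cF oU FA AU H]]] := tA e e0.
exists (~` U), (~` F); split.
- exact: open_closedC.
- exact: closed_openC.
- exact: subsetC.
- exact: subsetC.
- suff -> : ~` F `\` ~` U = U `\` F by [].
  by rewrite setDE setCK setIC -setDE.
Qed.

(** Open sets are united as they are, but a union of closed sets must be cut at a finite stage, with
    a loss that tends to 0. Half of [e] pays for this and half for the individual errors. *)
Lemma tight_bigcup (A : nat -> set 'rV[R]_n) : (forall i, tight (A i)) -> tight (\bigcup_i A i).
Proof.
move=> tA e e0; have e20 : (0 < e / 2)%R by rewrite divr_gt0.
have ei0 i : (0 < e / 2 / (2 ^ i.+1)%:R)%R by rewrite divr_gt0// ltr0n expn_gt0.
have [F H1] := choice (fun i => tA i _ (ei0 i)); have [U H2] := choice H1.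
have cF i : closed (F i) by case: (H2 i).
have oU i : open (U i) by case: (H2 i).
have FA i : F i `<=` A i by case: (H2 i).
have AU i : A i `<=` U i by case: (H2 i).
have He i : m (W `&` (U i `\` F i)) <= (e / 2 / (2 ^ i.+1)%:R)%:E by case: (H2 i).
pose G N := \big[setU/set0]_(i < N) F i.
have cG N : closed (G N).
  by rewrite /G; apply: closed_bigsetU => i _; exact: cF.
have mF i : measurable (F i : set (borel R n)) by exact: measurable_closed.
have mU i : measurable (U i : set (borel R n)) by exact: measurable_open.
have mG N : measurable (G N : set (borel R n)) by exact: measurable_closed.
have mbF : measurable (\bigcup_i F i : set (borel R n)) by exact: bigcupT_measurable.
have cv : m (W `&` (\bigcup_i F i `\` G N)) @[N --> \oo] --> 0.
  apply: (cvg_decreasing0 (D := fun N => W `&` (\bigcup_i F i `\` G N))).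
  - by move=> k; apply: measurableI => //; exact: measurableD.
  - by move=> k x [].
  - move=> j k jk; apply/subsetPset => x [Wx [Fx Gx]]; split => //; split => // Gjx; apply: Gx.
    move: Gjx; rewrite /G -!bigcup_mkord => -[i /= ij Fix].
    by exists i => //=; exact: leq_trans jk.
  - apply/seteqP; split => // x H; have [_ [[i _ Fx] _]] := H 0%N I.
    by have [_ [_]] := H i.+1 I; apply; rewrite /G -bigcup_mkord; exists i => //=.
have [N HN] := filter_ex (ereal_cvg0_lt cv e20).
exists (G N), (\bigcup_i U i); split => //.
- by apply: bigcup_open => i _; exact: oU.
- by move=> x; rewrite /G -bigcup_mkord => -[i _ Fx]; exists i => //; exact: FA.
- by move=> x [i _ Ax]; exists i => //; exact: AU.
have mUF i : measurable (W `&` (U i `\` F i) : set (borel R n)).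
  by apply: measurableI => //; exact: measurableD.
have mb : measurable (\bigcup_i (W `&` (U i `\` F i)) : set (borel R n)).
  exact: bigcupT_measurable.
have mg : measurable (W `&` (\bigcup_i F i `\` G N) : set (borel R n)).
  by apply: measurableI => //; exact: measurableD.
apply: (@le_trans _ _ (m (\bigcup_i (W `&` (U i `\` F i))) + m (W `&` (\bigcup_i F i `\` G N)))).
  apply: (@le_trans _ _ (m (\bigcup_i (W `&` (U i `\` F i)) `|` (W `&` (\bigcup_i F i `\` G N)))));
    last exact: measureU2.
  apply: measure_sub.
  - by apply: measurableI => //; apply: measurableD => //; exact: bigcupT_measurable.
  - exact: measurableU.
  - move=> x [Wx [[i _ Ux] Gx]]; have [Fx|Fx] := pselect (F i x).
      by right; split => //; split => //; exists i.
    by left; exists i.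
rewrite (splitr e) EFinD; apply: leeD; last exact: ltW.
apply: (@le_trans _ _ (\sum_(i <oo) m (W `&` (U i `\` F i)))).
  exact: measure_sigma_subadditive.
apply: (@le_trans _ _ (\sum_(i <oo) (0 + (e / 2 / (2 ^ i.+1)%:R)%:E))).
  by apply: lee_nneseries => // i _; rewrite add0e.
apply: (le_trans (epsilon_trick (A := fun=> 0) xpredT (fun=> lexx _) (ltW e20))).
by rewrite eseries0// add0e.
Qed.

Lemma measurable_tight (A : set (borel R n)) : measurable A -> tight A.
Proof.
apply: smallest_sub; last by move=> U; exact: tight_open.
split.
- exact: tight_open open0.
- by move=> B tB; rewrite setTD; exact: tightC.
- exact: tight_bigcup.
Qed.

End outer_regularity.

(** * Coordinates and boxes in a subspace *)

Section boxes.
Context {R : realType} {n d : nat} (B : 'M[R]_(d, n)) (free_B : row_free B).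
Implicit Types (x y v : 'rV[R]_n) (a z : 'rV[R]_d) (s t : R).

Definition rowspan : set 'rV[R]_n := [set x | (x <= B)%MS].

Definition coords x : 'rV[R]_d := x *m pinvmx B.

(** Half-open in the coordinates of the basis [B], so that translates tile the subspace without
    overlap. For [d = 0] it is the origin alone. *)
Definition box s a : set 'rV[R]_n :=
  [set x | rowspan x /\ forall i, a 0 i <= coords x 0 i < a 0 i + s].

Lemma coordsK x : rowspan x -> coords x *m B = x.
Proof. exact: mulmxKpV. Qed.

Lemma coordsB z : coords (z *m B) = z.
Proof. exact: (mulmxKp free_B). Qed.

Lemma coordsD x y : coords (x + y) = coords x + coords y.
Proof. exact: mulmxDl. Qed.

Lemma coords_sub x y : coords (x - y) = coords x - coords y.
Proof. exact: mulmxBl. Qed.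

Lemma coords_subE x y i : coords (x - y) 0 i = coords x 0 i - coords y 0 i.
Proof. by rewrite coords_sub; move: (coords x) (coords y) => u v; rewrite !mxE. Qed.

Lemma coordsZ t x : coords (t *: x) = t *: coords x.
Proof. by rewrite /coords scalemxAl. Qed.

Lemma rowspanD x y : rowspan x -> rowspan y -> rowspan (x + y).
Proof. exact: addmx_sub. Qed.

Lemma rowspanZ t x : rowspan x -> rowspan (t *: x).
Proof. exact: scalemx_sub. Qed.

Lemma rowspanM z : rowspan (z *m B).
Proof. exact: submxMl. Qed.

Lemma rowspanB x y : rowspan x -> rowspan y -> rowspan (x - y).
Proof. by move=> sx sy; apply: rowspanD => //; rewrite -scaleN1r; exact: rowspanZ. Qed.

Lemma mulmx_bounded p q (M : 'M[R]_(p, q)) :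
  exists2 K, 0 < K & forall z : 'rV[R]_p, enorm (z *m M) <= K * enorm z.
Proof.
pose K := \sum_(b < q) \sum_(a < p) `|M a b|.
have K0 : 0 <= K by apply: sumr_ge0 => b _; apply: sumr_ge0.
exists (K + 1); first by rewrite ltr_wpDl.
move=> z; apply: le_trans (enorm_le_sum _) _.
apply: (@le_trans _ _ (K * enorm z)); last by rewrite ler_wpM2r ?enorm_ge0// lerDl.
rewrite mulr_suml; apply: ler_sum => b _; rewrite mxE mulr_suml.
apply: (le_trans (ler_norm_sum _ _ _)); apply: ler_sum => a _.
by rewrite normrM mulrC ler_wpM2l// normr_coord_le.
Qed.

Lemma continuous_mulmx p q (M : 'M[R]_(p, q)) : continuous (fun z : 'rV[R]_p => z *m M).
Proof.
have [K K0 HK] := mulmx_bounded M.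
move=> z A /nbhs_eballP[r r0 rA]; apply/nbhs_eballP; exists (r / K); first by rewrite divr_gt0.
move=> z'; rewrite /eball/= ltr_pdivlMr// mulrC => zz; apply: rA.
by rewrite /eball/= -mulmxBl (le_lt_trans (HK _)).
Qed.

Lemma coords_continuous i : continuous (fun x => coords x 0 i).
Proof.
have [K K0 HK] := mulmx_bounded (pinvmx B).
apply: (@continuous_elipschitz _ _ _ K) => x y.
by rewrite -coords_subE; apply: le_trans (normr_coord_le _ _) (HK _).
Qed.

(** The vectors of the subspace are those fixed by the continuous map [pinvmx B *m B]. *)
Lemma closed_rowspan : closed rowspan.
Proof.
have -> : rowspan = [set x : 'rV[R]_n | enorm (x *m (pinvmx B *m B - 1%:M)) <= 0].
  apply/seteqP; split => x /=.
    by move=> sx; rewrite mulmxBr mulmx1 mulmxA mulmxKpV// subrr enorm0.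
  rewrite le_eqVlt ltNge enorm_ge0 orbF => /eqP/enorm_eq0/eqP.
  rewrite mulmxBr mulmx1 mulmxA subr_eq0 => /eqP <-; exact: rowspanM.
apply: (@closed_comp _ _ (fun x : 'rV[R]_n => x *m (pinvmx B *m B - 1%:M)) [set y | enorm y <= 0]).
  by move=> x _; exact: continuous_mulmx.
exact: closed_enorm_le.
Qed.

Lemma measurable_rowspan : measurable (rowspan : set (borel R n)).
Proof. by apply: measurable_closed; exact: closed_rowspan. Qed.

Lemma measurable_box s a : measurable (box s a : set (borel R n)).
Proof.
have -> : box s a = rowspan `&` \bigcap_(i in [set: 'I_d])
    ((fun x => coords x 0 i) @^-1` `[a 0 i, a 0 i + s[%classic).
  apply/seteqP; split => x [sx H]; split => //.
    by move=> i _ /=; rewrite in_itv/=; exact: H.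
  by move=> i; have := H i I; rewrite /= in_itv.
apply: measurableI; first exact: measurable_rowspan.
apply: (@fin_bigcap_measurable _ (borel R n) 'I_d) => // i _; rewrite -[X in measurable X]setTI.
exact: (measurable_borel_real (coords_continuous (i := i))).
Qed.

Lemma box0P s x : box s 0 x <-> rowspan x /\ forall i, 0 <= coords x 0 i < s.
Proof.
have E i : (0 : 'rV[R]_d) 0 i = 0 by rewrite mxE.
by split=> -[sx H]; split=> // i; have := H i; rewrite E add0r.
Qed.

Lemma box_translate s a x : box s a x <-> box s 0 (x - a *m B).
Proof.
split=> [[sx H]|/box0P[sx H]]; [apply/box0P|]; split.
- by apply: rowspanB => //; exact: rowspanM.
- move=> i; rewrite coords_subE coordsB; have /andP[? ?] := H i; apply/andP; split; lra.
- by rewrite -(subrK (a *m B) x); apply: rowspanD => //; exact: rowspanM.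
- move=> i; have := H i; rewrite coords_subE coordsB => /andP[? ?]; apply/andP; split; lra.
Qed.

Lemma box_diam : exists2 K, 0 < K & forall s a x y, 0 < s -> box s a x -> box s a y ->
  enorm (x - y) <= K * s.
Proof.
have [K K0 HK] := mulmx_bounded B; exists (K * (d%:R + 1)); first by rewrite mulr_gt0// ltr_wpDl.
move=> s a x y s0 [sx Hx] [sy Hy].
rewrite -(coordsK sx) -(coordsK sy) -mulmxBl -mulrA (le_trans (HK _))// ler_wpM2l ?(ltW K0)//.
apply: le_trans (enorm_le_sum _) _; apply: (@le_trans _ _ (\sum_(i < d) s)).
  apply: ler_sum => i _; rewrite -coords_sub coords_subE ler_norml.
  have /andP[? ?] := Hx i; have /andP[? ?] := Hy i; apply/andP; split; lra.
by rewrite sumr_const card_ord -[_ *+ d]mulr_natr mulrC ler_pM2r// lerDl.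
Qed.

End boxes.

(** * Scaling of boxes, grids and nested lattices of cells *)

Section fibers.
Context {R : realType} {n d : nat} (B : 'M[R]_(d, n)) (free_B : row_free B).
Implicit Types (x y v : 'rV[R]_n) (a z : 'rV[R]_d) (s t : R) (q : {ffun 'I_d -> int}).

Lemma box_scale s t : 0 < t -> box B (t * s) 0 = (fun x => t *: x) @` box B s 0.
Proof.
move=> t0; have tn : t != 0 by rewrite gt_eqF.
apply/seteqP; split => [x /box0P[sx H]|_ [x /box0P[sx H] <-]]; last first.
  apply/box0P; split; first exact: rowspanZ.
  move=> i; rewrite coordsZ; move: (coords B x) (H i) => u; rewrite mxE => /andP[u0 us].
  by rewrite mulr_ge0 ?(ltW t0)//= ltr_pM2l.
exists (t^-1 *: x); last by rewrite scalerA mulfV// scale1r.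
apply/box0P; split; first exact: rowspanZ.
move=> i; rewrite coordsZ; move: (coords B x) (H i) => u; rewrite mxE => /andP[u0 us].
by rewrite mulr_ge0 ?invr_ge0 ?(ltW t0)//= ltr_pdivrMl.
Qed.

Lemma hausdorff_box_translate s a : hausdorff d (box B s a) = hausdorff d (box B s 0).
Proof.
have tr v (x y : 'rV[R]_n) : enorm (x + v - (y + v)) <= 1 * enorm (x - y).
  by rewrite mul1r opprD addrACA subrr addr0.
apply/eqP; rewrite eq_le; apply/andP; split.
  have := hausdorff_lipschitz d (box B s 0) ltr01 (tr (a *m B)).
  rewrite expr1n mul1e; apply: le_trans; apply: hausdorff_mono => x /(box_translate free_B) Hx.
  by exists (x - a *m B) => //; rewrite subrK.
have := hausdorff_lipschitz d (box B s a) ltr01 (tr (- (a *m B))).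
rewrite expr1n mul1e; apply: le_trans; apply: hausdorff_mono => x Hx.
by exists (x + a *m B); [apply/(box_translate free_B); rewrite addrK|rewrite addrK].
Qed.

Lemma hausdorff_box_scale s : 0 < s ->
  hausdorff d (box B s 0) = ((s ^+ d)%:E * hausdorff d (box B 1 0))%E.
Proof.
move=> s0; have sc t (t0 : 0 < t) (x y : 'rV[R]_n) : enorm (t *: x - t *: y) <= t * enorm (x - y).
  by rewrite -scalerBr enormZ ger0_norm// ltW.
have is0 : 0 < s^-1 by rewrite invr_gt0.
apply/eqP; rewrite eq_le; apply/andP; split.
  by rewrite -[in X in (X <= _)%E](mulr1 s) box_scale//; apply: hausdorff_lipschitz => //; exact: sc.
rewrite muleC -lee_pdivlMr ?exprn_gt0// muleC -exprVn.
rewrite -[X in (hausdorff d (box B X 0) <= _)%E](mulVf (lt0r_neq0 s0)) box_scale//.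
by apply: hausdorff_lipschitz => //; exact: sc.
Qed.

Definition grid (k : nat) := {ffun 'I_d -> 'I_k}.

Definition gridpt (k : nat) s (f : grid k) : 'rV[R]_d := \row_i ((f i)%:R * s).

Lemma gridptE (k : nat) s (f : grid k) i : gridpt s f 0 i = (f i)%:R * s.
Proof. by rewrite mxE. Qed.

Lemma box_floor (s c : R) (k : int) : 0 < s -> k%:~R * s <= c < k%:~R * s + s ->
  Num.floor (c / s) = k.
Proof.
move=> s0 /andP[h1 h2]; apply: floor_def.
by rewrite ler_pdivlMr// h1 ltr_pdivrMr// intrD mulrDl mul1r.
Qed.

Lemma floor_box (s c : R) : 0 < s ->
  (Num.floor (c / s))%:~R * s <= c < (Num.floor (c / s))%:~R * s + s.
Proof.
move=> s0; have /andP[h1 h2] := floor_itv (c / s).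
rewrite ler_pdivlMr// in h1; rewrite ltr_pdivrMr// intrD mulrDl mul1r in h2.
by rewrite h1 h2.
Qed.

Lemma box_tile (k : nat) s : 0 < s ->
  box B (k%:R * s) 0 = \bigcup_(f in [set: grid k]) box B s (gridpt s f).
Proof.
move=> s0; apply/seteqP; split => [x /box0P[sx H]|x [f _ [sx H]]]; last first.
  apply/box0P; split => // i; have := H i; rewrite gridptE => /andP[h1 h2].
  rewrite (le_trans _ h1) ?mulr_ge0 ?(ltW s0)//=; apply: (lt_le_trans h2).
  have fk : (f i).+1%:R <= k%:R :> R by rewrite ler_nat ltn_ord.
  by have := ler_wpM2r (ltW s0) fk; rewrite -natr1 mulrDl mul1r.
have tr (i : 'I_d) : (Num.truncn (coords B x 0 i / s)%R < k)%N /\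
   (Num.truncn (coords B x 0 i / s))%:R * s <= coords B x 0 i <
   (Num.truncn (coords B x 0 i / s))%:R * s + s.
  have /andP[h1 h2] := H i; have c0 : 0 <= coords B x 0 i / s by rewrite divr_ge0// ltW.
  have /andP[t1 t2] := truncn_itv c0.
  rewrite ler_pdivlMr// in t1; rewrite ltr_pdivrMr// -natr1 mulrDl mul1r in t2.
  split; last by rewrite t1 t2.
  by rewrite -(ltr_nat R) -(ltr_pM2r s0); apply: le_lt_trans h2.
exists [ffun i => Ordinal (tr i).1] => //; split => // i.
by rewrite gridptE ffunE /=; exact: (tr i).2.
Qed.

Lemma gridpt_inj (k : nat) s (f g : grid k) x : 0 < s ->
  box B s (gridpt s f) x -> box B s (gridpt s g) x -> f = g.
Proof.
move=> s0 [sx Hf] [_ Hg]; apply/ffunP => i; apply: val_inj => /=.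
have hf := Hf i; have hg := Hg i; rewrite !gridptE in hf hg.
have Ef := @box_floor s (coords B x 0 i) (f i)%:Z s0 hf.
have Eg := @box_floor s (coords B x 0 i) (g i)%:Z s0 hg.
by rewrite Ef in Eg; case: Eg.
Qed.

Definition cellpt s q : 'rV[R]_d := \row_i ((q i)%:~R * s).

Lemma cellptE s q i : cellpt s q 0 i = (q i)%:~R * s.
Proof. by rewrite mxE. Qed.

Definition cell s q := box B s (cellpt s q).

Definition code s x : {ffun 'I_d -> int} := [ffun i => Num.floor (coords B x 0 i / s)].

Lemma cell_code s x : 0 < s -> rowspan B x -> cell s (code s x) x.
Proof. by move=> s0 sx; split => // i; rewrite cellptE ffunE; exact: floor_box. Qed.

Lemma code_cell s q x : 0 < s -> cell s q x -> code s x = q.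
Proof.
move=> s0 [sx H]; apply/ffunP => i; rewrite ffunE; apply: box_floor => //.
by have := H i; rewrite cellptE.
Qed.

Lemma measurable_cell s q : measurable (cell s q : set (borel R n)).
Proof. exact: measurable_box. Qed.

(** The lattices are nested: if [w] and [z] are the floors of [a / (s / 2)] and [a / s], then
    [2 z <= w < 2 z + 2], so [w] determines [z]. *)
Lemma code_halve s x y : 0 < s -> code (s / 2) x = code (s / 2) y -> code s x = code s y.
Proof.
move=> s0 /ffunP H; apply/ffunP => i; have := H i; rewrite !ffunE.
move: (coords B x 0 i) (coords B y 0 i) => a b Hab.
have s20 : 0 < s / 2 by rewrite divr_gt0.
have /andP[a1 a2] := floor_box a s20; have /andP[b1 b2] := floor_box b s20.
have /andP[c1 c2] := floor_box a s0; rewrite -Hab in b1 b2.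
set w := Num.floor (a / (s / 2)) in a1 a2 b1 b2; set z := Num.floor (a / s) in c1 c2 *.
have w1 : w < 2 * z + 2.
  rewrite -(ltr_int R) intrD intrM -(ltr_pM2r s20); apply: le_lt_trans a1 _; lra.
have w2 : 2 * z < w + 1.
  rewrite -(ltr_int R) intrD intrM -(ltr_pM2r s20); lra.
have w3 : 2 * z <= w by rewrite -ltzD1.
have w4 : w + 1 <= 2 * z + 2 by rewrite lezD1.
apply/esym/box_floor => //; apply/andP; split.
  apply: le_trans b1; have : (2 * z)%:~R <= w%:~R :> R by rewrite ler_int.
  rewrite intrM -(ler_pM2r s20); lra.
apply: lt_le_trans b2 _; have : (w + 1)%:~R <= (2 * z + 2)%:~R :> R by rewrite ler_int.
rewrite !intrD intrM -(ler_pM2r s20); lra.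
Qed.

Definition trace s (S : set 'rV[R]_n) (i : nat) : set 'rV[R]_n :=
  if choice.pickle_inv i is Some q then S `&` cell s q else set0.

Lemma trace_cover s S : 0 < s -> S `<=` rowspan B -> \bigcup_i trace s S i = S.
Proof.
move=> s0 SV; apply/seteqP; split => [x [i _]|x Sx].
  by rewrite /trace; case: choice.pickle_inv => // q [].
exists (choice.pickle (code s x)) => //; rewrite /trace choice.pickleK_inv; split => //.
by apply: cell_code => //; exact: SV.
Qed.

Lemma trace_trivIset s S : 0 < s -> trivIset setT (trace s S).
Proof.
move=> s0; apply/trivIsetP => i j _ _ ij; apply/seteqP; split => // x.
rewrite /trace.
case Ei : (choice.pickle_inv i) => [q|] /=; last by case.
case Ej : (choice.pickle_inv j) => [q'|] /=; last by case.
move=> [[_ xq] [_ xq']]; move/negP: ij; apply; apply/eqP.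
have := @choice.pickle_invK {ffun 'I_d -> int} i; rewrite Ei /= => <-.
have := @choice.pickle_invK {ffun 'I_d -> int} j; rewrite Ej /= => <-.
by rewrite -(code_cell s0 xq) -(code_cell s0 xq').
Qed.

Lemma measurable_trace s (S : set (borel R n)) i : measurable S ->
  measurable (trace s S i : set (borel R n)).
Proof.
move=> mS; rewrite /trace; case: choice.pickle_inv => [q|]; last exact: measurable0.
by apply: measurableI => //; exact: measurable_cell.
Qed.

End fibers.

(** * A translation-invariant measure on a subspace is a multiple of [hausdorff] *)

Section flatness.
Local Open Scope ereal_scope.
Context {R : realType} {n d : nat} (B : 'M[R]_(d, n)) (free_B : row_free B).
Context (m : {measure set (borel R n) -> \bar R}) (radon_m : radon m).
Context (m_rowspan : m (~` rowspan B) = 0).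
Context (m_invariant : forall v, rowspan B v -> forall A : set (borel R n), measurable A ->
  m ((fun x : 'rV[R]_n => x + v)%R @^-1` A) = m A).
Context (m_neq0 : m setT != 0).
Implicit Types (x y v : 'rV[R]_n) (a : 'rV[R]_d) (s t : R) (q : {ffun 'I_d -> int}).

Lemma measure_box s a : m (box B s a) = m (box B s 0).
Proof.
rewrite -(m_invariant (rowspanM B a) (measurable_box B s a)).
congr (m _); apply/seteqP; split => x /=.
  by move=> /(box_translate free_B); rewrite addrK.
by move=> Hx; apply/(box_translate free_B); rewrite addrK.
Qed.

Lemma measure_box_lty s a : (0 < s)%R -> m (box B s a) < +oo.
Proof.
move=> s0; have [K K0 HK] := box_diam B.
have [[x Hx]|H] := pselect (exists x, box B s a x).
  apply: (@le_lt_trans _ _ (m (eball x (K * s + 1)))); last exact: radon_ball.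
  apply: measure_sub => //; first exact: measurable_box.
  by move=> y Hy; rewrite /eball/=; have := HK _ _ _ _ s0 Hy Hx; lra.
rewrite (_ : box B s a = set0) ?measure0//.
by apply/seteqP; split => // x Hx; apply: H; exists x.
Qed.

(** The grid cuts the large box into [k^d] disjoint translates of the small one; [G] lists them,
    padded with empty sets. *)
Lemma measure_tile (k : nat) s : (0 < s)%R ->
  m (box B (k%:R * s)%R 0) = (k%:R ^+ d)%:E * m (box B s 0).
Proof.
move=> s0; rewrite box_tile//.
pose G i : set (borel R n) :=
  if insub i is Some j then box B s (gridpt s (enum_val (j : 'I_#|@grid d k|))) else set0.
have GE : \bigcup_(f in [set: @grid d k]) box B s (gridpt s f) = \bigcup_i G i.
  apply/seteqP; split => [x [f _ fx]|x [i _]].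
    exists (enum_rank f) => //; rewrite /G insubT// => lt.
    by rewrite (_ : Sub _ _ = enum_rank f) ?enum_rankK//; exact: val_inj.
  by rewrite /G; case: insubP => // j _ _ Hx; exists (enum_val j).
have mG i : measurable (G i).
  by rewrite /G; case: insubP => [j _ _|_]; [exact: measurable_box|exact: measurable0].
rewrite GE measure_semi_bigcup//; last 2 first.
- apply/trivIsetP => i j _ _ ij; apply/seteqP; split => // x; rewrite /G.
  case: insubP => [u _ ui|_ []] //; case: insubP => [v _ vj|_ []]// [xu xv].
  have := gridpt_inj s0 xu xv => /enum_val_inj uv.
  by move/negP: ij; apply; rewrite -ui -vj uv.
- exact: bigcupT_measurable.
rewrite (nneseries_split 0 #|@grid d k|); last by move=> i _; exact: measure_ge0.
rewrite add0n [X in _ + X]eseries0 ?adde0; last first.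
  move=> i Ii _; rewrite /G insubF ?measure0//.
  by rewrite ltnNge; apply/negbF; rewrite -(add0n #|_|).
rewrite big_mkord (eq_bigr (fun=> m (box B s 0))); last first.
  move=> i _; rewrite /G insubT//= => lt; exact: measure_box.
have mf : m (box B s 0) \is a fin_num by rewrite ge0_fin_numE ?measure_box_lty.
rewrite -(fineK mf) sumEFin sumr_const card_ord card_ffun !card_ord -EFinM.
by rewrite -[in LHS]mulr_natl natrX.
Qed.

Let P := box B 1 0.

(** Countably many translates of the unit box cover the subspace, which carries [m]; if the box were
    null, [m] would vanish. *)
Lemma unit_box_gt0 : 0 < m P.
Proof.
rewrite lt0e measure_ge0 andbT; apply/eqP => P0.
have V0 : m (rowspan B) = 0.
  apply/eqP; rewrite eq_le measure_ge0 andbT.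
  rewrite -{1}(@trace_cover R n d B 1 (rowspan B) ltr01)//.
  apply: (@le_trans _ _ (\sum_(i <oo) m (trace B 1 (rowspan B) i))).
    apply: measure_sigma_subadditive => //.
    - by move=> i; apply: measurable_trace; exact: measurable_rowspan.
    - by apply: bigcupT_measurable => i; apply: measurable_trace; exact: measurable_rowspan.
  rewrite eseries0// => i _ _; rewrite /trace; case: choice.pickle_inv => [q|]; last exact: measure0.
  apply/eqP; rewrite eq_le measure_ge0 andbT -P0 -(measure_box 1 (cellpt 1 q)).
  apply: measure_sub; [apply: measurableI; [exact: measurable_rowspan|exact: measurable_cell]| |].
    exact: measurable_box.
  by move=> x [].
move/eqP: m_neq0; apply; apply/eqP; rewrite eq_le measure_ge0 andbT -(setvU (rowspan B)).
apply: (@le_trans _ _ (m (~` rowspan B) + m (rowspan B))).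
  by apply: measureU2; [apply: measurableC|]; exact: measurable_rowspan.
by rewrite m_rowspan V0 adde0.
Qed.

Lemma unit_box_lty : m P < +oo.
Proof. exact: measure_box_lty. Qed.

Lemma inv_nat_box (k : nat) : (0 < k)%N -> m P = (k%:R ^+ d)%:E * m (box B (k%:R^-1)%R 0).
Proof.
move=> k0; rewrite -measure_tile ?invr_gt0 ?ltr0n//.
by rewrite mulfV// pnatr_eq0 -lt0n.
Qed.

(** The [k^d] boxes of side [1 / k] tiling the unit box have diameter at most [K / k], and the
    powers of these bounds add up to [K^d] for every [k]. *)
Lemma hausdorff_unit_box_lty : hausdorff d P < +oo.
Proof.
have [K K0 HK] := box_diam B.
apply: (@le_lt_trans _ _ (K ^+ d)%:E); last exact: ltry.
apply: ge_ereal_sup => _ [delta /= d0 <-].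
have [k Hk] := @ltr_add_invr R 0 _ (divr_gt0 d0 K0); rewrite add0r in Hk.
have k0 : (0 < k.+1%:R^-1 :> R)%R by rewrite invr_gt0 ltr0n.
have PE : P = \bigcup_(f in [set: @grid d k.+1]) box B (k.+1%:R^-1)%R (gridpt (k.+1%:R^-1)%R f).
  by rewrite -box_tile// mulfV// pnatr_eq0.
apply: (@le_trans _ _ (#|@grid d k.+1|%:R * (K * k.+1%:R^-1) ^+ d)%:E).
  apply: (@hausdorff_delta_le_count _ _ _ _ _ _ (fun f => box B (k.+1%:R^-1)%R (gridpt (k.+1%:R^-1)%R f))).
  - by rewrite mulrC -ler_pdivlMr// ltW.
  - by rewrite mulr_ge0// ltW.
  - by rewrite PE.
  - by move=> f x y; exact: HK.
rewrite card_ffun !card_ord lee_fin exprMn natrX mulrCA -exprMn mulfV ?pnatr_eq0//.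
by rewrite expr1n mulr1.
Qed.

(** The point is the corner of a box of side [1 / k], whose mass [m P / k^d] tends to 0 since
    [d > 0]. *)
Lemma measure_point0 x : (0 < d)%N -> rowspan B x -> m [set x] = 0.
Proof.
move=> d0 sx; have mx : measurable ([set x] : set (borel R n)).
  by apply: measurable_closed; exact: (accessible_closed_set1 (hausdorff_accessible (@norm_hausdorff R _))).
have Pf : m P \is a fin_num by rewrite ge0_fin_numE ?unit_box_lty.
apply/eqP; rewrite eq_le measure_ge0 andbT; apply/lee_addgt0Pr => e e0; rewrite add0e.
have P0 : (0 < fine (m P))%R by rewrite fine_gt0// unit_box_gt0 unit_box_lty.
have [k Hk] := @ltr_add_invr R 0 _ (divr_gt0 e0 P0); rewrite add0r in Hk.
have k0 : (0 < k.+1%:R :> R)%R by rewrite ltr0n.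
have kd0 : (0 < k.+1%:R ^+ d :> R)%R by rewrite exprn_gt0.
have H : m [set x] <= m (box B (k.+1%:R^-1)%R 0).
  rewrite -(measure_box _ (coords B x)); apply: measure_sub => //; first exact: measurable_box.
  by move=> _ ->; split => // i; rewrite lexx/= ltrDl invr_gt0.
apply: (le_trans H); rewrite -(lee_pmul2l (x := (k.+1%:R ^+ d)%:E)) ?lte_fin// -inv_nat_box//.
rewrite -(fineK Pf) -EFinM lee_fin.
apply: (@le_trans _ _ (k.+1%:R * e)%R).
  by move: (ltW Hk); rewrite ler_pdivlMr// ler_pdivrMl.
rewrite ler_wpM2r ?(ltW e0)//; case: d d0 => // d' _.
by rewrite exprS ler_peMr ?(ltW k0)// exprn_ege1// ler1n.
Qed.

(* A set of diameter [rho] meets the unit box inside a translate of a box whose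
   side is the inverse of an integer and comparable to [rho]. *)
Lemma hausdorff_unit_box_gt0 : 0 < hausdorff d P.
Proof.
have [K K0 HK] := mulmx_bounded (pinvmx B).
have Pf : m P \is a fin_num by rewrite ge0_fin_numE ?unit_box_lty.
have P0 : (0 < fine (m P))%R by rewrite fine_gt0// unit_box_gt0 unit_box_lty.
have mP : measurable (P : set (borel R n)) by exact: measurable_box.
(* A box of side [1 / k <= 6 * K * rho] has mass [m P / k^d <= L * rho ^+ d]. *)
pose L := ((6 * K) ^+ d * fine (m P))%R.
have L0 : (0 < L)%R by rewrite mulr_gt0// exprn_gt0// mulr_gt0.
have delta0 : (0 < (3 * K)^-1)%R by rewrite invr_gt0 mulr_gt0.
suff H : m P <= L%:E * hausdorff d P.
  rewrite lt0e hausdorff_ge0 andbT; apply/eqP => h0; move: H.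
  by rewrite h0 mule0 leNgt unit_box_gt0.
apply: (le_hausdorff_mass delta0 L0) => // E rho /andP[rho0 rhod] Erho.
have [[e [Ee Pe]]|EP] := pselect (exists x, (E `&` P) x); last first.
  exists set0 => //; split; first by move=> x Hx; apply: EP; exists x.
  by rewrite measure0 lee_fin mulr_ge0 ?(ltW L0)// exprn_ge0.
have se : rowspan B e by case: Pe.
(* There is no box of side comparable to [rho = 0]. The whole unit box serves if [d = 0], where
   [rho ^+ d = 1], and a null singleton otherwise. *)
move: rho0; rewrite le_eqVlt => /predU1P[rho0|rho0].
  have [d0|d0] := posnP d.
    exists P => //; split; first by move=> x [].
    by rewrite -(fineK Pf) lee_fin /L d0 !expr0 mul1r mulr1.
  exists [set e]; first by apply: measurable_closed;
    exact: (accessible_closed_set1 (hausdorff_accessible (@norm_hausdorff R _))).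
  split; last by rewrite measure_point0// lee_fin mulr_ge0 ?(ltW L0)// exprn_ge0// -rho0.
  move=> x [Ex _]; have := Erho x e Ex Ee; rewrite -rho0 => H.
  apply/eqP; rewrite -subr_eq0; apply/eqP/enorm_eq0/eqP.
  by rewrite eq_le H enorm_ge0.
have t1 : (1 <= (3 * K * rho)^-1)%R.
  rewrite -[leLHS]invr1 lef_pV2 ?posrE ?mulr_gt0//.
  by rewrite mulrC -ler_pdivlMr ?mulr_gt0// div1r.
(* Rounding down gives [3 * K * rho <= 1 / k <= 6 * K * rho]; the bound [rho <= (3 * K)^-1] ensures
   that [k] is not 0. *)
pose k := Num.truncn ((3 * K * rho)^-1)%R.
have /andP[k1 k2] : ((k%:R : R) <= (3 * K * rho)^-1 < k.+1%:R)%R.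
  by apply: truncn_itv; apply: le_trans t1.
have k0 : (0 < k)%N.
  by rewrite lt0n; apply/eqP => kE; move: k2; rewrite kE ltNge t1.
have kR0 : (0 < k%:R :> R)%R by rewrite ltr0n.
have k0' : (0 < k%:R^-1 :> R)%R by rewrite invr_gt0.
have side1 : (3 * K * rho <= k%:R^-1)%R.
  by rewrite -[leLHS]invrK lef_pV2 ?posrE ?invr_gt0 ?mulr_gt0.
have side2 : (k%:R^-1 <= 6 * K * rho)%R.
  rewrite -[leRHS]invrK lef_pV2 ?posrE ?invr_gt0 ?mulr_gt0//.
  have kk : (k.+1%:R <= 2 * k%:R :> R)%R by rewrite -natrM ler_nat mul2n -addnn -addn1 leq_add2l.
  have -> : (6 * K * rho)^-1%R = ((3 * K * rho)^-1 / 2)%R by field; rewrite !gt_eqF.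
  by rewrite ler_pdivrMr// (mulrC k%:R); apply: le_trans kk; exact: ltW.
(* Coordinates of points of the set differ from those of [e] by at most [K * rho]. A side of at
   least [3 * K * rho], rather than [2 * K * rho], leaves the strict inequality that a half-open box
   demands. *)
pose a : 'rV[R]_d := (coords B e - const_mx (K * rho))%R.
have aE i : (a 0 i = coords B e 0 i - K * rho)%R.
  by rewrite /a; move: (coords B e) => u; rewrite !mxE.
exists (box B (k%:R^-1)%R a); first exact: measurable_box.
split.
  move=> x [Ex [sx _]]; split => // i; rewrite aE.
  have h : (`|coords B x 0 i - coords B e 0 i| <= K * rho)%R.
    rewrite -coords_subE; apply: le_trans (normr_coord_le _ _) _; apply: (le_trans (HK _)).
    by rewrite ler_pM2l//; exact: Erho.
  have Kr : (0 < K * rho)%R by rewrite mulr_gt0.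
  have s1 : (3 * (K * rho) <= k%:R^-1)%R by rewrite mulrA.
  by move: h; rewrite ler_norml => /andP[? ?]; apply/andP; split; lra.
have kd0 : (0 < k%:R ^+ d :> R)%R by rewrite exprn_gt0.
rewrite measure_box -(lee_pmul2l (x := (k%:R ^+ d)%:E)) ?lte_fin// -inv_nat_box//.
rewrite -(fineK Pf) -EFinM lee_fin /L.
have -> : (k%:R ^+ d * ((6 * K) ^+ d * fine (m P) * rho ^+ d) =
    (k%:R * (6 * K * rho)) ^+ d * fine (m P))%R by rewrite !exprMn; ring.
rewrite ler_peMl ?(ltW P0)// exprn_ege1//.
by rewrite mulrC -ler_pdivrMr// div1r.
Qed.

Let kappa := (fine (hausdorff d P) / fine (m P))%R.

Lemma kappa_gt0 : (0 < kappa)%R.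
Proof.
by rewrite divr_gt0// fine_gt0// ?unit_box_gt0 ?unit_box_lty// hausdorff_unit_box_gt0
  hausdorff_unit_box_lty.
Qed.

Lemma kappa_unit_box : hausdorff d P = kappa%:E * m P.
Proof.
have Pf : m P \is a fin_num by rewrite ge0_fin_numE ?unit_box_lty.
have Hf : hausdorff d P \is a fin_num.
  by rewrite ge0_fin_numE ?hausdorff_ge0 ?hausdorff_unit_box_lty.
have P0 : (0 < fine (m P))%R by rewrite fine_gt0// unit_box_gt0 unit_box_lty.
by rewrite -(fineK Pf) -EFinM /kappa divfK ?gt_eqF// fineK.
Qed.

(** The scaling of [m] in the side comes from tiling, hence is available for integers and their
    inverses; dyadic cells and the large boxes used below have such sides. *)
Lemma kappa_nat_box (k : nat) a : (0 < k)%N ->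
  hausdorff d (box B k%:R a) = kappa%:E * m (box B k%:R a).
Proof.
move=> k0; have kR0 : (0 < k%:R :> R)%R by rewrite ltr0n.
rewrite hausdorff_box_translate// measure_box hausdorff_box_scale// kappa_unit_box.
by rewrite -[in RHS](mulr1 k%:R) measure_tile// muleCA.
Qed.

Lemma kappa_inv_nat_box (k : nat) a : (0 < k)%N ->
  hausdorff d (box B (k%:R^-1)%R a) = kappa%:E * m (box B (k%:R^-1)%R a).
Proof.
move=> k0; have kR0 : (0 < k%:R :> R)%R by rewrite ltr0n.
rewrite hausdorff_box_translate// measure_box hausdorff_box_scale ?invr_gt0// kappa_unit_box.
rewrite (inv_nat_box k0) !muleA; congr (_ * _); rewrite -!EFinM; congr EFin.
by rewrite mulrAC -exprMn mulVf ?gt_eqF// expr1n mul1r.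
Qed.

(** On the countable partition into cells, [m] is additive and [hausdorff] is subadditive, which is
    the right direction for this inequality. *)
Lemma le_of_cells s (S : set (borel R n)) : (0 < s)%R -> measurable S -> S `<=` rowspan B ->
  (forall q, hausdorff d (S `&` cell B s q) <= kappa%:E * m (S `&` cell B s q)) ->
  hausdorff d S <= kappa%:E * m S.
Proof.
move=> s0 mS SV H.
have mT i : measurable (trace B s S i : set (borel R n)) by exact: measurable_trace.
have -> : m S = \sum_(i <oo) m (trace B s S i).
  rewrite -{1}(trace_cover s0 SV) measure_semi_bigcup//.
  - exact: trace_trivIset.
  - exact: bigcupT_measurable.
rewrite -{1}(trace_cover s0 SV); apply: le_trans (hausdorff_sigma_subadditive d _) _.
rewrite -nneseriesZl; last by move=> i _; exact: measure_ge0.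
apply: lee_nneseries => [i _ _|i _]; first exact: hausdorff_ge0.
rewrite /trace; case: choice.pickle_inv => [q|]; first exact: H.
by rewrite hausdorff_set0 measure0 mule0.
Qed.

Lemma cell_halve s q x y : (0 < s)%R -> cell B (s / 2)%R q x -> cell B (s / 2)%R q y ->
  code B s x = code B s y.
Proof.
move=> s0 xq yq; have s20 : (0 < s / 2)%R by rewrite divr_gt0.
by apply: code_halve => //; rewrite (code_cell s20 xq) (code_cell s20 yq).
Qed.

(** The points whose cell of side [2^-k] lies in [U] form an increasing sequence exhausting the
    trace of [U] on the subspace. Its successive differences are unions of cells, on which
    [hausdorff d] equals [kappa] times [m]. *)
Lemma le_open (U : set 'rV[R]_n) : open U ->
  hausdorff d (U `&` rowspan B) <= kappa%:E * m (U `&` rowspan B).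
Proof.
move=> oU; pose s k : R := ((2 ^ k)%:R^-1)%R.
have s0 k : (0 < s k)%R by rewrite invr_gt0 ltr0n expn_gt0.
have sS k : s k.+1 = (s k / 2)%R by rewrite /s expnS natrM invfM mulrC.
pose V k : set (borel R n) := [set x | rowspan B x /\ cell B (s k) (code B (s k) x) `<=` U].
have Vcode k x y : V k x -> rowspan B y -> code B (s k) x = code B (s k) y -> V k y.
  by move=> [sx Hx] sy E; split => //; rewrite -E.
have mV k : measurable (V k).
  pose W i : set (borel R n) := if choice.pickle_inv i is Some q then
     if `[< cell B (s k) q `<=` U >] then cell B (s k) q else set0 else set0.
  have -> : V k = \bigcup_i W i.
    apply/seteqP; split => [x [sx Hx]|x [i _]].
      exists (choice.pickle (code B (s k) x)) => //; rewrite /W choice.pickleK_inv.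
      by rewrite asboolT//; exact: cell_code.
    rewrite /W; case: choice.pickle_inv => // q; case: asboolP => // qU xq.
    by split; [case: xq|rewrite (code_cell (s0 k) xq)].
  apply: bigcupT_measurable => i; rewrite /W; case: choice.pickle_inv => [q|]; last exact: measurable0.
  by case: asboolP => _; [exact: measurable_cell|exact: measurable0].
have VU k : V k `<=` U `&` rowspan B.
  by move=> x [sx Hx]; split => //; apply: Hx; exact: cell_code.
have ndV : nondecreasing_seq V.
  apply/nondecreasing_seqP => k; apply/subsetPset => x [sx Hx]; split => //.
  move=> y yx; apply: Hx; have sy : rowspan B y by case: yx.
  rewrite sS in yx; have xx : cell B (s k / 2)%R (code B (s k / 2)%R x) x.
    by apply: cell_code => //; rewrite divr_gt0.
  by rewrite (cell_halve (s0 k) xx yx); exact: cell_code.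
have bV : \bigcup_k V k = U `&` rowspan B.
  apply/seteqP; split => [x [k _ Vx]|x [Ux sx]]; first exact: VU Vx.
  have /nbhs_eballP[r r0 rU] : nbhs x U by exact: open_nbhs_nbhs.
  have [K K0 HK] := box_diam B.
  have [k Hk] := @ltr_add_invr R 0 _ (divr_gt0 r0 K0); rewrite add0r in Hk.
  exists k => //; split => // y yx; apply: rU; rewrite /eball/=.
  apply: (le_lt_trans (HK _ _ _ _ (s0 k) yx (cell_code (s0 k) sx))).
  rewrite mulrC -ltr_pdivlMr//; apply: le_lt_trans Hk.
  by rewrite lef_pV2 ?posrE ?ltr0n ?expn_gt0// ler_nat ltn_expl.
have mD k : measurable (seqD V k) by case: k => [|k] //=; exact: measurableD.
have Dk k : hausdorff d (seqD V k) <= kappa%:E * m (seqD V k).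
  apply: (le_of_cells (s0 k)) => //.
    by case: k => [|k] x; [case|case; case].
  (* A cell that meets the difference is contained in it: membership in [V k] depends only on the
     cell of side [s k], and the lattices are nested. *)
  move=> q; have [[x [Dx xq]]|H] := pselect (exists x, (seqD V k `&` cell B (s k) q) x); last first.
    rewrite (_ : _ `&` _ = set0) ?hausdorff_set0 ?measure0 ?mule0//.
    by apply/seteqP; split => // x Hx; apply: H; exists x.
  rewrite (_ : _ `&` _ = cell B (s k) q); first by rewrite /cell kappa_inv_nat_box// expn_gt0.
  apply/seteqP; split => [y []//|y yq]; split => //.
  have sy : rowspan B y by case: yq.
  have sx : rowspan B x by case: xq.
  have E : code B (s k) x = code B (s k) y.
    by rewrite (code_cell (s0 k) xq) (code_cell (s0 k) yq).
  case: k Dx xq yq E => [|k] /=; first by move=> Vx _ _ E; exact: Vcode Vx sy E.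
  rewrite sS => -[Vx nVx] xq yq E; split.
    by apply: Vcode Vx sy _; rewrite sS.
  move=> Vy; apply: nVx; apply: Vcode Vy sx _.
  exact: (cell_halve (s0 k) yq xq).
rewrite -bV -(eq_bigcup_seqD V).
rewrite measure_semi_bigcup//; last 2 first.
- exact: trivIset_seqD.
- exact: bigcupT_measurable.
apply: le_trans (hausdorff_sigma_subadditive d _) _.
rewrite -nneseriesZl; last by move=> i _; exact: measure_ge0.
by apply: lee_nneseries => [i _ _|i _]; [exact: hausdorff_ge0|exact: Dk].
Qed.

(** Regularity inside [eball 0 r], with tolerance [e / kappa], reduces the bound to an open set. *)
Lemma le_bounded (A : set (borel R n)) r : measurable A -> A `<=` rowspan B ->
  A `<=` eball 0 r -> hausdorff d A <= kappa%:E * m A.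
Proof.
move=> mA AV Ar; have k0 := kappa_gt0; apply/lee_addgt0Pr => e e0.
have ek0 : (0 < e / kappa)%R by rewrite divr_gt0.
have mW : measurable (eball 0 r : set (borel R n)) by [].
have Wfin : m (eball 0 r) < +oo by exact: radon_ball.
have [F [U [cF oU FA AU H]]] := measurable_tight mW Wfin mA ek0.
have oWU : open (eball 0 r `&` U) by apply: openI => //; exact: open_eball.
have mU : measurable (U : set (borel R n)) by exact: measurable_open.
have mF : measurable (F : set (borel R n)) by exact: measurable_closed.
apply: (@le_trans _ _ (hausdorff d (eball 0 r `&` U `&` rowspan B))).
  apply: hausdorff_mono => x Ax; split; last exact: AV.
  by split; [exact: Ar|exact: AU].
apply: le_trans (le_open oWU) _.
have -> : e%:E = kappa%:E * (e / kappa)%:E by rewrite -EFinM mulrC divfK// gt_eqF.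
rewrite -muleDr//; last by rewrite ge0_adde_def// inE ?measure_ge0// lee_fin ltW.
rewrite lee_pmul2l//.
have mD : measurable (eball 0 r `&` (U `\` F) : set (borel R n)).
  by apply: measurableI => //; exact: measurableD.
apply: (@le_trans _ _ (m (A `|` (eball 0 r `&` (U `\` F))))).
  apply: measure_sub.
  - apply: measurableI; last exact: measurable_rowspan.
    exact: measurable_open.
  - exact: measurableU.
  - move=> x [[xr Ux] _]; have [Fx|Fx] := pselect (F x); first by left; exact: FA.
    by right.
apply: (@le_trans _ _ (m A + m (eball 0 r `&` (U `\` F)))); last by rewrite leeD2l.
exact: measureU2.
Qed.

Lemma hausdorff_le_measure (A : set (borel R n)) : measurable A -> A `<=` rowspan B ->
  hausdorff d A <= kappa%:E * m A.
Proof.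
move=> mA AV; apply: (le_of_cells ltr01) => // q.
have [[x [Ax xq]]|H] := pselect (exists x, (A `&` cell B 1 q) x); last first.
  rewrite (_ : _ `&` _ = set0) ?hausdorff_set0 ?measure0 ?mule0//.
  by apply/seteqP; split => // x Hx; apply: H; exists x.
have [K K0 HK] := box_diam B.
apply: (@le_bounded _ (K * 1 + enorm x + 1)%R).
- by apply: measurableI => //; exact: measurable_cell.
- by move=> y [Ay _]; exact: AV.
- move=> y [_ yq]; rewrite /eball/=; have h := HK _ _ _ _ ltr01 yq xq.
  by have := enorm_distD x y 0; rewrite !subr0; lra.
Qed.

(** In a large box [Q], [kappa m(Q) = H(Q) <= H(A & Q) + H(Q - A) <= H(A & Q) + kappa m(Q - A)],
    where [H] is [hausdorff d]. Cancelling the finite term [kappa m(Q - A)] gives the bound for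
    [A & Q], and the boxes exhaust the subspace. *)
Lemma measure_le_hausdorff (A : set (borel R n)) : measurable A -> A `<=` rowspan B ->
  m A <= (kappa^-1)%:E * hausdorff d A.
Proof.
move=> mA AV; have k0 := kappa_gt0.
pose Q (N : nat) := box B (N.+1.*2)%:R (const_mx (- N.+1%:R)%R).
have mQ N : measurable (Q N : set (borel R n)) by exact: measurable_box.
have QP N x : Q N x <-> rowspan B x /\ forall i, (- N.+1%:R <= coords B x 0 i < N.+1%:R)%R.
  split=> -[sx H]; split => // i; have := H i; rewrite (_ : const_mx _ 0 i = - N.+1%:R)%R ?mxE//;
  by rewrite -muln2 natrM => /andP[? ?]; apply/andP; split; lra.
have ndQ : nondecreasing_seq (fun N => A `&` Q N).
  move=> j k jk; apply/subsetPset => x [Ax /QP[sx H]]; split => //; apply/QP; split => // i.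
  have jkR : (j.+1%:R <= k.+1%:R :> R)%R by rewrite ler_nat.
  by have /andP[? ?] := H i; apply/andP; split; lra.
have bQ : \bigcup_N (A `&` Q N) = A.
  apply/seteqP; split => [x [N _ []]//|x Ax].
  exists (Num.bound (enorm (coords B x))) => //; split => //; apply/QP; split; first exact: AV.
  move=> i; have h := normr_coord_le (coords B x) i.
  have := archi_boundP (enorm_ge0 (coords B x)).
  set N := Num.bound _ => hN; have NN : (N%:R <= N.+1%:R :> R)%R by rewrite ler_nat.
  by move: h; rewrite ler_norml => /andP[? ?]; apply/andP; split; lra.
have HN N : m (A `&` Q N) <= (kappa^-1)%:E * hausdorff d A.
  have mAQ : measurable (A `&` Q N : set (borel R n)) by exact: measurableI.
  have mQA : measurable (Q N `\` A : set (borel R n)) by exact: measurableD.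
  have Qf : m (Q N) < +oo by apply: measure_box_lty; rewrite ltr0n.
  have QAf : m (Q N `\` A) \is a fin_num.
    rewrite ge0_fin_numE//; apply: le_lt_trans Qf; apply: measure_sub => // x [].
  have QE : m (Q N) = m (A `&` Q N) + m (Q N `\` A).
    rewrite -measureU//; last by apply/seteqP; split => // x [[Ax _] [_ nAx]].
    congr (m _); apply/seteqP; split => x; last by case=> [[]|[]].
    by move=> Qx; have [Ax|Ax] := pselect (A x); [left|right].
  rewrite lee_pdivlMl//; apply: (@le_trans _ _ (hausdorff d (A `&` Q N))); last first.
    by apply: hausdorff_mono => x [].
  have kf : kappa%:E * m (Q N `\` A) \is a fin_num by rewrite fin_numM.
  rewrite -(leeD2rE _ _ kf) -muleDr//; last by rewrite ge0_adde_def// inE measure_ge0.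
  rewrite -QE -kappa_nat_box ?double_gt0//.
  apply: (@le_trans _ _ (hausdorff d (A `&` Q N) + hausdorff d (Q N `\` A))).
    apply: le_trans (hausdorffU d _ _); apply: hausdorff_mono => x Qx.
    by have [Ax|Ax] := pselect (A x); [left|right].
  by rewrite leeD2l// hausdorff_le_measure// => x [[]].
have cv : m (A `&` Q N) @[N --> \oo] --> m A.
  rewrite -{2}bQ; apply: nondecreasing_cvg_mu => //.
  - by move=> N; exact: measurableI.
  - by rewrite bQ.
have <- : lim (m (A `&` Q N) @[N --> \oo]) = m A by exact: (cvg_lim _ cv).
apply: lime_le; first by apply/cvg_ex; exists (m A).
exact: nearW.
Qed.

Lemma invariant_measure_hausdorff : exists2 c : R, (0 <= c)%R &
  forall A : set (borel R n), measurable A -> m A = c%:E * hausdorff d (A `&` rowspan B).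
Proof.
have k0 := kappa_gt0; exists kappa^-1%R; first by rewrite invr_ge0 ltW.
move=> A mA; have mV : measurable (rowspan B : set (borel R n)) := measurable_rowspan B.
have mAV : measurable (A `&` rowspan B : set (borel R n)) by exact: measurableI.
have -> : m A = m (A `&` rowspan B).
  have mAC : measurable (A `&` ~` rowspan B : set (borel R n)).
    by apply: measurableI => //; exact: measurableC.
  have -> : m A = m (A `&` rowspan B) + m (A `&` ~` rowspan B).
    rewrite -measureU//; first by rewrite -setIUr setUCr setIT.
    by rewrite setIACA setICr !setI0.
  rewrite [X in _ + X](_ : _ = 0) ?adde0//.
  apply/eqP; rewrite eq_le measure_ge0 andbT -m_rowspan.
  by apply: measure_sub => //; exact: measurableC.
apply/eqP; rewrite eq_le; apply/andP; split.
  by apply: measure_le_hausdorff => // x [].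
by rewrite lee_pdivrMl//; apply: hausdorff_le_measure => // x [].
Qed.

End flatness.

(** * The span of the support, and the conclusion *)

Section flat_tangents.
Context {R : realType} {n : nat}.
Implicit Types m : {measure set (borel R n) -> \bar R}.

(** Take linearly independent vectors of [S] in maximal number: a vector of [S] outside their span
    could be added. The rows lie in [S] itself because invariance is first known along support
    vectors. *)
Lemma exists_free_rows (S : set 'rV[R]_n) : exists d (B : 'M[R]_(d, n)),
  [/\ row_free B, forall i, S (row i B) & S `<=` rowspan B].
Proof.
pose Q (d : nat) := exists B : 'M[R]_(d, n), row_free B /\ forall i, S (row i B).
have Q0 : exists d, `[< Q d >].
  by exists 0%N; apply/asboolP; exists 0; split; [rewrite /row_free mxrank0|case].
have Qn d : `[< Q d >] -> (d <= n)%N.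
  move=> /asboolP[B [fB _]]; have := rank_leq_col B.
  by move: fB; rewrite /row_free => /eqP ->.
have [d /asboolP[B [fB BS]] dmax] := ex_maxnP Q0 Qn; exists d, B; split => // x Sx.
rewrite /rowspan /=; apply: contrapT => /negP xB.
suff : (d + 1 <= d)%N by rewrite addn1 ltnn.
apply: dmax; apply/asboolP; exists (col_mx B x); split; last first.
  move=> i; have [j ->|j ->] := split_ordP i; first by rewrite rowKu.
  rewrite rowKd (_ : row j x = x)//.
  by apply/rowP => l; rewrite mxE (ord1 j).
rewrite /row_free eqn_leq rank_leq_row/= -addsmxE addn1.
have : (B < B + x)%MS.
  by rewrite ltmxE addsmxSl/=; apply: contra xB; apply: submx_trans; exact: addsmxSr.
by move=> /rank_ltmx; move: fB; rewrite /row_free => /eqP ->.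
Qed.

Lemma invariant_rowspan m d (B : 'M[R]_(d, n)) :
  (forall i (t : R), scales m (fun x => x + t *: row i B) 1) ->
  forall v, rowspan B v -> scales m (fun x => x + v) 1.
Proof.
move=> H v /submxP[z ->]; rewrite mulmx_sum_row.
elim/big_ind : _ => [|u w su sw|i _]; last exact: H.
  by move=> phi tp; rewrite mul1r; congr tint; apply/funext => x; rewrite addr0.
move=> phi tp; have := scales_comp ltr01 (dilates_translation u) su sw tp.
by rewrite mulr1 => <-; congr tint; apply/funext => x; rewrite -addrA (addrC w).
Qed.

(** The image of [m] under the translation is a Radon measure with the same integrals of test
    functions, so it agrees with [m] on Borel sets. *)
Lemma scales1_invariant m v : radon m -> scales m (fun x => x + v) 1 ->
  forall A : set (borel R n), measurable A -> m ((fun x : 'rV[R]_n => x + v) @^-1` A) = m A.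
Proof.
move=> rm sv A mA; have dv := @dilates_translation R n v.
pose pm := pushforward_measure m (measurable_dilates dv).
have rpm : radon pm.
  move=> x; exists 1 => //; apply: (@le_lt_trans _ _ (m (eball (x - v) 1))); last exact: radon_ball.
  rewrite /pm /= /pushforward le_eqVlt; apply/orP; left; apply/eqP; congr (m _).
  by apply/seteqP; split => y; rewrite /eball/= opprB addrA.
have E phi : test_fun phi -> tint pm phi = tint m phi.
  move=> tp; rewrite /tint /pm (integral_pushforward_test ltr01 dv rm tp) /=.
  by rewrite (sv phi tp) mul1r.
exact: (radon_measure_eq rpm rm E mA).
Qed.

Lemma rowspan_vspace d (B : 'M[R]_(d, n)) : row_free B -> exists2 V : {vspace 'rV[R]_n},
  \dim V = d & [set y | y \in V] = rowspan B.
Proof.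
move=> fB; pose f := linfun (mulmxr B : 'rV[R]_d -> 'rV[R]_n).
exists (f @: fullv)%VS.
  have kf : lker f == 0%VS.
    apply/lker0P => u w; rewrite !lfunE /= => /(congr1 (mulmxr (pinvmx B))) /=.
    by rewrite !mulmxKp.
  by rewrite limg_dim_eq ?(eqP kf) ?capv0// dimvf dim_matrix mul1r.
apply/seteqP; split => [y /memv_imgP[z _ ->]|y /submxP[z ->]].
  by rewrite lfunE /=; exact: rowspanM.
by apply/memv_imgP; exists z; rewrite ?memvf// lfunE.
Qed.

End flat_tangents.

Theorem theorem1p3 (R : realType) (n : nat)
    (mu : {measure set (borel R n) -> \bar R}) (l1 l2 : R)
    (mu_doubling : doubling mu) (l1_gt1 : 1 < l1) (l1_lt_l2 : l1 < l2) :
  forall x, Sigma0 mu l1 l2 x -> Tan mu x `<=` flat.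
Proof.
move=> x [sx alpha0] sigma [rsigma [A0 mA0 sigmaA0] [rk [ak [rk0 rk_cvg ak0 wcvg]]]].
have [rmu [C C0 dbl]] := mu_doubling.
have dblR y r : msupport mu y -> 0 < r -> mball mu y (2 * r) <= C * mball mu y r.
  by move=> sy r0; rewrite -lee_fin EFinM -!mballE//; exact: dbl.
have cvgJ phi : test_fun phi ->
    ak k * tint mu (fun z => phi ((rk k)^-1 *: (z - x))) @[k --> \oo] --> tint sigma phi.
  move=> tp; have := wcvg phi (test_continuous tp) (compact_test_support tp).
  rewrite tintE// (_ : (fun k => _) =
    (fun k => (ak k * tint mu (fun z => phi ((rk k)^-1 *: (z - x))))%:E)).
    by move=> /fine_cvgP[_].
  by apply/funext => k; rewrite integral_blowup.
have [p sp] := msupport_ex mA0 sigmaA0.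
have s0 := support_tangent0 rmu rsigma C0 dblR sx rk0 ak0 cvgJ sp.
have selfsim y : msupport sigma y -> exists (A : 'M[R]_n) lam,
    [/\ 0 < lam, lam <= l1^-1, conformal lam A & symmetry sigma (fun v => (v - y) *m A + y)].
  exact: (self_similar_tangent rmu rsigma C0 dblR l1_gt1 l1_lt_l2 sx alpha0 rk0 rk_cvg ak0 cvgJ).
have q1 : l1^-1 < 1 by rewrite invf_lt1// (lt_trans ltr01).
have [d [B [fB rowsB suppB]]] := exists_free_rows (msupport sigma).
have inv v (vB : rowspan B v) : scales sigma (fun y => y + v) 1.
  apply: invariant_rowspan vB => i t.
  exact: (invariant_line rsigma q1 selfsim s0 t (rowsB i)).
have nul : sigma (~` rowspan B) = 0%E.
  apply/eqP; rewrite eq_le measure_ge0 andbT -(msupportC_null sigma).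
  apply: measure_sub; [apply: measurableC; exact: measurable_rowspan| |exact: subsetC].
  by apply: measurable_open; apply: closed_openC; exact: closed_msupport.
have nz : sigma setT != 0%E.
  apply: contra sigmaA0 => /eqP s00; rewrite eq_le measure_ge0 andbT -s00.
  exact: measure_sub.
have [c c0 sigmaE] := invariant_measure_hausdorff fB rsigma nul
  (fun v vB => scales1_invariant rsigma (inv v vB)) nz.
have [V dV VE] := rowspan_vspace fB.
exists d.
  by have := rank_leq_col B; move: fB; rewrite /row_free => /eqP ->.
by exists c, V; split => // A mA; rewrite VE; exact: sigmaE.
Qed.
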